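(* Let $(X_t)_{t\ge0}$ be a free Lévy process such that $\tau(X_t)=0$ and $\tau(X_t^2)=t$ for all $t$, and suppose there are constants $\eta,\sigma\in\mathbb{R}$ and a normalizing function $C_{t,u}$ (real-valued) such that for all $t<u$ $$\mathrm{Var}(X_t\mid X_u)=C_{t,u}\Bigl(1+\frac{\eta}{u}X_u+\frac{\sigma}{u^2}X_u^2\Bigr).$$ Then for all $s,t>0$ the increment $X_{s+t}-X_s$ has the free Meixner $\mu_{a,b}$-type law with parameters $a=\eta/\sqrt{t}\in\mathbb{R}$, $b=\sigma/t\ge0$. Moreover, the $R$-transform of $X_t$ is $$r_{X_t}(z)=\frac{2zt}{1-\eta z+\sqrt{(1-\eta z)^2-4z^2\sigma}}.$$
   Context: $\mathcal{A}$ is a von Neumann algebra with unit $1$ and a normal faithful tracial state $\tau$. A random variable is a self-adjoint element of $\mathcal{A}$; its law is the unique probability measure $\mu$ on $\mathbb{R}$ with $\tau(X^n)=\int x^n\,d\mu$ for all $n\ge0$. Freeness is in the sense of Voiculescu with respect to $\tau$. For a random variable $S$, $\tau(\cdot\mid S)$ is the unique $\tau$-preserving conditional expectation from $\mathcal{A}$ onto the von Neumann algebra generated by $S$, and $\mathrm{Var}(X\mid S)=\tau(X^2\mid S)-(\tau(X\mid S))^2$. A (non-commutative) stochastic process $(X_t)_{t\ge0}$ is a family of random variables in $\mathcal{A}$ indexed by $[0,\infty)$. It is a free Lévy process if: the law of $X_t$ converges to $\delta_0$ as $t\to0$; it has free increments, i.e. for every $t_1<t_2<\dots<t_k$ the random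 variables $X_{t_1},X_{t_2}-X_{t_1},\dots,X_{t_k}-X_{t_{k-1}}$ are free; and it has stationary increments, i.e. for $s<t$ the law of $X_t-X_s$ equals the law of $X_{t-s}$. The $R$-transform is $r_X(z)=\sum_{k\ge0}R_{k+1}(X)z^k$, where $R_k(X)$ are the free cumulants of $X$; the square root in the $R$-transform formulas is the branch equal to $1$ at $z=0$. Free Meixner laws: for $a\in\mathbb{R}$, $b\ge-1$, $\mu_{a,b}$ is the probability measure on $\mathbb{R}$ (mean $0$, variance $1$) with Cauchy–Stieltjes transform $$\int_{\mathbb{R}}\frac{1}{z-y}\,\mu_{a,b}(dy)=\frac{(1+2b)z+a-\sqrt{(z-a)^2-4(1+b)}}{2(bz^2+az+1)},$$ with the branch of the square root behaving like $z$ as $z\to\infty$; equivalently $r_{\mu_{a,b}}(z)=\dfrac{2z}{1-az+\sqrt{(1-az)^2-4z^2b}}$. A $\mu$-type law is the law of an affine function of a random variable with law $\mu$. *)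

(* Defs.v *)
From HB Require Import structures.
From mathcomp Require Import all_boot all_order all_algebra.
From mathcomp Require Import complex.
From mathcomp Require Import all_classical all_reals all_analysis.

Set Implicit Arguments.
Unset Strict Implicit.
Unset Printing Implicit Defensive.

Import Order.TTheory GRing.Theory Num.Theory.
Import numFieldNormedType.Exports.

Local Open Scope classical_set_scope.
Local Open Scope complex_scope.
Local Open Scope ring_scope.

Section VonNeumann.
Variables (R : realType) (H : completeNormedModType R[i]).

Definition hilbert_product (ip : {dot H for Num.conj}) :=
  forall x : H, `|x| ^+ 2 = ip x x.

Definition bounded_operator (T : H -> H) := linear T /\ continuous T.

Definition commutant (M : set (H -> H)) : set (H -> H) :=
  [set T | bounded_operator T /\ forall S, M S -> T \o S = S \o T].

Variables (A : algType R[i]) (star : A -> A) (rep : A -> H -> H).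

(* A von Neumann algebra is a unital *-subalgebra of B(H) equal to its
   bicommutant. It is given as an abstract algebra [A] with involution [star],
   together with the inclusion [rep] of [A] into B(H). *)
Record von_neumann_algebra (ip : {dot H for Num.conj}) : Prop := {
  rep_bounded : forall a, bounded_operator (rep a);
  rep_inj : injective rep;
  rep_linear : linear rep;
  rep_one : rep 1 = id;
  rep_mul : forall a b, rep (a * b) = rep a \o rep b;
  rep_star : forall a x y, ip (rep a x) y = ip x (rep (star a) y);
  rep_bicommutant : range rep = commutant (commutant (range rep)) }.

Definition self_adjoint (a : A) := star a = a.

Definition positive (a : A) := exists c, a = star c * c.

Definition op_le (a b : A) := positive (b - a).

Definition op_lub (D : set A) (x : A) :=
  (forall a, D a -> op_le a x) /\
  (forall y, (forall a, D a -> op_le a y) -> op_le x y).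

Definition op_directed (D : set A) :=
  D !=set0 /\
  forall a b, D a -> D b -> exists c, [/\ D c, op_le a c & op_le b c].

Variable tau : {scalar A}.

Record normal_faithful_tracial_state : Prop := {
  tau_one : tau 1 = 1;
  tau_pos : forall a, positive a -> 0 <= tau a;
  tau_faithful : forall a, positive a -> tau a = 0 -> a = 0;
  tau_tracial : forall a b, tau (a * b) = tau (b * a);
  tau_normal : forall (D : set A) x, op_directed D ->
    (forall a, D a -> positive a) -> op_lub D x ->
    supremums (tau @` D) (tau x) }.

(* For [S] self-adjoint, the von Neumann algebra generated by [S] is the
   bicommutant of [S] in B(H); it is contained in [A]. *)
Definition vN_generated (S : A) : set A :=
  [set a | commutant (commutant [set rep S]) (rep a)].

Record cond_expectation (S : A) (E : {linear A -> A}) : Prop := {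
  ce_range : forall a, vN_generated S (E a);
  ce_id : forall b, vN_generated S b -> E b = b;
  ce_pos : forall a, positive a -> positive (E a);
  ce_bimodule : forall a b c, vN_generated S b -> vN_generated S c ->
    E (b * a * c) = b * E a * c;
  ce_tau : forall a, tau (E a) = tau a }.

(* [V] is Var(X | S). *)
Definition cond_variance (X S V : A) :=
  exists2 E : {linear A -> A}, cond_expectation S E &
    V = E (X ^+ 2) - (E X) ^+ 2.

(* [mu] is the law of [X]; it is unique since [X] is bounded. *)
Definition has_law (X : A) (mu : probability R R) :=
  forall n, mu.-integrable setT (fun x => (x ^+ n)%:E) /\
    tau (X ^+ n) = (\int[mu]_x (x ^+ n))%:C.

Definition same_law (X Y : A) := exists2 mu, has_law X mu & has_law Y mu.

(* Voiculescu's freeness of the unital algebras C<x i> generated by the [x i]: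
   an alternating product of centered elements [p.1 = i_j], [p.2] a polynomial,
   has trace zero. *)
Definition free_family (I : eqType) (x : I -> A) :=
  forall w : seq (I * {poly R[i]}),
    w != [::] -> sorted (fun p q => p.1 != q.1) w ->
    (forall p, p \in w -> tau (horner_alg (x p.1) p.2) = 0) ->
    tau (\prod_(p <- w) horner_alg (x p.1) p.2) = 0.

Definition increment (X : R -> A) (t : nat -> R) (i : nat) : A :=
  if i is j.+1 then X (t j.+1) - X (t j) else X (t 0%N).

Definition weak_cvg_to_dirac0 (mu : R -> probability R R) :=
  forall f : R -> R, continuous f -> bounded_fun f ->
    \int[mu t]_x f x @[t --> 0^'+] --> f 0.

Record free_levy_process (X : R -> A) : Prop := {
  levy_self_adjoint : forall t, 0 <= t -> self_adjoint (X t);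
  levy_continuous : exists2 mu : R -> probability R R,
    forall t, 0 <= t -> has_law (X t) (mu t) & weak_cvg_to_dirac0 mu;
  levy_free : forall (k : nat) (t : nat -> R), 0 <= t 0%N ->
    (forall i, (i.+1 < k)%N -> t i < t i.+1) ->
    free_family (fun i : 'I_k => increment X t i);
  levy_stationary : forall s t, 0 <= s -> s < t ->
    same_law (X t - X s) (X (t - s)) }.

End VonNeumann.

Section Cumulants.

Definition noncrossing (n : nat) (P : {set {set 'I_n}}) :=
  [forall B1 in P, forall B2 in P, (B1 != B2) ==>
    ~~ [exists i in B1, exists j in B2, exists k in B1, exists l in B2,
         [&& (i < j)%N, (j < k)%N & (k < l)%N]]].

Variables (R : realType) (A : algType R[i]) (tau : {scalar A}).

(* Moment-cumulant formula; it determines [kappa k] for all k >= 1, while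
   [kappa 0] is irrelevant. *)
Definition free_cumulants (X : A) (kappa : nat -> R[i]) :=
  forall n, tau (X ^+ n) =
    \sum_(P : {set {set 'I_n}} | finset.partition P (finset.setTfor 'I_n) &&
                               noncrossing P)
      \prod_(B in P) kappa #|B|.

Definition sqrt_branch (D : set R[i]^o) (f w : R[i]^o -> R[i]^o) :=
  {within D, continuous w} /\ forall z, D z -> w z ^+ 2 = f z.

(* The R-transform of [X] converges and equals [r z] for z in [D]. *)
Definition R_transform_eq (X : A) (D : set R[i]^o) (r : R[i]^o -> R[i]^o) :=
  exists2 kappa, free_cumulants X kappa &
    forall z, D z ->
      series (fun k => kappa k.+1 * z ^+ k : R[i]^o) @ \oo --> r z.

End Cumulants.

Section FreeMeixner.
Variable R : realType.

Definition upper_half_plane : set R[i]^o := [set z | 0 < complex.Im z].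

Definition cauchy_stieltjes (mu : probability R R) (z : R[i]) : R[i] :=
  (\int[mu]_y complex.Re (z - y%:C)^-1) +i*
  (\int[mu]_y complex.Im (z - y%:C)^-1).

(* Where b z^2 + a z + 1 vanishes, the quotient has a removable singularity. *)
Definition free_meixner (a b : R) (mu : probability R R) :=
  -1 <= b /\
  exists w : R[i]^o -> R[i]^o,
  [/\ sqrt_branch upper_half_plane
        (fun z => (z - a%:C) ^+ 2 - (4 * (1 + b))%:C) w,
      forall e : R, 0 < e -> exists M : R, forall z, upper_half_plane z ->
        M%:C < `|z| -> `|w z / z - 1| < e%:C
    & forall z, upper_half_plane z -> b%:C * z ^+ 2 + a%:C * z + 1 != 0 ->
        cauchy_stieltjes mu z =
        ((1 + 2 * b)%:C * z + a%:C - w z) /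
        (2 * (b%:C * z ^+ 2 + a%:C * z + 1))].

Definition free_meixner_type (a b : R) (mu : probability R R) :=
  exists2 nu, free_meixner a b nu &
    exists c d : R, c != 0 /\
      forall B : set R, measurable B ->
        mu B = pushforward nu (fun x => c * x + d) B.

End FreeMeixner.

(* Main.v *)
Require Import Defs.
From HB Require Import structures.
From mathcomp Require Import all_boot all_order all_algebra.
From mathcomp Require Import complex.
From mathcomp Require Import all_classical all_reals all_analysis.
From mathcomp Require Import measurable_realfun ring lra zify.

Set Implicit Arguments.
Unset Strict Implicit.
Unset Printing Implicit Defensive.

Import Order.TTheory GRing.Theory Num.Theory.
Import numFieldNormedType.Exports.

Local Open Scope classical_set_scope.
Local Open Scope complex_scope.
Local Open Scope ring_scope.

(* Split X_u into the free, identically distributed halves X_{u/2} and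
   X_u - X_{u/2}, with difference D. On the free Appell polynomials T_k of X_u,
   freeness gives tau(D T_k) = 0 and tau(D^2 T_k) = R_{k+2}(X_u). By normality of
   the trace the first identity implies tau(D | X_u) = 0, so that
   Var(X_{u/2} | X_u) = tau(D^2 | X_u) / 4, and the regression hypothesis turns the
   second one into a recursion for the free cumulants: the power series
   rho(z) = r_{X_u}(z) / u satisfies rho = z (1 + eta rho + sigma rho^2), which is
   the formula for the R-transform.
   For the law of X_t / sqrt t, with a = eta / sqrt t and b = sigma / t, the
   three-term recurrence P_1 = x, P_2 = (x - a) P_1 - 1,
   P_{n+1} = (x - a) P_n - (1 + b) P_{n-1} defines orthogonal polynomials, because
   tau(P_n T_k) is a multiple of the coefficient of z^k in rho^n, and P_n has squared
   norm (1 + b)^{n-1}. Hence 1 + sigma / t >= 0 for every t > 0, so sigma >= 0.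
   Moreover the integrals of P_n(y) / (z - y) satisfy the same recurrence and grow
   at most like (1 + b)^{n/2}, so they follow the smaller characteristic root; this
   determines the Cauchy-Stieltjes transform. *)

(** * Geometry of a Hilbert space *)

(** The conditional expectation lands in the bicommutant of X_u, while freeness only tests against
    polynomials in X_u. Polynomials are dense there on finitely many vectors of H, but the trace is
    not given by vectors: normality speaks of suprema of directed sets. So tau is compared with
    finite sums of vector functionals on an h with tau(1 - h) as small as desired, and the remainder
    is controlled by approximants that are bounded in the operator order. Square roots and
    resolvents are limits of monotone sequences, the form of convergence that normality can
    evaluate. The regression is used at the times (u/2, u), where both halves have the same law and
    the conditional mean is half of X_u. The constant C is then fixed by the second moment. Free
    cumulants are defined through noncrossing partitions, so the coefficients of the Appell
    recurrence have to be identified with them. Expanding powers of X_u in the T_k does this: k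
    counts the points that are still to be joined to a block. *)

Section RealParts.
Variable R : realType.
Implicit Types z : R[i].

Lemma ReD z1 z2 : complex.Re (z1 + z2) = complex.Re z1 + complex.Re z2.
Proof. by case: z1 => a b; case: z2. Qed.

Lemma ReN z : complex.Re (- z) = - complex.Re z.
Proof. by case: z. Qed.

Lemma ReZ (a : R) z : complex.Re (a%:C * z) = a * complex.Re z.
Proof. by case: z => x y /=; rewrite mul0r subr0. Qed.

Lemma ReJ z : complex.Re (z^*)%C = complex.Re z.
Proof. by case: z. Qed.

Lemma le0_complexP z : 0 <= z -> z = (complex.Re z)%:C.
Proof. by move=> z0; rewrite RRe_real // ger0_real. Qed.

Lemma conjCE z : Num.conj z = (z^*)%C.
Proof. by []. Qed.

End RealParts.

Section Hilbert.
Variables (R : realType) (H : completeNormedModType R[i]).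
Variable (ip : {dot H for Num.conj}).
Hypothesis hip : hilbert_product ip.

(** The real part gives the same norm, and the same orthogonal complement of a complex subspace,
    with values in an ordered field. *)
Definition real_product (x y : H) : R := complex.Re (ip x y).

Lemma ripC x y : real_product x y = real_product y x.
Proof.
have e : ip x y = (-1) ^+ false * Num.conj (ip y x) by exact: hermC.
by rewrite /real_product e expr0 mul1r conjCE ReJ.
Qed.

Lemma ripDl x y z : real_product (x + y) z = real_product x z + real_product y z.
Proof. by rewrite /real_product linearDl ReD. Qed.

Lemma ripDr x y z : real_product z (x + y) = real_product z x + real_product z y.
Proof. by rewrite ripC ripDl !(ripC z). Qed.

Lemma ripNl x z : real_product (- x) z = - real_product x z.
Proof. by rewrite /real_product linearNl ReN. Qed.

Lemma ripNr x z : real_product z (- x) = - real_product z x.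
Proof. by rewrite ripC ripNl ripC. Qed.

Lemma ripNN x : real_product (- x) (- x) = real_product x x.
Proof. by rewrite ripNl ripNr opprK. Qed.

Lemma ripZl (a : R) x z : real_product (a%:C *: x) z = a * real_product x z.
Proof. by rewrite /real_product linearZl_LR /= ReZ. Qed.

Lemma ripZr (a : R) x z : real_product z (a%:C *: x) = a * real_product z x.
Proof. by rewrite ripC ripZl ripC. Qed.

Lemma rip0l x : real_product 0 x = 0.
Proof. by rewrite /real_product linear0l. Qed.

Lemma rip0r x : real_product x 0 = 0.
Proof. by rewrite ripC rip0l. Qed.

Lemma rip_ge0 x : 0 <= real_product x x.
Proof.
by have := @dnorm_ge0 _ _ ip x; rewrite lecE => /andP[_].
Qed.

Lemma rip_sqr x : `|x| ^+ 2 = (real_product x x)%:C.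
Proof.
rewrite hip; apply: le0_complexP; exact: dnorm_ge0.
Qed.

Lemma rip_norm x : real_product x x = complex.Re `|x| ^+ 2.
Proof.
have := rip_sqr x; rewrite (@le0_complexP _ `|x|) // -rmorphXn /= => /complexI e.
by rewrite -e.
Qed.

Lemma rip_eq0 x : real_product x x = 0 -> x = 0.
Proof.
move=> e; have := rip_sqr x; rewrite e => /eqP; rewrite sqrf_eq0 normr_eq0.
by move/eqP.
Qed.

Lemma rip_orth0 x : (forall y, real_product x y = 0) -> x = 0.
Proof. by move=> /(_ x) /rip_eq0. Qed.

Lemma ripDD x y : real_product (x + y) (x + y) = real_product x x + 2 * real_product x y + real_product y y.
Proof. by rewrite !(ripDl, ripDr) (ripC y x); ring. Qed.

Lemma ripBB x y : real_product (x - y) (x - y) = real_product x x - 2 * real_product x y + real_product y y.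
Proof. by rewrite ripDD ripNr !(ripNl, ripNr); ring. Qed.

Lemma rip_parallelogram x y :
  real_product (x + y) (x + y) + real_product (x - y) (x - y) = 2 * real_product x x + 2 * real_product y y.
Proof. by rewrite ripDD ripBB; ring. Qed.

Lemma rip_le_DD x y : real_product (x + y) (x + y) <= 2 * real_product x x + 2 * real_product y y.
Proof. by rewrite -rip_parallelogram lerDl rip_ge0. Qed.

Lemma rip_amgm x y : 2 * `|real_product x y| <= real_product x x + real_product y y.
Proof.
have := rip_ge0 (x - y); have := rip_ge0 (x + y); rewrite ripDD ripBB.
by case: (ger0P (real_product x y)) => _; lra.
Qed.

Lemma norm_lt_ripE x (e : R) : 0 <= e -> (`|x| < e%:C) = (real_product x x < e ^+ 2).
Proof.
move=> e0; rewrite rip_norm [X in X < _](le0_complexP (normr_ge0 x)) ltcR.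
by rewrite ltr_pXn2r // nnegrE -ler0c -le0_complexP.
Qed.

Definition hcvg (u : nat -> H) (l : H) :=
  forall e : R, 0 < e -> exists N, forall n, (N <= n)%N -> real_product (u n - l) (u n - l) < e.

Lemma gt0_complexP (e : R[i]) : 0 < e -> exists2 d : R, 0 < d & e = d%:C.
Proof.
move=> e0; have ee := le0_complexP (ltW e0); exists (complex.Re e) => //.
by move: e0; rewrite {1}ee ltcR.
Qed.

Lemma hcvgP u l : hcvg u l <-> u @ \oo --> l.
Proof.
split=> [h|h].
  apply/cvgrPdist_lt => _ /gt0_complexP[e e0 ->].
  have [N hN] := h (e ^+ 2) (exprn_gt0 _ e0).
  by exists N => // n /= /hN; rewrite distrC norm_lt_ripE ?ltW.
move=> e e0; move/cvgrPdist_lt: h.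
have s0 : 0 < (Num.sqrt e)%:C :> R[i] by rewrite ltcR sqrtr_gt0.
move=> /(_ _ s0) [N _ hN]; exists N => n /hN /=.
by rewrite distrC norm_lt_ripE ?sqrtr_ge0 // sqr_sqrtr ?ltW.
Qed.

Lemma hcvg_cauchy u :
  (forall e : R, 0 < e -> exists N, forall m n, (N <= m)%N -> (N <= n)%N ->
     real_product (u m - u n) (u m - u n) < e) -> exists l, hcvg u l.
Proof.
move=> h.
suff /cvg_ex[l hl] : cvg (u @ \oo) by exists l; apply/hcvgP.
apply/cauchy_cvgP/cauchy_ballP => _ /gt0_complexP[e e0 ->]; near_simpl.
have [N hN] := h (e ^+ 2) (exprn_gt0 _ e0).
have hN' : \forall n \near \oo, (N <= n)%N by exists N.
exists ([set n | (N <= n)%N], [set n | (N <= n)%N]) => //= -[m n] /= [mN nN].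
by rewrite -ball_normE /ball_ /= norm_lt_ripE ?ltW ?hN.
Qed.

Lemma rip_CS x y : real_product x y ^+ 2 <= real_product x x * real_product y y.
Proof.
have [y0|y0] := eqVneq (real_product y y) 0.
  by rewrite (rip_eq0 y0) !rip0r mulr0 expr2 mulr0.
have y1 : 0 < real_product y y by rewrite lt_def y0 rip_ge0.
have := rip_ge0 (x - (real_product x y / real_product y y)%:C *: y).
rewrite ripBB !(ripZr, ripZl) => h.
have : real_product x x - real_product x y ^+ 2 / real_product y y >= 0.
  by apply: le_trans h _; rewrite le_eqVlt; apply/orP; left; apply/eqP; field.
by rewrite subr_ge0 ler_pdivrMr.
Qed.

Lemma rip_abs x y : `|real_product x y| <= (real_product x x + real_product y y) / 2.
Proof. by have := rip_amgm x y; lra. Qed.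

Lemma hcvg_rip u l y : hcvg u l -> (fun n => real_product (u n) y) @ \oo --> real_product l y.
Proof.
move=> h; apply/cvgrPdist_lt => e e0.
have d0 : 0 < e ^+ 2 / (real_product y y + 1).
  by rewrite divr_gt0 ?exprn_gt0 // ltr_wpDl ?rip_ge0.
have [N hN] := h _ d0; exists N => // n /= /hN.
rewrite ltr_pdivlMr ?ltr_wpDl ?rip_ge0 // => hlt.
rewrite distrC -ripNl -ripDl.
rewrite -(@ltr_pXn2r _ 2) // ?nnegrE ?ltW // real_normK ?num_real //.
apply: le_lt_trans (rip_CS _ _) _; apply: le_lt_trans hlt.
by rewrite ler_wpM2l ?rip_ge0 // lerDl.
Qed.

Lemma rip_scale (a : R[i]) x y : real_product (a *: x) y = real_product x ((a^*)%C *: y).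
Proof.
rewrite /real_product linearZl_LR linearZr_LR /=.
by rewrite -conjCE Num.Theory.conjCK.
Qed.

Lemma rip_normZ (a : R[i]) x :
  real_product (a *: x) (a *: x) = (complex.Re a ^+ 2 + complex.Im a ^+ 2) * real_product x x.
Proof.
rewrite rip_scale scalerA mulrC.
case: a => p q; rewrite /= -ripZr; congr (real_product _ (_ *: _)).
by apply/eqP; rewrite eq_complex /=; apply/andP; split; apply/eqP; ring.
Qed.

Lemma hcvg_unique u l l' : hcvg u l -> hcvg u l' -> l = l'.
Proof. by move=> /hcvgP h /hcvgP; apply: cvg_unique. Qed.

Lemma bounded_continuous (T : H -> H) (M : R) : linear T -> 
  (forall x, real_product (T x) (T x) <= M * real_product x x) -> continuous T.
Proof.
move=> lT hT x; apply/cvgrPdist_lt => _ /gt0_complexP[e e0 ->].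
have M1 : 0 < `|M| + 1 by rewrite ltr_wpDl.
have hd : 0 < (e / (`|M| + 1)) by rewrite divr_gt0.
have hd' : 0 < (e / (`|M| + 1))%:C :> R[i] by rewrite ltcR.
near=> z.
have TB : T x - T z = T (x - z).
  by have := lT (-1) z x; rewrite !scaleN1r addrC => <-; rewrite addrC.
rewrite TB norm_lt_ripE ?ltW //.
have : `|x - z| < (e / (`|M| + 1))%:C.
  by near: z; apply: cvgr_dist_lt => //; exact: cvg_id.
rewrite norm_lt_ripE ?ltW // => hz.
apply: le_lt_trans (hT _) _.
apply: (@le_lt_trans _ _ ((`|M| + 1) * real_product (x - z) (x - z))).
  by rewrite ler_wpM2r ?rip_ge0 // (le_trans (ler_norm _)) // lerDl.
rewrite mulrC -ltr_pdivlMr //; apply: lt_le_trans hz _.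
rewrite expr_div_n ler_pdivrMr ?exprn_gt0 // -mulrA ler_peMr ?sqr_ge0 //.
by rewrite expr2 mulrA mulVf ?gt_eqF // mul1r lerDr.
Unshelve. all: by end_near. Qed.

Lemma continuous_bounded (T : H -> H) : linear T -> continuous T ->
  exists2 M : R, 0 < M & forall x, real_product (T x) (T x) <= M * real_product x x.
Proof.
move=> lT cT.
have T0 : T 0 = 0.
  by have := lT (-1) 0 0; rewrite scaleN1r oppr0 addr0 scaleN1r addNr.
have TZ (a : R[i]) x : T (a *: x) = a *: T x.
  by have := lT a x 0; rewrite !addr0 T0 addr0.
have hh : nbhs (0 : H) (fun t => `|T 0 - T t| < 1).
  by have /cvgrPdist_lt /(_ 1 ltr01) := cT 0.
have /nbhs_ballP[d /= d0 hd] := hh.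
have [e e0 ed] := gt0_complexP d0.
exists ((2 / e) ^+ 2) => [|x]; first by rewrite exprn_gt0 // divr_gt0.
have [x0|x0] := eqVneq (real_product x x) 0.
  by rewrite (rip_eq0 x0) T0 rip0l mulr0.
have x1 : 0 < real_product x x by rewrite lt_def x0 rip_ge0.
pose s := Num.sqrt (real_product x x).
have s0 : 0 < s by rewrite sqrtr_gt0.
have ss : real_product x x = s ^+ 2 by rewrite sqr_sqrtr ?rip_ge0.
have c0 : 0 < e / (2 * s) by rewrite divr_gt0 // mulr_gt0.
have h v : real_product v v < e ^+ 2 -> real_product (T v) (T v) < 1.
  move=> hv; have := hd v; rewrite -ball_normE /ball_ /= T0 !sub0r !normrN.
  rewrite ed norm_lt_ripE ?(ltW e0) // => /(_ hv).
  by rewrite -[X in _ < X]/(1%:C) norm_lt_ripE ?expr1n.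
(* The factor e / (2 s) brings x to norm e / 2, inside the ball whose image has norm below 1; hence
   the constant (2 / e)^2. *)
have h2 : real_product (T ((e / (2 * s))%:C *: x)) (T ((e / (2 * s))%:C *: x)) < 1.
  apply: h; rewrite ripZl ripZr ss.
  have -> : e / (2 * s) * (e / (2 * s) * s ^+ 2) = e ^+ 2 / 4.
    by field; rewrite gt_eqF.
  by rewrite ltr_pdivrMr // ltr_pMr ?exprn_gt0 //; lra.
rewrite TZ ripZl ripZr in h2; rewrite ss.
have -> : (2 / e) ^+ 2 * s ^+ 2 = (e / (2 * s)) ^- 2.
  by field; rewrite !gt_eqF.
rewrite -[X in _ <= X]mul1r ler_pdivlMr ?exprn_gt0 //.
by apply/ltW; apply: le_lt_trans h2; rewrite le_eqVlt; apply/orP; left; apply/eqP; ring.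
Qed.

End Hilbert.

(** * Orthogonal projection in a finite direct sum of copies of H *)

Section TupleProjection.
Variables (R : realType) (H : completeNormedModType R[i]).
Variable (ip : {dot H for Num.conj}).
Hypothesis hip : hilbert_product ip.
Variable k : nat.
Local Notation rip := (real_product ip).
Implicit Types v w p : 'I_k -> H.

Definition sip v w : R := \sum_i rip (v i) (w i).

Lemma sipC v w : sip v w = sip w v.
Proof. by apply: eq_bigr => i _; rewrite ripC. Qed.

Lemma sipDl v v' w : sip (fun i => v i + v' i) w = sip v w + sip v' w.
Proof. by rewrite -big_split; apply: eq_bigr => i _; rewrite ripDl. Qed.

Lemma sipBl v v' w : sip (fun i => v i - v' i) w = sip v w - sip v' w.
Proof.
by rewrite /sip -sumrN -big_split; apply: eq_bigr => i _; rewrite ripDl ripNl.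
Qed.

Lemma sipBr v v' w : sip w (fun i => v i - v' i) = sip w v - sip w v'.
Proof. by rewrite sipC sipBl !(sipC w). Qed.

Lemma sip_scale (a : R[i]) v w :
  sip (fun i => a *: v i) w = sip v (fun i => (a^*)%C *: w i).
Proof. by apply: eq_bigr => i _; rewrite rip_scale. Qed.

Lemma sipZl (a : R) v w : sip (fun i => a%:C *: v i) w = a * sip v w.
Proof. by rewrite /sip mulr_sumr; apply: eq_bigr => i _; rewrite ripZl. Qed.

Lemma sip_ge0 v : 0 <= sip v v.
Proof. by apply: sumr_ge0 => i _; apply: rip_ge0. Qed.

Lemma sip_BB v w :
  sip (fun i => v i - w i) (fun i => v i - w i) = sip v v - 2 * sip v w + sip w w.
Proof. by rewrite sipBl !sipBr (sipC w v); ring. Qed.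

Lemma sip_normZ (a : R[i]) v :
  sip (fun i => a *: v i) (fun i => a *: v i) =
  (complex.Re a ^+ 2 + complex.Im a ^+ 2) * sip v v.
Proof.
by rewrite /sip mulr_sumr; apply: eq_bigr => i _; rewrite rip_normZ.
Qed.

Lemma sip_eq0 v : sip v v = 0 -> v = fun=> 0.
Proof.
move=> /eqP; rewrite psumr_eq0 => [/allP h|i _]; last exact: rip_ge0.
apply/funext => i; apply: (rip_eq0 hip); apply/eqP.
by have := h i (mem_index_enum _).
Qed.

Lemma sip_component v i : rip (v i) (v i) <= sip v v.
Proof.
rewrite /sip (bigD1 i) //= lerDl; apply: sumr_ge0 => j _; exact: rip_ge0.
Qed.

Lemma sip_le_DD v w : sip (fun i => v i + w i) (fun i => v i + w i) <=
  2 * sip v v + 2 * sip w w.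
Proof.
rewrite /sip !mulr_sumr -big_split /=; apply: ler_sum => i _; exact: rip_le_DD.
Qed.

Lemma sip_abs (v w : 'I_k -> H) (c : R) : 0 < c ->
  `|sip v w| <= (c * sip v v + c^-1 * sip w w) / 2.
Proof.
move=> c0.
pose s := Num.sqrt c; have s0 : 0 < s by rewrite sqrtr_gt0.
have ss : c = s * s by rewrite -expr2 sqr_sqrtr ?ltW.
have h i : `|rip (v i) (w i)| <= (c * rip (v i) (v i) + c^-1 * rip (w i) (w i)) / 2.
  have := rip_abs ip (s%:C *: v i) (s^-1%:C *: w i).
  rewrite !(ripZl, ripZr) !mulrA mulfV ?gt_eqF // mul1r => /le_trans; apply.
  by rewrite ss invfM.
apply: le_trans (ler_norm_sum _ _ _) _.
rewrite /sip !mulr_sumr -big_split mulr_suml; apply: ler_sum => i _; exact: h.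
Qed.

Variable W : set ('I_k -> H).
Hypothesis W0 : W (fun=> 0).
Hypothesis WD : forall v w, W v -> W w -> W (fun i => v i + w i).
Hypothesis WZ : forall (a : R[i]) v, W v -> W (fun i => a *: v i).

Definition clW v := forall e : R, 0 < e ->
  exists2 w, W w & sip (fun i => v i - w i) (fun i => v i - w i) < e.

Lemma W_clW w : W w -> clW w.
Proof.
move=> Ww e e0; exists w => //.
by rewrite (_ : (fun i => _) = fun=> 0) ?/sip ?big1 // => [i _|];
  [rewrite rip0l|apply/funext => i; rewrite subrr].
Qed.

Lemma clWD v v' : clW v -> clW v' -> clW (fun i => v i + v' i).
Proof.
move=> hv hv' e e0.
have e4 : 0 < e / 4 by rewrite divr_gt0.
have [w Ww hw] := hv _ e4; have [w' Ww' hw'] := hv' _ e4.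
exists (fun i => w i + w' i); first exact: WD.
have -> : (fun i => v i + v' i - (w i + w' i)) =
          (fun i => (fun i => v i - w i) i + (fun i => v' i - w' i) i).
  by apply/funext => i; rewrite opprD addrACA.
by apply: le_lt_trans (sip_le_DD _ _) _; lra.
Qed.

Lemma clWZ (a : R[i]) v : clW v -> clW (fun i => a *: v i).
Proof.
move=> hv e e0.
pose m := complex.Re a ^+ 2 + complex.Im a ^+ 2.
have m0 : 0 <= m by rewrite addr_ge0 ?sqr_ge0.
have d0 : 0 < e / (m + 1) by rewrite divr_gt0 ?ltr_wpDl.
have [w Ww hw] := hv _ d0.
exists (fun i => a *: w i); first exact: WZ.
have -> : (fun i => a *: v i - a *: w i) = (fun i => a *: (fun i => v i - w i) i).
  by apply/funext => i; rewrite scalerBr.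
rewrite sip_normZ -/m; move: hw; rewrite ltr_pdivlMr ?ltr_wpDl // mulrC.
by apply: le_lt_trans; rewrite ler_wpM2r ?sip_ge0 // lerDl.
Qed.

Lemma orth_clW v p : (forall w, W w -> sip v w = 0) -> clW p -> sip v p = 0.
Proof.
move=> hv hp; apply/eqP/contraT => n0.
have a0 : 0 < `|sip v p| by rewrite normr_gt0.
(* With this [c] the first term of [sip_abs] is at most the absolute value of [sip v p]. For [w]
   close to [p] the second term is strictly smaller, so the mean of the two cannot reach that
   value. *)
pose c := `|sip v p| / (sip v v + 1).
have c0 : 0 < c by rewrite divr_gt0 // ltr_wpDl ?sip_ge0.
have [w Ww hw] := hp (c * `|sip v p|) (mulr_gt0 c0 a0).
have : sip v p = sip v (fun i => p i - w i) by rewrite sipBr (hv w Ww) subr0.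
move=> e.
have := sip_abs v (fun i => p i - w i) c0; rewrite -e => h.
have : c * sip v v <= `|sip v p|.
  rewrite /c mulrAC ler_pdivrMr ?ltr_wpDl ?sip_ge0 //.
  by rewrite ler_wpM2l // lerDl.
have : c^-1 * sip (fun i => p i - w i) (fun i => p i - w i) < `|sip v p|.
  by rewrite mulrC ltr_pdivrMr // mulrC.
move: h; set x := sip _ _ in a0 *; set y := c^-1 * _; set z := c * _ => *.
exfalso; lra.
Qed.

(** A minimizing sequence is Cauchy by the parallelogram law, since midpoints stay in [W].
    Orthogonality holds because moving a near-minimizer along [w] cannot bring the distance below
    the infimum. *)
Lemma projection_exists v : exists2 p, clW p &
  forall w, W w -> sip (fun i => v i - p i) w = 0.
Proof.
have [a [a0 hN]] : exists a : nat -> R, (forall n, 0 < a n) /\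
    forall e, 0 < e -> exists N, forall n, (N <= n)%N -> a n < e.
  exists (fun n => n.+1%:R^-1); split=> [n|e e0]; first by rewrite invr_gt0.
  by have [N _ hN] := near_infty_natSinv_lt (PosNum e0); exists N.
pose D := [set r | exists2 w, W w & r = sip (fun i => v i - w i) (fun i => v i - w i)].
have D0 : D !=set0 by exists (sip (fun i => v i - 0) (fun i => v i - 0)); exists (fun=> 0).
have Dlb : has_lbound D by exists 0 => _ [w _ ->]; apply: sip_ge0.
pose d := inf D.
have dle w : W w -> d <= sip (fun i => v i - w i) (fun i => v i - w i).
  by move=> Ww; apply: ge_inf => //; exists w.
have happ n : exists w, W w /\
    sip (fun i => v i - w i) (fun i => v i - w i) < d + a n.
  have [_ [w Ww ->] hw] := @inf_adherent R D (a n) (a0 n) (conj D0 Dlb).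
  by exists w.
have [u hu] := choice happ.
have aux (c b d' s1 s2 s3 s4 : R) : s3 + s4 = 2 * s1 + 2 * s2 -> s1 < d' + c ->
    s2 < d' + b -> d' <= 1 / 2 * (1 / 2 * s3) -> s4 <= 2 * (c + b).
  by move=> *; lra.
have hmid m n : sip (fun i => u m i - u n i) (fun i => u m i - u n i) <=
    2 * (a m + a n).
  have [Wm hm] := hu m; have [Wn hn] := hu n.
  have hW : W (fun i => (1/2)%:C *: (u m i + u n i)).
    exact: (WZ (1/2)%:C (WD Wm Wn)).
  have := dle _ hW.
  have -> : (fun i => v i - (1/2)%:C *: (u m i + u n i)) =
     (fun i => (1/2)%:C *: (fun i => (v i - u m i) + (v i - u n i)) i).
    apply/funext => i; rewrite addrACA -opprD scalerBr; congr (_ - _).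
    rewrite -[v i]scale1r -scalerDl scalerA; congr (_ *: _).
    by apply/eqP; rewrite eq_complex /=; apply/andP; split; apply/eqP; field.
  rewrite sipZl sipC sipZl.
  move: hm hn; rewrite /sip.
  set S1 := \sum_(i < k) _; set S2 := \sum_(i < k) _; set S3 := \sum_(i < k) _.
  set S4 := \sum_(i < k) _.
  have : S3 + S4 = 2 * S1 + 2 * S2.
    rewrite /S3 /S4 /S1 /S2 !mulr_sumr -!big_split; apply: eq_bigr => i _ /=.
    have -> : rip (u m i - u n i) (u m i - u n i) =
       rip ((v i - u m i) - (v i - u n i)) ((v i - u m i) - (v i - u n i)).
      rewrite (_ : v i - u m i - (v i - u n i) = - (u m i - u n i)) ?ripNN //.
      by rewrite !opprB addrC addrA subrK.
    exact: rip_parallelogram.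
  exact: aux.
have hl i : exists l, hcvg ip (fun n => u n i) l.
  apply: hcvg_cauchy => // e e0.
  have [N hN'] := hN (e / 4) ltac:(lra).
  exists N => m n /hN' hm /hN' hn.
  apply: le_lt_trans (sip_component (fun i => u m i - u n i) i) _.
  by apply: le_lt_trans (hmid m n) _; lra.
have [p hp] := choice hl.
have hlim : forall e : R, 0 < e -> exists N, forall n, (N <= n)%N ->
    sip (fun i => p i - u n i) (fun i => p i - u n i) < e.
  move=> e e0.
  have e0' : 0 < e / (k%:R + 1) by rewrite divr_gt0 // ltr_wpDl.
  have := fun i => hp i _ e0'; move=> /choice[N hN'].
  exists (\max_i N i)%N => n hn.
  apply: (@le_lt_trans _ _ (\sum_(i < k) e / (k%:R + 1))).
    apply: ler_sum => i _; rewrite -(opprB (u n i)) ripNN.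
    by apply/ltW/hN'; apply: leq_trans hn; apply: (leq_bigmax i).
  rewrite sumr_const card_ord -(mulr_natr (e / _)) mulrAC ltr_pdivrMr ?ltr_wpDl //.
  by rewrite ltr_pM2l // ltrDl.
exists p => [e e0|w Ww].
  have [N hN'] := hlim e e0; exists (u N); first by case: (hu N).
  exact: hN'.
apply/eqP/contraT => n0; exfalso.
set x := sip (fun i => v i - p i) w in n0.
have x0 : 0 < `|x| by rewrite normr_gt0.
pose M := sip w w.
have M0 : 0 <= M by apply: sip_ge0.
(* A step length for which the quadratic term of [hm] is dominated by the linear one; the sign of
   [x] decides whether t = c or t = - c gives the contradiction. *)
pose c := `|x| / (M + 1) / 4.
have c0 : 0 < c by rewrite !divr_gt0 // ltr_wpDl.
have xc0 : 0 < `|x| * c / 2 by rewrite divr_gt0 // mulr_gt0.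
have [N1 hN1] := hN _ xc0.
have [N2 hN2] := hlim (c * `|x|) (mulr_gt0 c0 x0).
pose n := maxn N1 N2.
have := hN1 n (leq_maxl _ _); have := hN2 n (leq_maxr _ _) => h2 h1.
have [Wn hn] := hu n.
set y := sip (fun i => v i - u n i) w.
have cM : c * M <= `|x| / 4.
  rewrite /c mulrAC ler_pM2r // -mulrA ler_piMr //.
  by rewrite mulrC ler_pdivrMr ?ltr_wpDl // mul1r lerDl.
have hxy : `|y - x| <= 5 / 8 * `|x|.
  have -> : y - x = sip (fun i => p i - u n i) w.
    by rewrite /y /x !sipBl; ring.
  have ci : 0 < c^-1 by rewrite invr_gt0.
  apply: le_trans (sip_abs _ _ ci) _; rewrite invrK -/M.
  have : c^-1 * sip (fun i => p i - u n i) (fun i => p i - u n i) < `|x|.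
    by rewrite mulrC ltr_pdivrMr // mulrC.
  lra.
have hm t : t ^+ 2 * M - 2 * t * y + a n >= 0.
  have hW : W (fun i => u n i + t%:C *: w i) by exact: (WD Wn (WZ t%:C Ww)).
  have := dle _ hW.
  have -> : (fun i => v i - (u n i + t%:C *: w i)) =
     (fun i => (fun i => v i - u n i) i - (fun i => t%:C *: w i) i).
    by apply/funext => i; rewrite opprD addrA.
  rewrite sip_BB (sipC _ (fun i => t%:C *: w i)) !sipZl.
  rewrite (sipC w (fun i => _ *: _)) sipZl -/M (sipC w) -/y.
  move: hn; lra.
have fin (X Y A : R) : 0 < X -> c * M <= X / 4 -> A < X * c / 2 ->
    3 / 8 * X <= Y -> c ^+ 2 * M - 2 * c * Y + A >= 0 -> False.
  move=> X0 h3 h4 h5 h6.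
  have h7 : c * (c * M) <= c * (X / 4) by rewrite ler_wpM2l // ltW.
  have h8 : c * (3 / 8 * X) <= c * Y by rewrite ler_wpM2l // ltW.
  by move: h4 h6 h7 h8; rewrite expr2; lra.
have := hm c; have := hm (- c); rewrite sqrrN.
case: (ger0P x) hxy cM h1 x0 => x0'; rewrite ler_distl => /andP[hy1 hy2] cM h1 x0 m1 m2.
  by apply: (fin x y (a n)) => //; lra.
by apply: (fin (- x) (- y) (a n)) => //; lra.
Qed.

End TupleProjection.

(** * The von Neumann algebra generated by a self-adjoint element *)

Section VonNeumannAlgebra.
Variables (R : realType) (H : completeNormedModType R[i]).
Variable (ip : {dot H for Num.conj}).
Hypothesis hip : hilbert_product ip.
Variables (A : algType R[i]) (star : A -> A) (rep : A -> H -> H).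
Hypothesis vn : von_neumann_algebra star rep ip.
Local Notation rip := (real_product ip).

Lemma repP (c : R[i]) a b x : rep (c *: a + b) x = c *: rep a x + rep b x.
Proof. by rewrite (rep_linear vn). Qed.

Lemma repD a b x : rep (a + b) x = rep a x + rep b x.
Proof. by have := repP 1 a b x; rewrite !scale1r. Qed.

Lemma rep0 x : rep 0 x = 0.
Proof.
have := repP (-1) 0 0 x; rewrite scaler0 addr0 scaleN1r.
by rewrite addNr.
Qed.

Lemma repZ (c : R[i]) a x : rep (c *: a) x = c *: rep a x.
Proof. by have := repP c a 0 x; rewrite rep0 !addr0. Qed.

Lemma repN a x : rep (- a) x = - rep a x.
Proof. by rewrite -scaleN1r repZ scaleN1r. Qed.

Lemma repB a b x : rep (a - b) x = rep a x - rep b x.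
Proof. by rewrite repD repN. Qed.

Lemma repM a b x : rep (a * b) x = rep a (rep b x).
Proof. by rewrite (rep_mul vn). Qed.

Lemma rep1 x : rep 1 x = x.
Proof. by rewrite (rep_one vn). Qed.

Section LinearOperator.
Variable T : H -> H.
Hypothesis linT : linear T.

Lemma opD x y : T (x + y) = T x + T y.
Proof. by have := linT 1 x y; rewrite !scale1r. Qed.

Lemma op0 : T 0 = 0.
Proof. by have := linT (-1) 0 0; rewrite scaler0 addr0 scaleN1r addNr. Qed.

Lemma opZ (c : R[i]) x : T (c *: x) = c *: T x.
Proof. by have := linT c x 0; rewrite op0 !addr0. Qed.

Lemma opN x : T (- x) = - T x.
Proof. by rewrite -scaleN1r opZ scaleN1r. Qed.

Lemma opB x y : T (x - y) = T x - T y.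
Proof. by rewrite opD opN. Qed.

Lemma op_sum (I : Type) (r : seq I) (P : pred I) (F : I -> H) :
  T (\sum_(i <- r | P i) F i) = \sum_(i <- r | P i) T (F i).
Proof. exact: (big_morph T opD op0). Qed.
End LinearOperator.

Lemma rep_lin a : linear (rep a).
Proof. by case: (rep_bounded vn a). Qed.

Lemma rep_op_bound a : exists2 M : R, 0 < M &
  forall x, rip (rep a x) (rep a x) <= M * rip x x.
Proof. by have [? ?] := rep_bounded vn a; apply: continuous_bounded. Qed.

Lemma rep_ext a b : (forall x, rep a x = rep b x) -> a = b.
Proof. by move=> h; apply: (rep_inj vn); apply/funext. Qed.

Lemma rip_rep a x y : rip (rep a x) y = rip x (rep (star a) y).
Proof. by rewrite /real_product (rep_star vn). Qed.

(** The record relates [star] to the inner product only; the algebraic rules of the involution all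
    follow from this uniqueness of the adjoint. *)
Lemma star_unique a b : (forall x y, rip (rep a x) y = rip x (rep b y)) ->
  b = star a.
Proof.
move=> h; apply: rep_ext => y; apply/eqP; rewrite -subr_eq0; apply/eqP.
apply: (rip_orth0 hip) => x; rewrite ripC ripDr ripNr -h rip_rep.
by rewrite subrr.
Qed.

Lemma starK a : star (star a) = a.
Proof. by apply/esym/star_unique => x y; rewrite ripC -rip_rep ripC. Qed.

Lemma starM a b : star (a * b) = star b * star a.
Proof. by apply/esym/star_unique => x y; rewrite !repM !rip_rep. Qed.

Lemma starD a b : star (a + b) = star a + star b.
Proof.
by apply/esym/star_unique => x y; rewrite !repD ripDl ripDr !rip_rep.
Qed.

Lemma starZ (c : R[i]) a : star (c *: a) = (c^*)%C *: star a.
Proof.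
by apply/esym/star_unique => x y; rewrite !repZ rip_scale rip_rep opZ //; exact: rep_lin.
Qed.

Lemma star1 : star 1 = 1.
Proof. by apply/esym/star_unique => x y; rewrite !rep1. Qed.

Lemma star0 : star 0 = 0.
Proof. by apply/esym/star_unique => x y; rewrite !rep0 rip0l rip0r. Qed.

Lemma starN a : star (- a) = - star a.
Proof. by apply/esym/star_unique => x y; rewrite !repN ripNl ripNr rip_rep. Qed.

Lemma selfadjP a : self_adjoint star a <->
  forall x y, rip (rep a x) y = rip x (rep a y).
Proof.
by split=> [h x y|h]; [rewrite rip_rep h|exact/esym/star_unique].
Qed.

Lemma saD a b : self_adjoint star a -> self_adjoint star b ->
  self_adjoint star (a + b).
Proof. by rewrite /self_adjoint starD => -> ->. Qed.

Lemma saN a : self_adjoint star a -> self_adjoint star (- a).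
Proof. by rewrite /self_adjoint starN => ->. Qed.

Lemma saB a b : self_adjoint star a -> self_adjoint star b ->
  self_adjoint star (a - b).
Proof. by move=> ha hb; apply: saD => //; apply: saN. Qed.

Lemma saZ (c : R) a : self_adjoint star a -> self_adjoint star (c%:C *: a).
Proof. by rewrite /self_adjoint starZ => ->; rewrite conjc_real. Qed.

Lemma sa1 : self_adjoint star 1. Proof. exact: star1. Qed.
Lemma sa0 : self_adjoint star 0. Proof. exact: star0. Qed.

Lemma saM a b : self_adjoint star a -> self_adjoint star b -> a * b = b * a ->
  self_adjoint star (a * b).
Proof. by rewrite /self_adjoint starM => -> ->. Qed.

Lemma saX a n : self_adjoint star a -> self_adjoint star (a ^+ n).
Proof.
move=> ha; elim: n => [|n IH]; first exact: sa1.
by rewrite exprS; apply: saM => //; rewrite -exprS exprSr.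
Qed.

Section GeneratedAlgebra.
Variable S : A.
Local Notation N := (vN_generated rep S).

Lemma in_NP a : N a <-> forall T, bounded_operator T ->
  (forall x, T (rep S x) = rep S (T x)) -> forall x, rep a (T x) = T (rep a x).
Proof.
split=> [[_ h] T bT cT x|h].
  have /h : commutant [set rep S] T.
    by split=> // _ ->; apply/funext => y; rewrite /= cT.
  by move=> /(congr1 (fun f => f x)).
split; first exact: (rep_bounded vn).
move=> T [bT cT]; apply/funext => x /=; apply: h => // y.
by have := cT _ erefl => /(congr1 (fun f => f y)).
Qed.

Lemma N_S : N S.
Proof. by apply/in_NP => T _ h x. Qed.

Lemma N1 : N 1.
Proof. by apply/in_NP => T bT h x; rewrite !rep1. Qed.

Lemma ND a b : N a -> N b -> N (a + b).
Proof.
move=> /in_NP ha /in_NP hb; apply/in_NP => T bT h x.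
by rewrite !repD ha // hb // opD //; case: bT.
Qed.

Lemma NZ (c : R[i]) a : N a -> N (c *: a).
Proof.
move=> /in_NP ha; apply/in_NP => T bT h x.
by rewrite !repZ ha // opZ //; case: bT.
Qed.

Lemma NN a : N a -> N (- a).
Proof. by rewrite -scaleN1r; apply: NZ. Qed.

Lemma NB a b : N a -> N b -> N (a - b).
Proof. by move=> ha hb; apply: ND => //; apply: NN. Qed.

Lemma NM a b : N a -> N b -> N (a * b).
Proof.
move=> /in_NP ha /in_NP hb; apply/in_NP => T bT h x.
by rewrite !repM hb // ha.
Qed.

Lemma N0 : N 0.
Proof. by rewrite -(subrr 1); apply: NB; exact: N1. Qed.

Lemma NX a n : N a -> N (a ^+ n).
Proof.
by move=> ha; elim: n => [|n IH]; [exact: N1|rewrite exprS; apply: NM].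
Qed.

Lemma Npoly a (q : {poly R[i]}) : N a -> N (horner_alg a q).
Proof.
move=> ha; elim/poly_ind: q => [|q c IH]; first by rewrite rmorph0; exact: N0.
rewrite rmorphD rmorphM /= horner_algC horner_algX.
by apply: ND; [apply: NM|apply: NZ; exact: N1].
Qed.

(** Since [rep S] commutes with itself, [a] commutes with it; so [rep a] is one of the operators
    with which [b] has to commute. *)
Lemma NC a b : N a -> N b -> a * b = b * a.
Proof.
move=> ha /in_NP hb; apply: rep_ext => x; rewrite !repM.
have bS : bounded_operator (rep S) by exact: (rep_bounded vn).
have ba : bounded_operator (rep a) by exact: (rep_bounded vn).
rewrite hb // => y; move/in_NP: ha => -> //.
Qed.

(* The von Neumann double commutant theorem, for finitely many vectors. *)
Lemma tuple_density (k : nat) (xi : 'I_k -> H) e (eps : R) :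
  self_adjoint star S -> N e -> 0 < eps ->
  exists q : {poly R[i]}, forall i,
    rip (rep e (xi i) - rep (horner_alg S q) (xi i))
        (rep e (xi i) - rep (horner_alg S q) (xi i)) < eps.
Proof.
move=> /selfadjP saS /in_NP Ne eps0.
pose W : set ('I_k -> H) :=
  [set v | exists q : {poly R[i]}, v = fun i => rep (horner_alg S q) (xi i)].
have W0 : W (fun=> 0).
  by exists 0; apply/funext => i; rewrite rmorph0 rep0.
have WD v w : W v -> W w -> W (fun i => v i + w i).
  move=> [p ->] [q ->]; exists (p + q); apply/funext => i.
  by rewrite rmorphD repD.
have WZ (a : R[i]) v : W v -> W (fun i => a *: v i).
  move=> [p ->]; exists (a *: p); apply/funext => i.
  by rewrite -mul_polyC rmorphM /= horner_algC mulr_algl repZ.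
have WS v : W v -> W (fun i => rep S (v i)).
  move=> [p ->]; exists ('X * p); apply/funext => i.
  by rewrite rmorphM /= horner_algX repM.
have clS v : clW ip W v -> clW ip W (fun i => rep S (v i)).
  have [M M0 hM] := rep_op_bound S.
  move=> hv d d0; have [w Ww hw] := hv (d / M) (divr_gt0 d0 M0).
  exists (fun i => rep S (w i)); first exact: WS.
  apply: (@le_lt_trans _ _ (M * sip ip (fun i => v i - w i) (fun i => v i - w i))).
    rewrite /sip mulr_sumr; apply: ler_sum => i _.
    by rewrite -opB //; exact: rep_lin.
  by rewrite mulrC -ltr_pdivlMr.
have ex v : exists p, clW ip W p /\
    forall w, W w -> sip ip (fun i => v i - p i) w = 0.
  by have [p h1 h2] := projection_exists hip W0 WD WZ v; exists p.
have [P hP] := choice ex.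
have uniq v p : clW ip W p -> (forall w, W w -> sip ip (fun i => v i - p i) w = 0) ->
    P v = p.
  move=> hp1 hp2; have [hP1 hP2] := hP v.
  have hd : clW ip W (fun i => P v i - p i).
    have -> : (fun i => P v i - p i) = (fun i => P v i + (fun i => -1 *: p i) i).
      by apply/funext => i; rewrite scaleN1r.
    by apply: clWD => //; apply: clWZ.
  have : sip ip (fun i => P v i - p i) (fun i => P v i - p i) = 0.
    apply: (orth_clW _ hd) => w Ww.
    have -> : (fun i => P v i - p i) =
      (fun i => (fun i => v i - p i) i - (fun i => v i - P v i) i).
      by apply/funext => i /=; rewrite opprB [RHS]addrC addrA subrK.
    by rewrite sipBl hp2 // hP2 // subrr.
  move/(sip_eq0 hip) => h; apply/funext => i; apply/eqP.
  by rewrite -subr_eq0; apply/eqP; exact: (congr1 (fun f => f i) h).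
have PD v w : P (fun i => v i + w i) = fun i => P v i + P w i.
  apply: uniq => [|u Wu]; first by apply: clWD; [|case: (hP v)|case: (hP w)].
  have -> : (fun i => v i + w i - (P v i + P w i)) =
     (fun i => (fun i => v i - P v i) i + (fun i => w i - P w i) i).
    by apply/funext => i /=; rewrite opprD addrACA.
  by rewrite sipDl (hP v).2 // (hP w).2 // addr0.
have PZ (c : R[i]) v : P (fun i => c *: v i) = fun i => c *: P v i.
  apply: uniq => [|u Wu]; first by apply: clWZ => //; case: (hP v).
  have -> : (fun i => c *: v i - c *: P v i) =
     (fun i => c *: (fun i => v i - P v i) i).
    by apply/funext => i /=; rewrite scalerBr.
  by rewrite sip_scale (hP v).2 //; exact: WZ.
(* [W] is invariant under S, and so is its orthogonal complement because S is self-adjoint. *)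
have PS v : P (fun i => rep S (v i)) = fun i => rep S (P v i).
  have [h1 h2] := hP v.
  apply: uniq => [|u Wu]; first exact: clS.
  rewrite -[RHS](h2 (fun i => rep S (u i)) (WS _ Wu)); apply: eq_bigr => i _.
  by rewrite -saS opB //; exact: rep_lin.
have Pb v : sip ip (P v) (P v) <= sip ip v v.
  have [h1 h2] := hP v.
  have h3 := orth_clW h2 h1.
  have := sip_ge0 ip (fun i => v i - P v i).
  rewrite sipBr h3 subr0 sipBl.
  by move: h3; rewrite sipBl => /eqP; rewrite subr_eq0 sipC => /eqP <-; lra.
(* The matrix entries [T j i] of [P] are bounded operators on H commuting with S. Hence [e] commutes
   with each of them, therefore with [P], and maps the range of [P], which contains [xi], into
   itself. *)
pose del (j : 'I_k) (x : H) := fun l => if l == j then x else 0.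
pose T j i x := P (del j x) i.
have bT j i : bounded_operator (T j i).
  have lT : linear (T j i).
    move=> c x y; rewrite /T.
    have -> : del j (c *: x + y) = fun l => (fun l => c *: del j x l) l + del j y l.
      by apply/funext => l; rewrite /del; case: ifP => //; rewrite scaler0 addr0.
    by rewrite PD PZ.
  split=> //; apply: (@bounded_continuous _ _ _ hip _ 1) => // x.
  apply: le_trans (sip_component ip (P (del j x)) i) _.
  apply: le_trans (Pb _) _; rewrite mul1r /sip (bigD1 j) //= big1 /del ?eqxx ?addr0 //.
  by move=> l /negbTE ->; rewrite rip0l.
have cT j i x : T j i (rep S x) = rep S (T j i x).
  rewrite /T -[rep S (P _ i)](congr1 (fun f => f i) (PS (del j x))).
  congr (P _ i); apply/funext => l; rewrite /del; case: ifP => // _.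
  by rewrite op0 //; exact: rep_lin.
have Psum v i : P v i = \sum_j T j i (v j).
  pose trunc (s : seq 'I_k) := fun l => \sum_(j <- s) del j (v j) l.
  have -> : v = trunc (index_enum 'I_k).
    apply/funext => l; rewrite /trunc /del (bigD1 l) //= eqxx big1 ?addr0 // => j.
    by rewrite eq_sym => /negbTE ->.
  suff h s : P (trunc s) i = \sum_(j <- s) T j i (v j).
    rewrite h; apply: eq_bigr => j _; congr T.
    rewrite /trunc /del (bigD1 j) //= eqxx big1 ?addr0 // => l.
    by rewrite eq_sym => /negbTE ->.
  elim: s => [|j s IH].
    rewrite big_nil (_ : trunc [::] = fun=> 0).
      by rewrite (uniq _ (fun=> 0)) // => [|w Ww];
        [apply: W_clW|rewrite /sip big1 // => l _; rewrite subrr rip0l].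
    by apply/funext => l; rewrite /trunc big_nil.
  rewrite big_cons -IH /T; have -> : trunc (j :: s) = fun l => del j (v j) l + trunc s l.
    by apply/funext => l; rewrite /trunc big_cons.
  by rewrite PD.
have Wxi : W xi by exists 1; apply/funext => i; rewrite rmorph1 rep1.
have Pxi : P xi = xi.
  apply: uniq => [|w Ww]; first exact: W_clW.
  by rewrite /sip big1 // => l _; rewrite subrr rip0l.
have Pe : P (fun i => rep e (xi i)) = fun i => rep e (xi i).
  apply/funext => i; rewrite Psum -[in RHS]Pxi Psum.
  rewrite op_sum; last exact: rep_lin.
  by apply: eq_bigr => j _; rewrite Ne.
have [hcl _] := hP (fun i => rep e (xi i)).
have [_ [q ->] hq] := hcl _ eps0; rewrite Pe in hq.
exists q => i; apply: le_lt_trans hq.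
exact: (sip_component ip (fun i => rep e (xi i) - rep (horner_alg S q) (xi i)) i).
Qed.

End GeneratedAlgebra.
End VonNeumannAlgebra.

(** * Positive operators: monotone limits and square roots *)

Section PositiveOperators.
Variables (R : realType) (H : completeNormedModType R[i]).
Variable (ip : {dot H for Num.conj}).
Hypothesis hip : hilbert_product ip.
Variables (A : algType R[i]) (star : A -> A) (rep : A -> H -> H).
Hypothesis vn : von_neumann_algebra star rep ip.
Local Notation rip := (real_product ip).
Local Notation sa := (self_adjoint star).

(** Positivity through the quadratic form, because this passes to strong limits; [positiveP]
    identifies it with [positive] once square roots exist. *)
Definition posop a := sa a /\ forall x, 0 <= rip (rep a x) x.

Lemma posop_sa a : posop a -> sa a. Proof. by case. Qed.

Lemma posopD a b : posop a -> posop b -> posop (a + b).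
Proof.
move=> [sa_a pa] [sb pb]; split=> [|x]; first exact: (saD hip vn).
by rewrite (repD vn) ripDl addr_ge0.
Qed.

Lemma posopZ (c : R) a : 0 <= c -> posop a -> posop (c%:C *: a).
Proof.
move=> c0 [sa_a pa]; split=> [|x]; first exact: (saZ hip vn).
by rewrite (repZ vn) ripZl mulr_ge0.
Qed.

Lemma posop0 : posop 0.
Proof.
by split=> [|x]; [exact: (sa0 hip vn)|rewrite (rep0 vn) rip0l].
Qed.

Lemma posop1 : posop 1.
Proof.
by split=> [|x]; [exact: (sa1 hip vn)|rewrite (rep1 vn) rip_ge0].
Qed.

Lemma posop_sum (I : Type) (r : seq I) (P : pred I) (F : I -> A) :
  (forall i, P i -> posop (F i)) -> posop (\sum_(i <- r | P i) F i).
Proof. by move=> h; apply: (big_ind posop posop0 posopD). Qed.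

Lemma posop_star c : posop (star c * c).
Proof.
split=> [|x]; first by rewrite /self_adjoint (starM hip vn) (starK hip vn).
by rewrite (repM vn) (rip_rep vn) (starK hip vn) rip_ge0.
Qed.

Lemma posop_sqr a : sa a -> posop (a * a).
Proof. by move=> h; rewrite -{1}h; exact: posop_star. Qed.

Lemma posop_conj a c : posop a -> posop (star c * a * c).
Proof.
move=> [h1 h2]; split=> [|x].
  by rewrite /self_adjoint !(starM hip vn) (starK hip vn) h1 mulrA.
by rewrite !(repM vn) (rip_rep vn) (starK hip vn).
Qed.

Lemma posop_trans a b c : posop (b - a) -> posop (c - b) -> posop (c - a).
Proof.
move=> h1 h2; rewrite (_ : c - a = (b - a) + (c - b)); first exact: posopD.
by rewrite [RHS]addrC addrA subrK.
Qed.

(** The quadratic form vanishes; its values at x + a x and x - a x then give <a x, a x> = 0 by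
    polarization. *)
Lemma posop_sandwich a : posop a -> posop (- a) -> a = 0.
Proof.
move=> [sa_a pa] [_ pn].
have h x : rip (rep a x) x = 0.
  by apply/eqP; rewrite eq_le pa andbT; have := pn x; rewrite (repN vn) ripNl oppr_ge0.
apply: (rep_ext vn) => x; rewrite (rep0 vn); apply: (rip_eq0 hip).
have := h (x + rep a x); have := h (x - rep a x).
rewrite (opB (rep_lin vn a)) (opD (rep_lin vn a)) !(ripDl, ripDr, ripNl, ripNr) !h.
by have := (selfadjP hip vn a).1 sa_a (rep a x) x; lra.
Qed.

Lemma sa_bound a : sa a -> exists2 M : R, 0 < M &
  posop (M%:C *: 1 - a) /\ posop (M%:C *: 1 + a).
Proof.
move=> sa_a; have [M M0 hM] := rep_op_bound hip vn a.
have sM := saZ hip vn ((M + 1) / 2) (sa1 hip vn).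
have h x : `|rip (rep a x) x| <= (M + 1) / 2 * rip x x.
  by apply: le_trans (rip_abs _ _ _) _; have := hM x; lra.
exists ((M + 1) / 2); first lra.
split; split=> [|x].
- exact: (saB hip vn).
- rewrite (repB vn) (repZ vn) (rep1 vn) ripDl ripNl ripZl.
  by have := h x; rewrite ler_norml => /andP[]; lra.
- exact: (saD hip vn).
- rewrite (repD vn) (repZ vn) (rep1 vn) ripDl ripZl.
  by have := h x; rewrite ler_norml => /andP[]; lra.
Qed.

(** The identity y - y^2 = (1 - y) y (1 - y) + y (1 - y) y writes the difference of the two sides as
    a sum of nonnegative values. *)
Lemma contraction_sqr y x : posop y -> posop (1 - y) ->
  rip (rep y x) (rep y x) <= rip (rep y x) x.
Proof.
move=> [sy py] [_ py1].
have := py (x - rep y x); have := py1 (rep y x).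
rewrite (repB vn) (rep1 vn) (opB (rep_lin vn y)) !(ripDl, ripDr, ripNl, ripNr).
have := (selfadjP hip vn y).1 sy (rep y x) x; lra.
Qed.

Lemma contraction_le y x : posop y -> posop (1 - y) ->
  rip (rep y x) (rep y x) <= rip x x.
Proof.
move=> py py1; apply: le_trans (contraction_sqr x py py1) _.
by have := py1.2 x; rewrite (repB vn) (rep1 vn) ripDl ripNl; lra.
Qed.

Definition scvg (u : nat -> A) (a : A) :=
  forall x, hcvg ip (fun n => rep (u n) x) (rep a x).

Lemma scvg_quadratic u a x y : scvg u a ->
  (fun n => rip (rep (u n) x) y) @ \oo --> rip (rep a x) y.
Proof. by move=> h; apply: hcvg_rip. Qed.

Arguments scvg_quadratic {u a} x y _.

Lemma scvg_sa u a : scvg u a -> (forall n, sa (u n)) -> sa a.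
Proof.
move=> h hu; apply/(selfadjP hip vn) => x y.
have h1 := scvg_quadratic x y h; have := scvg_quadratic y x h.
rewrite (_ : (fun n => _) = (fun n => rip (rep (u n) x) y)); last first.
  by apply/funext => n; have /(selfadjP hip vn) -> := hu n; rewrite ripC.
by move=> h2; rewrite (cvg_unique _ h1 h2) // ripC.
Qed.

Lemma scvg_le u a b : scvg u a -> (forall n, sa (u n)) -> sa b ->
  (forall n, posop (b - u n)) -> posop (b - a).
Proof.
move=> h su sb hu.
split=> [|x]; first by apply: (saB hip vn) => //; apply: scvg_sa h su.
rewrite (repB vn) ripDl ripNl subr_ge0.
apply: (cvgr_to_le (scvg_quadratic x x h)); apply: nearW => n.
by have := (hu n).2 x; rewrite (repB vn) ripDl ripNl subr_ge0.
Qed.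

Lemma scvg_ge u a b m : scvg u a -> (forall n, sa (u n)) -> sa b ->
  (forall n, (m <= n)%N -> posop (u n - b)) -> posop (a - b).
Proof.
move=> h su sb hu.
split=> [|x]; first by apply: (saB hip vn) => //; apply: scvg_sa h su.
rewrite (repB vn) ripDl ripNl subr_ge0.
apply: (cvgr_to_ge (scvg_quadratic x x h)); exists m => // n /= mn.
by have := (hu n mn).2 x; rewrite (repB vn) ripDl ripNl subr_ge0.
Qed.

Lemma scvg_commute u a T : bounded_operator T -> scvg u a ->
  (forall n x, rep (u n) (T x) = T (rep (u n) x)) ->
  forall x, rep a (T x) = T (rep a x).
Proof.
move=> [lT cT] h hu x.
apply: (hcvg_unique hip (h (T x))).
rewrite (_ : (fun n => _) = fun n => T (rep (u n) x)); last exact/funext.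
move/(hcvgP hip): (h x) => hx; apply/(hcvgP hip).
exact: (cvg_comp _ _ hx (cT _)).
Qed.

Lemma scvg_N S u a : scvg u a -> (forall n, vN_generated rep S (u n)) ->
  vN_generated rep S a.
Proof.
move=> h hu; apply/(in_NP vn) => T bT cT; apply: (scvg_commute bT h) => n x.
by have /(in_NP vn) := hu n; apply.
Qed.

Lemma posop_mono u n m : (forall k, posop (u k.+1 - u k)) -> (n <= m)%N ->
  posop (u m - u n).
Proof.
move=> h; elim: m => [|m IH]; first by rewrite leqn0 => /eqP ->; rewrite subrr; exact: posop0.
rewrite leq_eqVlt => /predU1P[->|]; first by rewrite subrr; exact: posop0.
by rewrite ltnS => /IH h'; apply: posop_trans h' (h m).
Qed.

(* Vigier's theorem. *)
Lemma scvg_monotone u : (forall n, posop (u n)) -> (forall n, posop (1 - u n)) ->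
  (forall n, posop (u n.+1 - u n)) ->
  exists a, [/\ scvg u a, posop a, posop (1 - a) & forall n, posop (a - u n)].
Proof.
move=> pu pu1 incr.
have su n : sa (u n) by case: (pu n).
(* An increment lies between 0 and 1, so its squared norm on x is at most its quadratic form, and
   the quadratic forms are a bounded monotone real sequence. *)
have contr m n x : (n <= m)%N -> rip (rep (u m) x - rep (u n) x) (rep (u m) x - rep (u n) x)
    <= rip (rep (u m) x) x - rip (rep (u n) x) x.
  move=> nm; rewrite -(repB vn) -ripNl -ripDl -(repB vn).
  apply: contraction_sqr; first exact: posop_mono.
  have -> : 1 - (u m - u n) = u n + (1 - u m) by rewrite opprB addrCA.
  exact: posopD.
have lim x : exists l, hcvg ip (fun n => rep (u n) x) l.
  apply: (hcvg_cauchy hip) => e e0.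
  pose f n := rip (rep (u n) x) x.
  have fmono m n : (n <= m)%N -> f n <= f m.
    by move=> /posop_mono -/(_ u incr) [_ /(_ x)]; rewrite (repB vn) ripDl ripNl subr_ge0.
  have fle n : f n <= rip x x.
    by have := (pu1 n).2 x; rewrite (repB vn) (rep1 vn) ripDl ripNl subr_ge0.
  have Fs : has_sup (range f).
    by split; [exists (f 0%N), 0%N|exists (rip x x) => _ [n _ <-]].
  have [_ [N _ <-] hN] := sup_adherent e0 Fs.
  have hM n m : (N <= n)%N -> (n <= m)%N -> f m - f n < e.
    move=> Nn nm; have : f m <= sup (range f) by apply: sup_upper_bound => //; exists m.
    by have := fmono _ _ Nn; move: hN; lra.
  exists N => m n Nm Nn.
  case: (leqP n m) => nm.
    by apply: le_lt_trans (contr _ _ _ nm) _; apply: hM.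
  rewrite -opprB ripNN.
  by apply: le_lt_trans (contr _ _ _ (ltnW nm)) _; apply: hM => //; exact: ltnW.
have [T hT] := choice lim.
have lT : linear T.
  move=> c x y; apply: (hcvg_unique hip (hT _)); apply/(hcvgP hip).
  rewrite (_ : (fun n => _) = fun n => c *: rep (u n) x + rep (u n) y); last first.
    by apply/funext => n; rewrite (rep_lin vn).
  apply: cvgD; last exact/(hcvgP hip).
  by apply: cvgZr; exact/(hcvgP hip).
have bT x : rip (T x) (T x) <= 1 * rip x x.
  rewrite mul1r -subr_ge0.
  have h1 : (fun n => rip (rep (u n) x) (T x)) @ \oo --> rip (T x) (T x) by apply: hcvg_rip.
  have h2 : rip (T x) (T x) <= (rip x x + rip (T x) (T x)) / 2.
    apply: (cvgr_to_le h1); apply: nearW => n.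
    apply: le_trans (ler_norm _) _; apply: le_trans (rip_abs _ _ _) _.
    by have := contraction_le x (pu n) (pu1 n); lra.
  lra.
have BT : bounded_operator T by split=> //; apply: bounded_continuous bT.
(* The limit commutes with the whole commutant, so the bicommutant property places it in the
   algebra. *)
have [a _ aT] : range rep T.
  rewrite (rep_bicommutant vn); split=> // T' [bT' cT'].
  apply/funext => x /=.
  have : forall n x, rep (u n) (T' x) = T' (rep (u n) x).
    move=> n y; have := cT' (rep (u n)) (ex_intro2 _ _ (u n) I erefl).
    by move=> /(congr1 (fun f => f y)).
  move=> hc; apply: (hcvg_unique hip (hT (T' x))).
  rewrite (_ : (fun n => _) = fun n => T' (rep (u n) x)); last exact/funext.
  move/(hcvgP hip): (hT x) => hx; apply/(hcvgP hip).
  exact: (cvg_comp _ _ hx (bT'.2 _)).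
have sc : scvg u a by move=> x; rewrite aT.
exists a; split=> //.
- rewrite -[a]subr0; apply: (@scvg_ge _ _ _ 0%N sc) => //; first exact: (sa0 hip vn).
  by move=> n _; rewrite subr0.
- by apply: scvg_le sc _ _ _ => //; exact: (sa1 hip vn).
- by move=> n; apply: (@scvg_ge _ _ _ n sc) => // m nm; apply: posop_mono.
Qed.

Definition rpoly (B : A) (p : {poly R}) : A := horner_alg B (map_poly (real_complex R) p).

Lemma rpolyD B p q : rpoly B (p + q) = rpoly B p + rpoly B q.
Proof. by rewrite /rpoly !rmorphD. Qed.

Lemma rpolyB B p q : rpoly B (p - q) = rpoly B p - rpoly B q.
Proof. by rewrite /rpoly !rmorphB. Qed.

Lemma rpolyM B p q : rpoly B (p * q) = rpoly B p * rpoly B q.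
Proof. by rewrite /rpoly !rmorphM. Qed.

Lemma rpolyX B : rpoly B 'X = B.
Proof. by rewrite /rpoly map_polyX horner_algX. Qed.

Lemma rpolyC B c : rpoly B c%:P = c%:C *: 1.
Proof. by rewrite /rpoly map_polyC horner_algC. Qed.

Lemma rpolyZ B c p : rpoly B (c *: p) = c%:C *: rpoly B p.
Proof. by rewrite -mul_polyC rpolyM rpolyC mulr_algl. Qed.

Lemma rpoly_commute B T p : bounded_operator T ->
  (forall x, T (rep B x) = rep B (T x)) ->
  forall x, rep (rpoly B p) (T x) = T (rep (rpoly B p) x).
Proof.
move=> bT h; have : vN_generated rep B (rpoly B p).
  by apply: (Npoly vn); apply: (N_S vn).
by move/(in_NP vn); apply.
Qed.

Lemma rpoly_sa B p : sa B -> sa (rpoly B p).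
Proof.
move=> sB; elim/poly_ind: p => [|p c IH].
  by rewrite -[0]/(0%:P) rpolyC scale0r; exact: (sa0 hip vn).
rewrite rpolyD rpolyM rpolyX rpolyC; apply: (saD hip vn).
  apply: (saM hip vn) => //.
  by rewrite -{2 3}[B](rpolyX B) -!rpolyM mulrC.
exact/(saZ hip vn)/(sa1 hip vn).
Qed.

Lemma posop_exp B n : posop B -> posop (B ^+ n).
Proof.
move=> pB; have sB := posop_sa pB.
have -> : B ^+ n = star (B ^+ n./2) * B ^+ odd n * B ^+ n./2.
  rewrite (saX hip vn) // -!exprD; congr (_ ^+ _).
  by rewrite -[LHS]odd_double_half -addnn addnCA addnA.
apply: posop_conj; case: (odd n); rewrite ?expr1 ?expr0 //; exact: posop1.
Qed.

Definition nneg_poly (p : {poly R}) := forall i, 0 <= p`_i.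

Lemma nneg_polyD p q : nneg_poly p -> nneg_poly q -> nneg_poly (p + q).
Proof. by move=> hp hq i; rewrite coefD addr_ge0. Qed.

Lemma nneg_polyM p q : nneg_poly p -> nneg_poly q -> nneg_poly (p * q).
Proof. by move=> hp hq i; rewrite coefM sumr_ge0 // => j _; rewrite mulr_ge0. Qed.

Lemma nneg_polyZ c p : 0 <= c -> nneg_poly p -> nneg_poly (c *: p).
Proof. by move=> c0 hp i; rewrite coefZ mulr_ge0. Qed.

Lemma nneg_polyX : nneg_poly 'X.
Proof. by move=> i; rewrite coefX ler0n. Qed.

Lemma posop_rpoly B p : posop B -> nneg_poly p -> posop (rpoly B p).
Proof.
move=> pB hp; rewrite -[p]coefK poly_def.
rewrite (big_morph (rpoly B) (rpolyD B) (_ : _ = 0)); last first.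
  by rewrite -[0]/(0%:P) rpolyC scale0r.
apply: posop_sum => i _; rewrite rpolyZ; apply: posopZ.
  exact: hp.
have -> : rpoly B 'X^i = B ^+ i.
  by elim: (nat_of_ord i) => [|j IH]; rewrite ?expr0 ?exprS ?rpolyM ?rpolyX ?IH // -[1]/(1%:P) rpolyC scale1r.
exact: posop_exp.
Qed.

(** The iteration y -> ((1 - a) + y^2) / 2, started at 0, increases to a y with (1 - y)^2 = a. Its
    terms and increments are polynomials in 1 - a with nonnegative coefficients, hence positive, and
    the limit commutes with every bounded operator commuting with [a]. *)
Lemma sqrt_contraction a : posop a -> posop (1 - a) ->
  exists c, [/\ posop c, c * c = a & forall T, bounded_operator T ->
    (forall x, T (rep a x) = rep a (T x)) -> forall x, T (rep c x) = rep c (T x)].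
Proof.
move=> pa pa1.
pose P := fix P n : {poly R} := if n is m.+1 then 2^-1 *: ('X + P m * P m) else 0.
pose u n := rpoly (1 - a) (P n).
have uS n : u n.+1 = (2^-1)%:C *: ((1 - a) + u n * u n).
  by rewrite /u /= rpolyZ rpolyD rpolyX rpolyM.
have nP n : nneg_poly (P n).
  elim: n => [|n IH] /=; first by move=> i; rewrite coef0.
  apply: nneg_polyZ; first by rewrite invr_ge0.
  by apply: nneg_polyD; [exact: nneg_polyX|exact: nneg_polyM].
have nPS n : nneg_poly (P n.+1 - P n).
  elim: n => [|n IH].
    rewrite /= subr0 mulr0 addr0; apply: nneg_polyZ; first by rewrite invr_ge0.
    exact: nneg_polyX.
  have -> : P n.+2 - P n.+1 = 2^-1 *: ((P n.+1 - P n) * (P n.+1 + P n)).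
    transitivity (2^-1 *: ('X + P n.+1 * P n.+1) - 2^-1 *: ('X + P n * P n)); first by [].
    by rewrite -scalerBr; congr (_ *: _); ring.
  apply: nneg_polyZ; first by rewrite invr_ge0.
  by apply: nneg_polyM => //; apply: nneg_polyD.
have pu n : posop (u n) by apply: posop_rpoly.
have pu1 n : posop (1 - u n).
  elim: n => [|n IH]; first by rewrite /u /= -[0]/(0%:P) rpolyC scale0r subr0; exact: posop1.
  rewrite uS.
  have -> : 1 - (2^-1)%:C *: (1 - a + u n * u n) = (2^-1)%:C *: (a + (1 - u n * u n)).
    rewrite -{1}[1]scale1r (_ : 1 = (2^-1)%:C + (2^-1)%:C :> R[i]); last first.
      by apply/eqP; rewrite eq_complex /=; apply/andP; split; apply/eqP; field.
    rewrite scalerDl -addrA -scalerBr -scalerDr; congr (_ *: _).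
    by rewrite opprD opprB (addrA 1 (a - 1)) [1 + (a - 1)]addrC subrK addrCA.
  apply: posopZ; first by rewrite invr_ge0.
  apply: posopD => //; split=> [|x].
    by apply: (saB hip vn); [exact: (sa1 hip vn)|apply: posop_sa; apply: posop_sqr; case: (pu n)].
  rewrite (repB vn) (repM vn) (rep1 vn) ripDl ripNl subr_ge0.
  have -> : rip (rep (u n) (rep (u n) x)) x = rip (rep (u n) x) (rep (u n) x).
    by apply: (selfadjP hip vn (u n)).1; case: (pu n).
  exact: contraction_le.
have incr n : posop (u n.+1 - u n) by rewrite /u -rpolyB; apply: posop_rpoly.
have [y [sc py py1 _]] := scvg_monotone pu pu1 incr.
have yy : scvg (fun n => u n * u n) (y * y).
  move=> x; apply/(hcvgP hip).
  rewrite (_ : (fun n => _) = fun n => rep (u n) (rep (u n) x - rep y x) + rep (u n) (rep y x)).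
    rewrite (repM vn) -[X in _ --> X]add0r; apply: cvgD; last exact/(hcvgP hip)/sc.
    apply/(hcvgP hip) => e e0; have [M hM] := sc x e e0; exists M => n /hM.
    by rewrite subr0; apply: le_lt_trans; apply: contraction_le.
  by apply/funext => n; rewrite (opB (rep_lin vn _)) subrK (repM vn).
have ye : y = (2^-1)%:C *: ((1 - a) + y * y).
  apply: (rep_ext vn) => x; apply: (@hcvg_unique _ _ _ hip (fun n => rep (u n.+1) x)).
    by move=> e e0; have [M hM] := sc x e e0; exists M => n Mn; apply: hM; apply: ltnW.
  apply/(hcvgP hip).
  rewrite (_ : (fun n => _) = fun n => (2^-1)%:C *: (rep (1 - a) x + rep (u n * u n) x)).
    rewrite (repZ vn) (repD vn (1 - a)); apply: cvgZr; apply: cvgD; first exact: cvg_cst.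
    exact/(hcvgP hip)/yy.
  by apply/funext => n; rewrite uS (repZ vn) (repD vn).
exists (1 - y); split=> //.
  have : y + y = 1 - a + y * y.
    rewrite {1 2}ye -scalerDl -[RHS]scale1r; congr (_ *: _).
    by apply/eqP; rewrite eq_complex /=; apply/andP; split; apply/eqP; field.
  move=> h; have -> : (1 - y) * (1 - y) = 1 - (y + y) + y * y.
    by rewrite mulrBl mul1r mulrBr mulr1 opprB opprD addrA addrAC addrA.
  by rewrite h opprD opprB addrA subrK addrC subrK.
move=> T bT hT x; apply/esym.
rewrite (repB vn) (rep1 vn) (repB vn) (rep1 vn) (opB bT.1); congr (_ - _).
apply: (scvg_commute bT sc) => n z; apply: rpoly_commute => // w.
by rewrite !(repB vn) !(rep1 vn) (opB bT.1) hT.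
Qed.

End PositiveOperators.

(** * The normal trace and its domination by vector functionals *)

Section TraceNormality.
Variables (R : realType) (H : completeNormedModType R[i]).
Variable (ip : {dot H for Num.conj}).
Hypothesis hip : hilbert_product ip.
Variables (A : algType R[i]) (star : A -> A) (rep : A -> H -> H).
Hypothesis vn : von_neumann_algebra star rep ip.
Variable tau : {scalar A}.
Hypothesis nf : normal_faithful_tracial_state star tau.
Local Notation rip := (real_product ip).
Local Notation sa := (self_adjoint star).
Local Notation posop := (posop ip star rep).
Local Notation scvg := (scvg ip rep).

Lemma complexMV (c : R) : c != 0 -> c%:C * (c^-1)%:C = 1.
Proof. by move=> c0; rewrite -rmorphM mulfV. Qed.

Lemma rpoly1 (B : A) : rpoly B 1 = 1.
Proof. by rewrite /rpoly !rmorph1. Qed.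

Lemma rpoly0 (B : A) : rpoly B 0 = 0.
Proof. by rewrite /rpoly !rmorph0. Qed.

Lemma sqrt_posop a : posop a ->
  exists c, [/\ posop c, c * c = a & forall T, bounded_operator T ->
    (forall x, T (rep a x) = rep a (T x)) -> forall x, T (rep c x) = rep c (T x)].
Proof.
move=> pa; have [M M0 [hM _]] := sa_bound hip vn (posop_sa pa).
have Mn : M != 0 by rewrite gt_eqF.
pose b := (M^-1)%:C *: a.
have pb : posop b by apply: posopZ => //; rewrite invr_ge0 ltW.
have ab : a = M%:C *: b by rewrite scalerA complexMV // scale1r.
have pb1 : posop (1 - b).
  have -> : 1 - b = (M^-1)%:C *: (M%:C *: 1 - a).
    by rewrite scalerBr scalerA mulrC complexMV // scale1r.
  by apply: posopZ => //; rewrite invr_ge0 ltW.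
have [c [pc cc hc]] := sqrt_contraction hip vn pb pb1.
exists ((Num.sqrt M)%:C *: c); split.
- by apply: posopZ => //; exact: sqrtr_ge0.
- by rewrite -scalerAl -scalerAr cc scalerA -rmorphM /= -expr2 sqr_sqrtr ?ltW // -ab.
move=> T bT hT x; rewrite !(repZ vn) (opZ bT.1) hc // => y.
by rewrite !(repZ vn) (opZ bT.1) hT.
Qed.

Lemma positiveP a : positive star a <-> posop a.
Proof.
split=> [[c ->]|pa]; first exact: posop_star.
by have [c [[sc _] cc _]] := sqrt_posop pa; exists c; rewrite sc cc.
Qed.

(** A square root [c] of [a] commutes with [b], so a b = c b c. *)
Lemma posop_mul a b : posop a -> posop b -> a * b = b * a -> posop (a * b).
Proof.
move=> pa pb ab; have [c [[sc _] cc hc]] := sqrt_posop pa.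
have cb : c * b = b * c.
  apply: (rep_ext vn) => x; rewrite !(repM vn); apply/esym/hc.
    exact: (rep_bounded vn).
  by move=> y; rewrite -!(repM vn) ab.
by rewrite -cc -mulrA cb mulrA -{1}sc; apply: posop_conj.
Qed.

Definition tr (a : A) : R := complex.Re (tau a).

Lemma trD a b : tr (a + b) = tr a + tr b.
Proof. by rewrite /tr raddfD /= ReD. Qed.

Lemma trN a : tr (- a) = - tr a.
Proof. by rewrite /tr raddfN /= ReN. Qed.

Lemma trB a b : tr (a - b) = tr a - tr b.
Proof. by rewrite trD trN. Qed.

Lemma trZ (c : R) a : tr (c%:C *: a) = c * tr a.
Proof. by rewrite /tr linearZ /= ReZ. Qed.

Lemma tr0 : tr 0 = 0.
Proof. by rewrite /tr raddf0. Qed.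

Lemma tr1 : tr 1 = 1.
Proof. by rewrite /tr (tau_one nf). Qed.

Lemma tau_posop a : posop a -> tau a = (tr a)%:C.
Proof. by move/positiveP/(tau_pos nf)/le0_complexP. Qed.

Lemma tr_ge0 a : posop a -> 0 <= tr a.
Proof. by move=> pa; rewrite -ler0c -tau_posop //; apply/(tau_pos nf)/positiveP. Qed.

Lemma tr_le a b : posop (b - a) -> tr a <= tr b.
Proof. by move/tr_ge0; rewrite trB subr_ge0. Qed.

Lemma tr_eq0 a : posop a -> tr a <= 0 -> a = 0.
Proof.
move=> pa a0; apply: (tau_faithful nf); first exact/positiveP.
by rewrite tau_posop // (_ : tr a = 0) //; apply/eqP; rewrite eq_le a0 tr_ge0.
Qed.

Lemma sqr_eq0 a : sa a -> a * a = 0 -> a = 0.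
Proof.
move=> sa_a aa; apply: (rep_ext vn) => x; rewrite (rep0 vn); apply: (rip_eq0 hip).
by rewrite ((selfadjP hip vn a).1 sa_a) -(repM vn) aa (rep0 vn) rip0r.
Qed.

(** By [scvg_le] the strong limit is the least upper bound of the range of [u], which is directed,
    so [tau_normal] applies. *)
Lemma tr_normal u a : (forall n, posop (u n)) -> (forall n, posop (u n.+1 - u n)) ->
  scvg u a -> (forall n, posop (a - u n)) ->
  forall e, 0 < e -> exists n, tr a - tr (u n) < e.
Proof.
move=> pu incr sc ua e e0.
have su n : sa (u n) by case: (pu n).
have mono m n : (m <= n)%N -> posop (u n - u m) by apply: posop_mono.
have pa : posop a by rewrite -[a](subrK (u 0%N)); apply: posopD.
have [_ hl] : supremums (tau @` range u) (tau a).
  apply: (tau_normal nf); first split.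
  - by exists (u 0%N), 0%N.
  - move=> _ _ [m _ <-] [n _ <-]; exists (u (maxn m n)); split; first by exists (maxn m n).
      by apply/positiveP/mono; rewrite leq_maxl.
    by apply/positiveP/mono; rewrite leq_maxr.
  - by move=> _ [n _ <-]; apply/positiveP.
  split=> [_ [n _ <-]|y hy]; first exact/positiveP.
  have py n : posop (y - u n) by apply/positiveP/hy; exists n.
  apply/positiveP/(scvg_le hip vn sc) => //.
  by rewrite -[y](subrK (u 0%N)); apply: (saD hip vn) => //; case: (py 0%N).
apply: contrapT => hn.
have hub : ubound (tau @` range u) (tr a - e)%:C.
  move=> _ [_ [n _ <-] <-]; rewrite tau_posop // lecR.
  by case: lerP => // hc; exfalso; apply: hn; exists n; lra.
by have := hl _ hub; rewrite tau_posop // lecR; lra.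
Qed.

Lemma tr_mono_cvg u a : (forall n, posop (u n)) -> (forall n, posop (u n.+1 - u n)) ->
  scvg u a -> (forall n, posop (a - u n)) -> (fun n => tr (u n)) @ \oo --> tr a.
Proof.
move=> pu incr sc ua; apply/cvgrPdist_lt => e e0.
have [N hN] := tr_normal pu incr sc ua e0; exists N => // n /= Nn.
have h1 := tr_le (ua n); have h2 := tr_le (posop_mono hip vn incr Nn).
by rewrite ger0_norm ?subr_ge0 //; lra.
Qed.

Section Exhaustion.
Variable S : A.
Local Notation N := (vN_generated rep S).

Lemma N_posop_mul a b : N a -> N b -> posop a -> posop b -> posop (a * b).
Proof. by move=> Na Nb pa pb; apply: posop_mul => //; apply: (NC vn Na Nb). Qed.

Lemma N_bound b : posop b -> exists2 M : R, 0 < M & posop (M%:C *: 1 - b).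
Proof. by move=> /posop_sa /(sa_bound hip vn)[M M0 [h _]]; exists M. Qed.

Lemma NR (c : R) : N (c%:C *: 1). Proof. by apply: (NZ vn); exact: (N1 vn). Qed.

(* In place of Zorn's lemma: each step of an increasing sequence gains at least half
   of the trace that can be gained, so that its limit is maximal. *)
Lemma exists_maximal (K : set A) x0 :
  (forall x, K x -> [/\ N x, posop x & posop (1 - x)]) -> K x0 ->
  (forall u a, (forall n, K (u n)) -> (forall n, posop (u n.+1 - u n)) ->
     scvg u a -> N a -> posop a -> posop (1 - a) -> (forall n, posop (a - u n)) ->
     (fun n => tr (u n)) @ \oo --> tr a -> K a) ->
  exists2 x, K x & forall y, K y -> posop (y - x) -> y = x.
Proof.
move=> hK K0 cK.
have next x : exists y, K x -> [/\ K y, posop (y - x) &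
    forall z, K z -> posop (z - x) -> tr z + tr x <= 2 * tr y].
  case: (pselect (K x)) => Kx; last by exists x.
  pose D := [set r | exists y, [/\ K y, posop (y - x) & r = tr y]].
  have Dx : D (tr x) by exists x; split=> //; rewrite subrr; apply: posop0.
  have Dub : has_ubound D.
    exists 1 => _ [y [Ky _ ->]]; have [_ _] := hK y Ky => /tr_le.
    by rewrite tr1.
  have Dz z : K z -> posop (z - x) -> tr z <= sup D.
    by move=> Kz pz; apply: ub_le_sup => //; exists z.
  have xs : tr x <= sup D by apply: ub_le_sup.
  move: xs; rewrite le_eqVlt => /predU1P[xs|xs].
    exists x => _; split=> //; first by rewrite subrr; apply: posop0.
    by move=> z Kz /(Dz z Kz); rewrite -xs; lra.
  have e0 : 0 < (sup D - tr x) / 2 by rewrite divr_gt0 ?subr_gt0.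
  have hs : has_sup D by split=> //; exists (tr x).
  have [_ [y [Ky py ->]] hy] := sup_adherent e0 hs.
  exists y => _; split=> // z Kz pz; have := Dz z Kz pz; lra.
have [f hf] := choice next.
pose u n := iter n f x0.
have Ku n : K (u n) by elim: n => [|n IH] //=; have [] := hf _ IH.
have incr n : posop (u n.+1 - u n) by have [] := hf _ (Ku n).
have hmax n z : K z -> posop (z - u n) -> tr z + tr (u n) <= 2 * tr (u n.+1).
  by move=> Kz pz; have [_ _] := hf _ (Ku n); apply.
have pu n : posop (u n) by have [] := hK _ (Ku n).
have pu1 n : posop (1 - u n) by have [] := hK _ (Ku n).
have [a [sc pa pa1 ua]] := scvg_monotone hip vn pu pu1 incr.
have Na : N a by apply: (scvg_N hip vn sc) => n; have [] := hK _ (Ku n).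
have ct := tr_mono_cvg pu incr sc ua.
have Ka : K a by apply: (cK u).
exists a => // y Ky ya.
(* tr y + tr (u n) is at most 2 tr (u (n + 1)), hence at most 2 tr a; the limit gives tr y <= tr a,
   and the trace is faithful. *)
apply/eqP; rewrite -subr_eq0; apply/eqP/tr_eq0 => //; rewrite trB subr_le0.
rewrite -(lerD2r (tr a)).
apply: (cvgr_to_le (cvgD (cvg_cst (tr y)) ct)); apply: nearW => n /=.
apply: le_trans (hmax n y Ky _) _; first exact: (posop_trans hip vn (ua n) ya).
by have := tr_le (ua n.+1); lra.
Qed.

Lemma posop_vector g : posop g -> g <> 0 -> forall c : R, exists x, c < rip (rep g x) x.
Proof.
move=> pg gn0 c.
have [x hx] : exists x, 0 < rip (rep g x) x.
  apply: contrapT => hn; apply: gn0; apply: (posop_sandwich hip vn pg).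
  split=> [|x]; first by apply: (saN hip vn); case: pg.
  rewrite (repN vn) ripNl oppr_ge0 leNgt; apply/negP => h.
  by apply: hn; exists x.
pose d := rip (rep g x) x; have d0 : 0 < d by [].
exists ((1 + `|c| / d)%:C *: x).
rewrite (opZ (rep_lin vn g)) ripZl ripZr -/d mulrA.
have c0 : 0 <= `|c| / d by rewrite divr_ge0 // ltW.
apply: le_lt_trans (ler_norm c) _.
rewrite -{1}[`|c|](divfK (lt0r_neq0 d0)) ltr_pM2r //.
by set t := `|c| / d in c0 *; nra.
Qed.

(* One half of a Hahn decomposition of the functional [b |-> <b x, x> - tau b]. *)
Lemma dominated_piece g x : N g -> posop g -> posop (1 - g) -> tr g < rip (rep g x) x ->
  exists k, [/\ N k, posop k, posop (g - k), k <> 0 &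
    forall b, N b -> posop b -> tr (k * b) <= rip (rep b x) x].
Proof.
move=> Ng pg pg1 hx.
pose K := [set y | [/\ N y, posop y, posop (g - y) & rip (rep y x) x <= tr y]].
have K0 : K 0.
  split; [exact: (N0 vn)|exact: posop0|by rewrite subr0|].
  by rewrite (rep0 vn) rip0l tr0.
have [y [Ny py pgy hy] ymax] : exists2 y, K y & forall z, K z -> posop (z - y) -> z = y.
  apply: (exists_maximal _ K0) => [y [Ny py pgy _]|u a Ku incr sc Na pa pa1 ua ct].
    by split=> //; apply: posop_trans pgy pg1.
  split=> //.
    apply: (scvg_le hip vn sc) => [n||n]; last by case: (Ku n).
      by case: (Ku n) => _ [].
    by case: pg.
  apply: (ler_cvg_to (scvg_quadratic hip (x := x) (y := x) sc) ct).
  by apply: nearW => n; case: (Ku n).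
have sy : sa y by case: py.
exists (g - y); split=> //; first exact: (NB vn).
- by rewrite subKr.
- by move/eqP; rewrite subr_eq0 => /eqP e; move: hx hy; rewrite -e; lra.
move=> b Nb pb; have [M M0 hM] := N_bound pb.
have Mn : M != 0 by rewrite gt_eqF.
have Mi : 0 <= M^-1 by rewrite invr_ge0 ltW.
pose k := g - y; have Nk : N k by apply: (NB vn).
have pk1 : posop (1 - k).
  have -> : 1 - k = (1 - g) + y by rewrite /k opprB addrA addrAC.
  exact: posopD.
have pkb : posop (k * b) by apply: N_posop_mul.
(* [k * b] rescaled to lie between 0 and [k]. If the quadratic form of [z] at [x] is at most its
   trace, then [y + z] is in [K] and maximality leaves z = 0. *)
pose z := (M^-1)%:C *: (k * b).
have Nz : N z by apply: (NZ vn); apply: (NM vn).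
have pz : posop z by apply: posopZ.
have pkz : posop (k - z).
  have -> : k - z = (M^-1)%:C *: (k * (M%:C *: 1 - b)).
    by rewrite mulrBr scalerBr -scalerAr mulr1 scalerA mulrC complexMV // scale1r.
  apply: posopZ => //; apply: N_posop_mul => //.
  by apply: (NB vn) => //; exact: NR.
have kbz : k * b = M%:C *: z by rewrite scalerA complexMV // scale1r.
have hb : rip (rep (k * b) x) x <= rip (rep b x) x.
  rewrite -subr_ge0 -ripNl -ripDl -(repB vn).
  have -> : b - k * b = (1 - k) * b by rewrite (mulrBl b 1 k) mul1r.
  suff [] : posop ((1 - k) * b) by [].
  by apply: N_posop_mul => //; apply: (NB vn) => //; exact: (N1 vn).
rewrite -/k; case: (lerP (rip (rep z x) x) (tr z)) => hz.
  have : K (y + z).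
    split=> //; first exact: (ND vn); first exact: posopD.
      by rewrite opprD addrA.
    by rewrite (repD vn) ripDl trD lerD.
  move=> /ymax; rewrite addrAC subrr add0r => /(_ pz) yz.
  have z0 : z = 0 by apply: (addrI y); rewrite addr0.
  by rewrite kbz z0 scaler0 tr0; case: pb.
apply: le_trans hb; rewrite kbz trZ (repZ vn) ripZl ler_pM2l //.
exact: ltW.
Qed.

(** [tuple_density] controls finitely many vectors at a time, so [h] cuts the trace down to a part
    that finitely many vectors dominate. *)
Definition vector_dominated (h : A) := exists s : seq H,
  forall b, N b -> posop b -> tr (h * b) <= \sum_(x <- s) rip (rep b x) x.

(** If a maximal x differs from 1, some vector xi satisfies tr (1 - x) < <(1 - x) xi, xi>, and
    [dominated_piece] finds a nonzero k <= 1 - x that can still be added. *)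
Lemma vector_dominated_exhaustion e : 0 < e -> exists h,
  [/\ N h, posop h, posop (1 - h), vector_dominated h & tr (1 - h) < e].
Proof.
pose P h := [/\ N h, posop h, posop (1 - h) & vector_dominated h].
(* A limit of dominated elements may require infinitely many vectors, so [K] asks only for dominated
   elements below x with nearly the same trace. *)
pose K := [set x | [/\ N x, posop x, posop (1 - x) &
  forall e, 0 < e -> exists h, [/\ P h, posop (x - h) & tr x - tr h < e]]].
have P0 : P 0.
  split; [exact: (N0 vn)|exact: posop0|by rewrite subr0; exact: posop1|].
  by exists [::] => b _ _; rewrite big_nil mul0r tr0.
have K0 : K 0.
  split; [exact: (N0 vn)|exact: posop0|by rewrite subr0; exact: posop1|].
  by move=> d d0; exists 0; split=> //; rewrite subrr //; exact: posop0.
have [x [Nx px px1 hx] xmax] : exists2 x, K x & forall z, K z -> posop (z - x) -> z = x.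
  apply: (exists_maximal _ K0) => [y []//|u a Ku incr sc Na pa pa1 ua ct].
  split=> // d d0.
  have pu n : posop (u n) by case: (Ku n).
  have [n hn] := tr_normal pu incr sc ua (divr_gt0 d0 (ltr0Sn _ 1)).
  have [_ _ _ /(_ (d / 2))] := Ku n; case=> [|h [Ph ph hd]]; first by rewrite divr_gt0.
  exists h; split=> //; first exact: posop_trans ph (ua n).
  by move: hn; lra.
have xe1 : x = 1.
  apply: contrapT => xn1.
  have gn0 : 1 - x <> 0 by move/eqP; rewrite subr_eq0 => /eqP /esym.
  have [xi hxi] := posop_vector px1 gn0 (tr (1 - x)).
  have Ng : N (1 - x) by apply: (NB vn) => //; exact: (N1 vn).
  have pg1 : posop (1 - (1 - x)) by rewrite subKr.
  have [k [Nk pk pgk kn0 hk]] := dominated_piece Ng px1 pg1 hxi.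
  apply: kn0.
  have : K (x + k).
    have pxk : posop (1 - (x + k)) by rewrite opprD addrA.
    split=> //; [exact: (ND vn)|exact: posopD|move=> d d0].
    have [h [[Nh ph ph1 [s hs]] pxh hd]] := hx d d0.
    exists (h + k); split.
    - split; [exact: (ND vn)|exact: posopD| |].
        have -> : 1 - (h + k) = (1 - (x + k)) + (x - h).
          by rewrite !opprD !addrA (addrAC _ (- k) x) subrK addrAC.
        exact: posopD.
      exists (rcons s xi) => b Nb pb; rewrite mulrDl trD -cats1 big_cat big_seq1 /=.
      by apply: lerD; [exact: hs|exact: hk].
    - by rewrite opprD addrACA subrr addr0.
    - by rewrite !trD; lra.
  move=> /xmax; rewrite addrAC subrr add0r => /(_ pk) xk.
  by apply: (addrI x); rewrite addr0.
move=> e0; have [h [[Nh ph ph1 vh] _ he]] := hx e e0.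
by exists h; split=> //; rewrite trB -xe1.
Qed.

(** Neumann series for 1 + T^2 = M (1 - v) with 0 <= v <= 1 - 1/M. The partial sums are polynomials
    in T and increase, so that normality can be applied along them. *)
Lemma resolvent_exists T : N T -> sa T ->
  exists g, [/\ N g, posop g, posop (1 - g), g * (1 + T * T) = 1 &
    exists2 p : nat -> {poly R}, (forall n, posop (rpoly T (p n.+1) - rpoly T (p n))) &
      (scvg (fun n => rpoly T (p n)) g /\ forall n, posop (rpoly T (p n)))].
Proof.
move=> NT sT.
have pT := posop_sqr hip vn sT.
have pT1 : posop (1 + T * T) by apply: posopD => //; exact: posop1.
have [M0 M00 hM0] := N_bound pT1.
(* The extra 1 gives M > 1, so the ratio rho = 1 - 1/M is positive and [v] can be divided by it. *)
pose M := M0 + 1.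
have M1 : 1 < M by rewrite /M; lra.
have M00' : 0 < M by lra.
have Mn : M != 0 by rewrite gt_eqF.
have Mi : 0 <= M^-1 by rewrite invr_ge0 ltW.
pose q : {poly R} := 1 - M^-1 *: (1 + 'X * 'X).
have qE : rpoly T q = 1 - (M^-1)%:C *: (1 + T * T).
  by rewrite rpolyB rpolyZ rpolyD rpolyM rpolyX rpoly1.
set v := rpoly T q in qE.
have Nr r : N (rpoly T r) by apply: (Npoly vn).
have pv : posop v.
  have -> : v = (M^-1)%:C *: (1 + (M0%:C *: 1 - (1 + T * T))).
    have MA : M%:C *: 1 = 1 + M0%:C *: 1 :> A.
      by rewrite /M rmorphD /= scalerDl scale1r addrC.
    by rewrite addrA -MA scalerBr scalerA mulrC complexMV // scale1r.
  by apply: posopZ => //; apply: posopD => //; exact: posop1.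
pose rho := 1 - M^-1.
have rho0 : 0 < rho by rewrite subr_gt0 invf_lt1.
have rho1 : rho < 1 by rewrite /rho ltrBlDr ltrDl invr_gt0.
have rhon : rho != 0 by rewrite gt_eqF.
have pvr : posop (rho%:C *: 1 - v).
  have -> : rho%:C *: 1 - v = (M^-1)%:C *: (T * T).
    rewrite qE /rho rmorphB /= scalerBl scale1r scalerDr opprB addrCA addrA.
    by rewrite addrA addrAC addrK addrAC subrr add0r.
  exact: posopZ.
have vcontr x : rip (rep v x) (rep v x) <= rho ^+ 2 * rip x x.
  have pw : posop ((rho^-1)%:C *: v) by apply: posopZ => //; rewrite invr_ge0 ltW.
  have pw1 : posop (1 - (rho^-1)%:C *: v).
    have -> : 1 - (rho^-1)%:C *: v = (rho^-1)%:C *: (rho%:C *: 1 - v).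
      by rewrite scalerBr scalerA mulrC complexMV // scale1r.
    by apply: posopZ => //; rewrite invr_ge0 ltW.
  have := contraction_le hip vn x pw pw1.
  rewrite (repZ vn) ripZl ripZr mulrA -expr2 exprVn mulrC.
  by rewrite ler_pdivrMr ?exprn_gt0 // mulrC.
have vncontr n x : rip (rep (v ^+ n) x) (rep (v ^+ n) x) <= rho ^+ 2 ^+ n * rip x x.
  elim: n => [|n IH]; first by rewrite !expr0 (rep1 vn) mul1r.
  rewrite exprS (repM vn) exprS -mulrA; apply: le_trans (vcontr _) _.
  by rewrite ler_wpM2l ?sqr_ge0.
pose p n : {poly R} := M^-1 *: \sum_(k < n) q ^+ k.
have pE n : (1 + 'X * 'X) * p n = 1 - q ^+ n.
  have q1 : M^-1 *: (1 + 'X * 'X) = - (q - 1) by rewrite opprB subKr.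
  by rewrite /p -scalerAr scalerAl q1 mulNr -subrX1 opprB.
have rq n : rpoly T (q ^+ n) = v ^+ n.
  elim: n => [|n IH]; first by rewrite !expr0 rpoly1.
  by rewrite !exprS rpolyM IH.
have incr n : posop (rpoly T (p n.+1) - rpoly T (p n)).
  rewrite -rpolyB /p big_ord_recr /= -scalerBr (addrC (\sum_(k < n) _)) addrK.
  by rewrite rpolyZ rq; apply: posopZ => //; apply: (posop_exp hip vn).
have pp n : posop (rpoly T (p n)).
  elim: n => [|n IH].
    by rewrite /p big_ord0 scaler0 rpoly0; exact: posop0.
  by rewrite -[rpoly _ _](subrK (rpoly T (p n))); apply: posopD.
have mulE n : (1 + T * T) * rpoly T (p n) = 1 - v ^+ n.
  rewrite -rq -[X in X - _](rpoly1 T) -rpolyB -pE.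
  by rewrite rpolyM rpolyD rpolyM rpolyX rpoly1.
have pp1 n : posop (1 - rpoly T (p n)).
  have -> : 1 - rpoly T (p n) = v ^+ n + T * T * rpoly T (p n).
    have := mulE n; rewrite mulrDl mul1r => /eqP.
    rewrite eq_sym subr_eq => /eqP ->.
    by rewrite addrAC [X in X + _ = _]addrAC subrr add0r addrC.
  apply: (posopD hip vn); first exact: (posop_exp hip vn).
  by apply: N_posop_mul => //; exact: (NM vn).
have [g [sc pg pg1 gp]] := scvg_monotone hip vn pp pp1 incr.
have Ng : N g by apply: (scvg_N hip vn sc) => n.
have NTT : N (1 + T * T) by apply: (ND vn); [exact: (N1 vn)|exact: (NM vn)].
have hg : (1 + T * T) * g = 1.
  apply: (rep_ext vn) => x; rewrite (rep1 vn).
  apply: (@hcvg_unique _ _ _ hip (fun n => rep ((1 + T * T) * rpoly T (p n)) x)).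
    rewrite (_ : (fun n => _) = fun n => rep (1 + T * T) (rep (rpoly T (p n)) x)).
      rewrite (repM vn); apply/(hcvgP hip).
      exact: (cvg_comp _ _ ((hcvgP hip _ _).1 (sc x)) ((rep_bounded vn _).2 _)).
    by apply/funext => n; rewrite (repM vn).
  move=> e e0.
  have : geometric (rip x x) (rho ^+ 2) @ \oo --> (0 : R).
    by apply: cvg_geometric; rewrite ger0_norm ?sqr_ge0 // expr_lt1 // ltW.
  move=> /cvgrPdist_lt /(_ e e0) [m _ hm]; exists m => n /hm /=.
  rewrite sub0r normrN ger0_norm; last by rewrite mulr_ge0 ?rip_ge0 ?exprn_ge0 // ltW.
  apply: le_lt_trans; rewrite mulE (repB vn) (rep1 vn) addrAC subrr add0r ripNN.
  by rewrite mulrC.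
exists g; split=> //; first by rewrite (NC vn Ng NTT).
by exists p.
Qed.

End Exhaustion.
End TraceNormality.

(** * Elements orthogonal to all polynomials in S *)

Section PolynomialDensity.
Variables (R : realType) (H : completeNormedModType R[i]).
Variable (ip : {dot H for Num.conj}).
Hypothesis hip : hilbert_product ip.
Variables (A : algType R[i]) (star : A -> A) (rep : A -> H -> H).
Hypothesis vn : von_neumann_algebra star rep ip.
Variable tau : {scalar A}.
Hypothesis nf : normal_faithful_tracial_state star tau.
Local Notation rip := (real_product ip).
Local Notation sa := (self_adjoint star).
Local Notation posop := (posop ip star rep).
Local Notation scvg := (scvg ip rep).
Local Notation tr := (tr tau).
Variable S : A.
Local Notation N := (vN_generated rep S).

(** In the commutative algebra [N] products of positive elements are positive, so W u_n is again
    increasing and normality applies to it. *)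
Lemma tr_mul_cvg (u : nat -> A) g W : N W -> posop W -> (forall n, N (u n)) ->
  (forall n, posop (u n)) -> (forall n, posop (u n.+1 - u n)) -> scvg u g ->
  (fun n => tr (W * u n)) @ \oo --> tr (W * g).
Proof.
move=> NW pW Nu pu incr sc.
have Ng : N g by apply: (scvg_N hip vn sc).
have mono m n : (m <= n)%N -> posop (u n - u m) by apply: posop_mono.
have gu n : posop (g - u n).
  apply: (scvg_ge hip vn (m := n) sc) => [k||k nk]; [by case: (pu k)|by case: (pu n)|].
  exact: mono.
apply: (tr_mono_cvg hip vn nf) => [n|n|x|n].
- exact: (N_posop_mul hip vn (S := S)).
- by rewrite -mulrBr; apply: (N_posop_mul hip vn (S := S)) => //; [exact: (NB vn)|exact: incr].
- rewrite (_ : (fun n => _) = fun n => rep W (rep (u n) x)).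
    rewrite (repM vn); apply/(hcvgP hip).
    exact: (cvg_comp _ _ ((hcvgP hip _ _).1 (sc x)) ((rep_bounded vn _).2 _)).
  by apply/funext => n; rewrite (repM vn).
- by rewrite -mulrBr; apply: (N_posop_mul hip vn (S := S)) => //; [exact: (NB vn)|exact: gu].
Qed.

Lemma rpoly_comp (B : A) p r : rpoly (rpoly B r) p = rpoly B (p \Po r).
Proof.
elim/poly_ind: p => [|p c IH]; first by rewrite comp_poly0 !rpoly0.
rewrite comp_polyD comp_polyM comp_polyX comp_polyC !rpolyD !rpolyM !rpolyC.
by rewrite rpolyX IH.
Qed.

Lemma N_rpoly B p : N B -> N (rpoly B p).
Proof. by move=> NB; apply: (Npoly vn). Qed.

(** The weight e T is not positive, so [tr_mul_cvg] is applied after polarization, 4 e T = (e + T)^2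
    - (e - T)^2. Each approximant T p_n(T) is a polynomial in S, where the trace against [e] is
    zero. *)
Lemma tr_resolvent0 e r g (p : nat -> {poly R}) : sa S -> N e -> sa e ->
  (forall q, tr (e * rpoly S q) = 0) ->
  (forall n, posop (rpoly (rpoly S r) (p n))) ->
  (forall n, posop (rpoly (rpoly S r) (p n.+1) - rpoly (rpoly S r) (p n))) ->
  scvg (fun n => rpoly (rpoly S r) (p n)) g -> tr (e * (rpoly S r * g)) = 0.
Proof.
move=> sS Ne se h0 pp incr sc.
set T := rpoly S r in pp incr sc *.
have NT : N T by apply: N_rpoly; exact: (N_S vn).
have sT : sa T by exact: (rpoly_sa hip vn).
have NP n : N (rpoly T (p n)) by apply: N_rpoly.
have eT : e * T = T * e by apply: (NC vn Ne NT).
have polar x : tr (e * (T * x)) = 4^-1 * (tr ((e + T) * (e + T) * x) - tr ((e - T) * (e - T) * x)).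
  have -> : (e + T) * (e + T) = (e * e + T * T) + (e * T + e * T).
    by rewrite mulrDl !mulrDr -eT [e * T + T * T]addrC addrACA.
  have -> : (e - T) * (e - T) = (e * e + T * T) - (e * T + e * T).
    by rewrite mulrBl !mulrBr -eT opprB addrACA -opprD.
  by rewrite !mulrDl mulNr !trD trN mulrDl trD !mulrA; field.
have N1' : N ((e + T) * (e + T)) by apply: (NM vn); apply: (ND vn).
have N2' : N ((e - T) * (e - T)) by apply: (NM vn); apply: (NB vn).
have p1 : posop ((e + T) * (e + T)) by apply: (posop_sqr hip vn); apply: (saD hip vn).
have p2 : posop ((e - T) * (e - T)) by apply: (posop_sqr hip vn); apply: (saB hip vn).
have c1 := tr_mul_cvg N1' p1 NP pp incr sc.
have c2 := tr_mul_cvg N2' p2 NP pp incr sc.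
have : (fun n => tr (e * (T * rpoly T (p n)))) @ \oo --> tr (e * (T * g)).
  rewrite polar (_ : (fun n => _) = fun n => 4^-1 * (tr ((e + T) * (e + T) * rpoly T (p n))
    - tr ((e - T) * (e - T) * rpoly T (p n)))); last by apply/funext => n; rewrite polar.
  by apply: cvgMr; apply: cvgB.
rewrite (_ : (fun n => _) = fun=> 0); last first.
  by apply/funext => n; rewrite rpoly_comp -rpolyM h0.
by move=> c; apply: (cvg_unique _ c (cvg_cst 0)).
Qed.

Lemma poly_real_imag (q : {poly R[i]}) : exists p1 p2 : {poly R},
  horner_alg S q = rpoly S p1 + 'i *: rpoly S p2.
Proof.
elim/poly_ind: q => [|q c [p1 [p2 IH]]].
  by exists 0, 0; rewrite !rpoly0 scaler0 addr0 rmorph0.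
exists (p1 * 'X + (complex.Re c)%:P), (p2 * 'X + (complex.Im c)%:P).
rewrite rmorphD rmorphM /= horner_algX horner_algC IH !rpolyD !rpolyM !rpolyX !rpolyC.
rewrite mulrDl -scalerAl {1}(complexE c) scalerDl scalerDr addrACA; congr (_ + (_ + _)).
by rewrite scalerA.
Qed.

(** For self-adjoint contractions [a] and [b] each summand on the right is positive, whence (a -
    b)^2 <= 4. *)
Lemma four_sub_sqrB (a b : A) : 4%:C *: 1 - (a - b) * (a - b) =
  (1 - a * a) + (1 - a * a) + ((1 - b * b) + (1 - b * b)) + (a + b) * (a + b).
Proof.
apply/eqP; rewrite subr_eq -[X in _ == X]addrA; apply/eqP.
have -> : (a + b) * (a + b) + (a - b) * (a - b) = (a * a + a * a) + (b * b + b * b).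
  rewrite mulrBl !mulrBr mulrDl !mulrDr opprB addrACA; congr (_ + _).
    by rewrite addrACA subrr addr0.
  by rewrite [b * b - _]addrC addrACA subrr add0r.
rewrite addrACA [X in X + _]addrACA [X in _ + X]addrACA !subrK.
by rewrite rmorph_nat scaler_nat !mulrS mulr0n addr0 !addrA.
Qed.

Lemma tr_sqrD (d : R) x y : x * y = y * x ->
  tr ((d%:C *: x + y) * (d%:C *: x + y)) =
  d ^+ 2 * tr (x * x) + 2 * d * tr (x * y) + tr (y * y).
Proof.
move=> xy.
have -> : (d%:C *: x + y) * (d%:C *: x + y) =
    d%:C *: (d%:C *: (x * x)) + d%:C *: (x * y) + (d%:C *: (x * y) + y * y).
  by rewrite mulrDl !mulrDr -!scalerAl -!scalerAr -xy.
by rewrite !trD !trZ; ring.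
Qed.

(** As W and U commute, <W x, U x> is real, and the factor i makes it purely imaginary. *)
Lemma selfadjoint_cross W U x : sa W -> sa U -> W * U = U * W ->
  rip (rep W x) ('i *: rep U x) = 0.
Proof.
move=> /(selfadjP hip vn) sW /(selfadjP hip vn) sU WU.
set c := rip _ _.
suff : c = - c by lra.
rewrite {1}/c -(opZ (rep_lin vn U)) -sU -(repM vn) -WU (repM vn) sW (opZ (rep_lin vn W)).
rewrite ripC rip_scale.
have -> : ('i^*)%C = - 'i :> R[i] by apply/eqP; rewrite eq_complex /= oppr0 !eqxx.
by rewrite scaleNr ripNr.
Qed.

(** [tuple_density] gives a complex polynomial. Its imaginary part is orthogonal to the error of its
    real part, so dropping it only reduces the error. *)
Lemma real_approximation e (s : seq H) eps : sa S -> N e -> sa e -> 0 < eps ->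
  exists p : {poly R}, \sum_(x <- s) rip (rep (rpoly S p - e) x) (rep (rpoly S p - e) x) < eps.
Proof.
move=> sS Ne se eps0.
have d0 : 0 < eps / (size s).+1%:R by rewrite divr_gt0.
have [q hq] := tuple_density hip vn (fun i : 'I_(size s) => nth 0 s i) sS Ne d0.
have [p1 [p2 qE]] := poly_real_imag q.
exists p1; rewrite (big_nth 0) big_mkord.
apply: (@le_lt_trans _ _ (\sum_(i < size s) eps / (size s).+1%:R)).
  apply: ler_sum => i _; apply/ltW; apply: le_lt_trans (hq i).
  set x := nth 0 s i.
  have Np p : N (rpoly S p) by apply: N_rpoly; exact: (N_S vn).
  have sp p : sa (rpoly S p) by exact: (rpoly_sa hip vn).
  have -> : rep e x - rep (horner_alg S q) x = - (rep (rpoly S p1 - e) x + 'i *: rep (rpoly S p2) x).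
    by rewrite qE !(repD vn) (repN vn) (repZ vn) [RHS]opprD opprB -addrA -opprD.
  rewrite ripNN ripDD selfadjoint_cross ?mulr0 ?addr0 ?lerDl ?rip_ge0 //.
    exact: (saB hip vn).
  by apply: (NC vn (S := S)) => //; apply: (NB vn).
rewrite sumr_const card_ord -(mulr_natr (eps / _)) mulrAC ltr_pdivrMr //.
by rewrite ltr_pM2l // ltr_nat.
Qed.

Lemma tr_mul_le a b c : N a -> N b -> N c -> posop a -> posop (c - b) ->
  tr (a * b) <= tr (a * c).
Proof.
move=> Na Nb Nc pa pcb; apply: (tr_le hip vn nf); rewrite -mulrBr.
by apply: (N_posop_mul hip vn (S := S)) => //; apply: (NB vn).
Qed.

Lemma resolvent_sqr T g : N T -> N g -> posop g -> posop (1 - g) ->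
  g * (1 + T * T) = 1 -> posop (1 - (T * g) * (T * g)).
Proof.
move=> NT Ng pg pg1 hg.
have Tg := NC vn NT Ng.
have -> : 1 - (T * g) * (T * g) = (1 - g) + g * g.
  have h : g * (T * T) = 1 - g.
    by apply/eqP; rewrite eq_sym subr_eq addrC -hg mulrDr mulr1.
  have -> : T * g * (T * g) = g * (T * T) * g by rewrite {1}Tg !mulrA.
  by rewrite h mulrBl mul1r opprB addrA addrAC.
by apply: (posopD hip vn) => //; apply: (posop_sqr hip vn); case: pg.
Qed.

(* This stands for the L^2-density of the polynomials in [S] in [N]. Kaplansky's
   cutoff [T (1 + T^2)^-1] keeps the approximants bounded. *)
Lemma orthogonal_polynomials_eq0 e : sa S -> N e -> sa e ->
  (forall q, tr (e * rpoly S q) = 0) -> e = 0.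
Proof.
move=> sS Ne se h0.
have [ge [Nge pge pge1 hge _]] := resolvent_exists hip vn Ne se.
pose b := e * ge.
have Nb : N b by apply: (NM vn).
have ege := NC vn Ne Nge.
have sge : sa ge by case: pge.
have sb : sa b by apply: (saM hip vn).
have pb : posop (1 - b * b) by apply: resolvent_sqr.
have pE : posop (e * e) by apply: (posop_sqr hip vn).
have pt : posop (e * b).
  by rewrite /b mulrA; apply: (N_posop_mul hip vn (S := S)) => //; apply: (NM vn).
pose t := tr (e * b); pose E := tr (e * e).
have E0 : 0 <= E by apply: (tr_ge0 hip vn nf).
have t0 : 0 <= t by apply: (tr_ge0 hip vn nf).
(* Comes from tr ((d e + y)^2) >= 0 with y = a - b: here tr (e a) = 0, so tr (e y) = - t, and tr
   (y^2) <= eps. *)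
have main d eps : 0 < d -> 0 < eps -> 2 * d * t <= d ^+ 2 * E + eps.
  move=> d0 eps0.
  have eps8 : 0 < eps / 8 by rewrite divr_gt0.
  have [h [Nh ph ph1 [s hs] he]] := vector_dominated_exhaustion hip vn nf S eps8.
  have [r hr] := real_approximation s sS Ne se eps8.
  set T := rpoly S r in hr.
  have NT : N T by apply: N_rpoly; exact: (N_S vn).
  have sT : sa T by exact: (rpoly_sa hip vn).
  have [g [Ng pg pg1 hg [p incr [sc pp]]]] := resolvent_exists hip vn NT sT.
  have sg : sa g by case: pg.
  have Tg := NC vn NT Ng.
  have tra : tr (e * (T * g)) = 0 by apply: (tr_resolvent0 sS Ne se h0 pp incr sc).
  pose a := T * g.
  have Na : N a by apply: (NM vn).
  have saa : sa a by apply: (saM hip vn).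
  have pa : posop (1 - a * a) by apply: resolvent_sqr.
  pose y := a - b.
  have Ny : N y by apply: (NB vn).
  have sy : sa y by apply: (saB hip vn).
  have c1 x : N x -> e * x = x * e by move=> Nx; apply: (NC vn Ne Nx).
  have c2 x : N x -> T * x = x * T by move=> Nx; apply: (NC vn NT Nx).
  (* A resolvent identity: y is T - e times bounded factors, hence small on the vectors where T
     approximates e. *)
  have yE : y = g * ge * (T - e) - a * b * (T - e).
    have -> : y = (a * (ge * (1 + e * e))) - (b * (g * (1 + T * T))).
      by rewrite hge hg !mulr1.
    rewrite (mulrDr ge) (mulrDr g) !mulr1 (mulrDr a) (mulrDr b).
    have -> : a * ge = g * ge * T by rewrite /a c2 // -mulrA c2 // mulrA.
    have -> : a * (ge * (e * e)) = a * b * e.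
      by rewrite /b !mulrA -(mulrA a ge) -ege mulrA.
    have -> : b * g = g * ge * e by rewrite /b (NC vn Nb Ng) /b c1 // mulrA.
    have -> : b * (g * (T * T)) = a * b * T.
      rewrite (NC vn Na Nb) -mulrA; congr (_ * _).
      by rewrite /a Tg -mulrA.
    by rewrite (mulrBr (g * ge)) (mulrBr (a * b)) opprD opprB addrACA.
  have contr (z x : _) : sa z -> posop (1 - z * z) -> rip (rep z x) (rep z x) <= rip x x.
    move=> /(selfadjP hip vn) sz [_ /(_ x)].
    by rewrite (repB vn) (repM vn) (rep1 vn) ripDl ripNl sz subr_ge0.
  have ynorm x : rip (rep y x) (rep y x) <= 4 * rip (rep (T - e) x) (rep (T - e) x).
    rewrite yE (repB vn) (repM vn (g * ge)) (repM vn (a * b)) (repM vn g) (repM vn a).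
    set v := rep (T - e) x.
    have := rip_le_DD ip (rep g (rep ge v)) (- rep a (rep b v)); rewrite ripNN.
    have := contraction_le hip vn (rep ge v) pg pg1.
    have := contraction_le hip vn v pge pge1.
    by have := contr a (rep b v) saa pa; have := contr b v sb pb; lra.
  have pyy : posop (y * y) by apply: (posop_sqr hip vn).
  (* On the part cut out by [h], y is small by approximation; on 1 - h it is merely bounded, but
     there the trace is small. Both estimates lose a factor 4, hence eps / 8. *)
  have h1 : tr (h * (y * y)) <= eps / 2.
    apply: le_trans (hs _ (NM vn Ny Ny) pyy) _.
    apply: (@le_trans _ _ (\sum_(x <- s) 4 * rip (rep (T - e) x) (rep (T - e) x))).
      apply: ler_sum => x _; rewrite (repM vn).
      by rewrite ((selfadjP hip vn y).1 sy) ynorm.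
    by rewrite -mulr_sumr; move: hr; lra.
  have h2 : tr ((1 - h) * (y * y)) <= eps / 2.
    have N1h : N (1 - h) by apply: (NB vn) => //; exact: (N1 vn).
    have -> : eps / 2 = 4 * (eps / 8) by field.
    apply: (@le_trans _ _ (tr ((1 - h) * (4%:C *: 1)))); last first.
      by rewrite -scalerAr mulr1 trZ ler_pM2l // ltW.
    apply: tr_mul_le => //; [exact: (NM vn)|by apply: (NZ vn); exact: (N1 vn)|].
    have -> : 4%:C *: 1 - y * y = (1 - a * a) + (1 - a * a) + ((1 - b * b) + (1 - b * b)) + (a + b) * (a + b).
      exact: four_sub_sqrB.
    have sab : sa (a + b) by apply: (saD hip vn).
    by do ![apply: (posopD hip vn) => //]; apply: (posop_sqr hip vn).
  have hyy : tr (y * y) <= eps.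
    have -> : tr (y * y) = tr (h * (y * y)) + tr ((1 - h) * (y * y)).
      by rewrite -trD -mulrDl addrC subrK mul1r.
    by lra.
  have hey : tr (e * y) = - t by rewrite /y mulrBr trB tra sub0r.
  have sey : sa (d%:C *: e + y) by apply: (saD hip vn) => //; apply: (saZ hip vn).
  have := tr_ge0 hip vn nf (posop_sqr hip vn sey).
  rewrite (tr_sqrD _ (c1 y Ny)) hey -/E.
  by move: hyy; lra.
have t00 : t = 0.
  apply/eqP; rewrite eq_le t0 andbT leNgt; apply/negP => tp.
  (* With d = t / (E + 1) the gain 2 d t - d^2 E equals d t + d^2, which exceeds eps = t d / 2. *)
  have d0 : 0 < t / (E + 1) by rewrite divr_gt0 // ltr_wpDl.
  have e0 : 0 < t * (t / (E + 1)) / 2 by rewrite divr_gt0 // mulr_gt0.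
  have := main _ _ d0 e0.
  have : t / (E + 1) * (E + 1) = t by rewrite divfK // gt_eqF // ltr_wpDl.
  move: (t / (E + 1)) d0 => d d0 dE.
  have d2 : 0 < d * d by rewrite mulr_gt0.
  have d2E : 0 <= d * d * E by rewrite mulr_ge0 // ltW.
  by rewrite expr2 -dE; lra.
apply: (sqr_eq0 hip vn se).
have : e * b = 0 by apply: (tr_eq0 hip vn nf) => //; rewrite -/t t00.
move=> eb; have -> : e * e = e * b * (1 + e * e); last by rewrite eb mul0r.
by rewrite /b -!mulrA hge mulr1.
Qed.

End PolynomialDensity.

(** * Free Appell polynomials and the regression *)

Section Recursion.

(** [G n] is already correct below [n], and later stages do not change these values, so the value at
    n is read off stage n + 1. *)
Lemma strong_recursion (T : Type) (d : T) (F : nat -> (nat -> T) -> T) :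
  (forall n u v, (forall m, (m < n)%N -> u m = v m) -> F n u = F n v) ->
  exists u, forall n, u n = F n u.
Proof.
move=> hF.
pose G := fix G n : nat -> T :=
  if n is m.+1 then fun k => if k == m then F m (G m) else G m k else fun=> d.
have hG n m : (m < n)%N -> G n m = G m.+1 m.
  elim: n => // n IH; rewrite ltnS leq_eqVlt => /predU1P[-> //|mn].
  by rewrite [LHS]/= ltn_eqF // IH.
exists (fun n => G n.+1 n) => n; rewrite /= eqxx; apply: hF => m mn.
by rewrite hG.
Qed.

(** Both sides run over the triples with i + l + m = k, grouped by i + l on the left and by i on the
    right. *)
Lemma triangular_sum (V : nmodType) (F : nat -> nat -> nat -> V) k :
  \sum_(j < k.+1) \sum_(i < j.+1) F i (j - i)%N (k - j)%N =
  \sum_(i < k.+1) \sum_(l < (k - i).+1) F i l (k - i - l)%N.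
Proof.
elim: k F => [|k IH] F; first by rewrite !big_ord1.
rewrite [LHS]big_ord_recr /=.
transitivity (\sum_(j < k.+1) \sum_(i < j.+1) F i (j - i)%N (k - j).+1 +
   \sum_(i < k.+2) F i (k.+1 - i)%N 0%N).
  congr (_ + _); last by rewrite subnn.
  by apply: eq_bigr => j _; rewrite subSn // -ltnS.
rewrite (IH (fun i l m => F i l m.+1)) [RHS]big_ord_recr [X in _ + X]big_ord_recr /=.
rewrite subnn big_ord1 addrA; congr (_ + F _ _ _).
rewrite -big_split; apply: eq_bigr => i _ /=.
have ik : (i <= k)%N by rewrite -ltnS.
rewrite subSn // [in RHS]big_ord_recr /= subnn; congr (_ + _).
by apply: eq_bigr => l _; rewrite subSn // -ltnS.
Qed.

End Recursion.

Section Appell.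
Variables (C : fieldType) (A : algType C) (tau : {scalar A}).

(* [K i] is the free cumulant of order [i + 1] of [S], and [T k] is the free
   Appell (Kailath-Segall) polynomial of degree [k] of [S]. *)
Definition appell (S : A) (K : nat -> C) (T : nat -> A) :=
  T 0%N = 1 /\ forall k, S * T k = T k.+1 + \sum_(i < k.+1) K i *: T (k - i)%N.

Definition appell_centered (S : A) (K : nat -> C) (T : nat -> A) :=
  appell S K T /\ forall k, tau (T k) = (k == 0%N)%:R.

Section FunctionalOnAppell.
Variables (S : A) (K : nat -> C) (T : nat -> A) (f : {scalar A}).
Hypothesis hT : appell S K T.

Lemma scalarZ (c : C) a : f (c *: a) = c * f a.
Proof. by rewrite linearZ. Qed.

Lemma appell_eq0_powers : (forall k, f (T k) = 0) -> forall n, f (S ^+ n) = 0.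
Proof.
have [T0 TS] := hT.
(* The induction needs f (S^n T_k) for every k; the claim is the case k = 0. *)
move=> h n; rewrite -[S ^+ n]mulr1 -T0; move: 0%N.
elim: n => [|n IH] k; first by rewrite expr0 mul1r.
rewrite exprSr -mulrA TS mulrDr linearD /= IH add0r mulr_sumr linear_sum big1 //=.
by move=> i _; rewrite -scalerAr scalarZ IH mulr0.
Qed.

Lemma powers_eq0_appell : (forall n, f (S ^+ n) = 0) -> forall k, f (T k) = 0.
Proof.
have [T0 TS] := hT.
move=> h k; rewrite -[T k]mul1r -(expr0 S); move: 0%N.
elim/ltn_ind: k => -[|k] IH n; first by rewrite T0 mulr1.
have -> : T k.+1 = S * T k - \sum_(i < k.+1) K i *: T (k - i)%N by rewrite TS addrK.
rewrite mulrBr linearB /= mulrA -exprSr IH // sub0r mulr_sumr linear_sum big1 ?oppr0 //=.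
by move=> i _; rewrite -scalerAr scalarZ IH ?mulr0 // ltnS leq_subr.
Qed.

End FunctionalOnAppell.

Lemma appell_tau_mul S K T : appell_centered S K T -> forall k, tau (S * T k) = K k.
Proof.
move=> [[T0 TS] tT] k; rewrite TS linearD /= tT add0r linear_sum /=.
rewrite big_ord_recr /= big1 ?add0r ?subnn ?(scalarZ tau) ?tT ?mulr1 // => i _.
by rewrite (scalarZ tau) tT subn_eq0 leqNgt ltn_ord mulr0.
Qed.

Lemma appell_tau_mul2 S K T : appell_centered S K T ->
  forall k, tau (S * (S * T k)) = K k.+1 + \sum_(i < k.+1) K i * K (k - i)%N.
Proof.
move=> hT k; rewrite hT.1.2 mulrDr linearD /= (appell_tau_mul hT); congr (_ + _).
rewrite mulr_sumr linear_sum; apply: eq_bigr => i _ /=.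
by rewrite -scalerAr (scalarZ tau) (appell_tau_mul hT).
Qed.

(** If the earlier q_i are centred, applying [l] to the recurrence leaves l (X q_k) = l (q_(k+1)) +
    K_k; the choice K_k = l (X q_k) is what centres q_(k+1). *)
Lemma appell_poly_exists (l : {poly C} -> C) : scalar l -> l 1 = 1 ->
  exists (q : nat -> {poly C}), q 0%N = 1 /\ (forall k,
     'X * q k = q k.+1 + \sum_(i < k.+1) l ('X * q i) *: q (k - i)%N) /\
     forall k, l (q k) = (k == 0%N)%:R.
Proof.
move=> lin l1.
have lD p q : l (p + q) = l p + l q by have := lin 1 p q; rewrite scale1r mul1r.
have l0 : l 0 = 0 by have := lin (-1) 0 0; rewrite scaler0 addr0 mulN1r addNr.
have lZ c p : l (c *: p) = c * l p by have := lin c p 0; rewrite !addr0 l0 addr0.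
have [q hq] := @strong_recursion {poly C} 0 (fun n q => if n is k.+1 then
   'X * q k - \sum_(i < k.+1) l ('X * q i) *: q (k - i)%N else 1) ltac:(
   move=> [|n] u v uv //; rewrite uv //; congr (_ - _); apply: eq_bigr => i _;
   by rewrite !uv // ltnS ?leq_subr // -ltnS).
have q0 : q 0%N = 1 by rewrite hq.
have qS k : 'X * q k = q k.+1 + \sum_(i < k.+1) l ('X * q i) *: q (k - i)%N.
  by rewrite (hq k.+1) subrK.
exists q; split=> //; split=> // k.
elim/ltn_ind: k => -[|k] IH; first by rewrite q0 l1.
have : l ('X * q k) = l (q k.+1) + l ('X * q k).
  rewrite {1}qS lD (big_morph l lD l0) big_ord_recr /= subnn q0 lZ l1 mulr1 big1 ?add0r // => i _.
  by rewrite lZ IH ?ltnS ?leq_subr // subn_eq0 leqNgt ltn_ord mulr0.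
by move=> h; apply: (addIr (l ('X * q k))); rewrite -h add0r.
Qed.

End Appell.

Section ConditionalVariance.
Variables (R : realType) (H : completeNormedModType R[i]).
Variable (ip : {dot H for Num.conj}).
Hypothesis hip : hilbert_product ip.
Variables (A : algType R[i]) (star : A -> A) (rep : A -> H -> H).
Hypothesis vn : von_neumann_algebra star rep ip.
Variable tau : {scalar A}.
Hypothesis nf : normal_faithful_tracial_state star tau.
Local Notation sa := (self_adjoint star).

Lemma horner_alg_sum (S : A) (q : {poly R[i]}) :
  horner_alg S q = \sum_(i < size q) q`_i *: S ^+ i.
Proof.
rewrite -[in LHS](coefK q) poly_def rmorph_sum; apply: eq_bigr => i _ /=.
by rewrite -mul_polyC rmorphM /= rmorphXn /= horner_algX horner_algC mulr_algl.
Qed.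

Lemma tau_poly0 (a S : A) : (forall n, tau (a * S ^+ n) = 0) ->
  forall q : {poly R[i]}, tau (a * horner_alg S q) = 0.
Proof.
move=> h q; rewrite horner_alg_sum mulr_sumr raddf_sum big1 // => i _ /=.
by rewrite -scalerAr (scalarZ tau) h mulr0.
Qed.

(** [E] is known to preserve positivity, so [D] is written as a quarter of the difference of the
    squares of 1 + D and 1 - D. *)
Lemma cond_expectation_sa S E D : cond_expectation star rep tau S E -> sa D -> sa (E D).
Proof.
move=> ce sD.
have sE P : sa P -> sa (E (P * P)).
  move=> sP; apply: (@posop_sa _ _ ip _ star rep).
  apply/(positiveP hip vn)/(ce_pos ce)/(positiveP hip vn).
  exact: (posop_sqr hip vn).
have -> : D = (4^-1)%:C *: ((1 + D) * (1 + D) - (1 - D) * (1 - D)).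
  have -> : (1 + D) * (1 + D) - (1 - D) * (1 - D) = 4%:R *: D.
    rewrite mulrBl !mulrBr mulrDl !mulrDr !mul1r !mulr1 !opprB.
    rewrite [D - D * D + _]addrC addrACA [1 + D]addrC [X in X + _]addrACA subrr addr0.
    by rewrite [X in _ + X]addrACA subrr addr0 scaler_nat !mulrS mulr0n addr0 !addrA.
  rewrite scalerA -(rmorph_nat (real_complex R)) -rmorphM /= mulVf ?pnatr_eq0 //.
  by rewrite scale1r.
rewrite linearZ linearB /=; apply: (saZ hip vn); apply: (saB hip vn); apply: sE.
  by apply: (saD hip vn) => //; exact: (sa1 hip vn).
by apply: (saB hip vn) => //; exact: (sa1 hip vn).
Qed.

Lemma cond_expectation_mulr S E a b : cond_expectation star rep tau S E ->
  vN_generated rep S b -> E (a * b) = E a * b.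
Proof.
move=> ce Nb; have := ce_bimodule ce a (N1 vn S) Nb.
by rewrite !mul1r.
Qed.

Lemma cond_expectation_mull S E a b : cond_expectation star rep tau S E ->
  vN_generated rep S b -> E (b * a) = b * E a.
Proof.
move=> ce Nb; have := ce_bimodule ce a Nb (N1 vn S).
by rewrite !mulr1.
Qed.

Lemma cond_expectation_eq0 S E D : sa S -> sa D ->
  cond_expectation star rep tau S E -> (forall n, tau (D * S ^+ n) = 0) -> E D = 0.
Proof.
move=> sS sD ce h.
apply: (orthogonal_polynomials_eq0 hip vn nf sS) => [||q].
- exact: (ce_range ce).
- exact: cond_expectation_sa ce sD.
- rewrite /tr -(cond_expectation_mulr _ ce) ?(ce_tau ce) ?tau_poly0 //.
  by apply: (N_rpoly vn); exact: (N_S vn).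
Qed.

(** The vanishing moments give E D = 0 for D = 2 X - S, that is 2 E X = S, and then E (D^2) = 4
    Var(X | S). *)
Lemma cond_variance_moments S X V : sa S -> sa X ->
  (forall n, tau ((X + X - S) * S ^+ n) = 0) -> cond_variance star rep tau X S V ->
  forall n, tau ((X + X - S) * (X + X - S) * S ^+ n) = 4 * tau (V * S ^+ n).
Proof.
move=> sS sX h [E ce ->] n.
have NS : vN_generated rep S S by exact: (N_S vn).
have sD : sa (X + X - S) by apply: (saB hip vn) => //; apply: (saD hip vn).
have ED := cond_expectation_eq0 sS sD ce h.
have EXX : E X + E X = S.
  by move: ED; rewrite linearB linearD /= (ce_id ce NS) => /eqP; rewrite subr_eq0 => /eqP.
set v := E (X ^+ 2) - E X ^+ 2.
have EDX : E ((X + X - S) * X) = v + v.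
  rewrite mulrBl mulrDl linearB linearD /= (cond_expectation_mull _ ce NS) -expr2.
  by rewrite -{1}EXX mulrDl -expr2 opprD addrACA.
have EDD : E ((X + X - S) * (X + X - S)) = 4 *: v.
  rewrite mulrBr linearB /= (cond_expectation_mulr _ ce NS) ED mul0r subr0.
  by rewrite mulrDr linearD /= EDX scaler_nat !mulrS mulr0n addr0 !addrA.
rewrite -(ce_tau ce) (cond_expectation_mulr _ ce) ?EDD; last exact: (NX vn).
by rewrite -scalerAl (scalarZ tau).
Qed.

End ConditionalVariance.

(** * Appell polynomials of a sum of two free elements with the same moments *)

Section FreeSum.
Variables (R : realType) (A : algType R[i]) (tau : {scalar A}) (x : bool -> A).
Hypothesis tau1 : tau 1 = 1.
Hypothesis free_x : free_family tau x.
Hypothesis same_moments : forall n, tau (x true ^+ n) = tau (x false ^+ n).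
Hypothesis mean0 : tau (x true) = 0.

Lemma same_poly_moments c (p : {poly R[i]}) :
  tau (horner_alg (x c) p) = tau (horner_alg (x true) p).
Proof.
rewrite -(coefK p) poly_def !rmorph_sum !linear_sum; apply: eq_bigr => i _ /=.
rewrite -mul_polyC !rmorphM /= !rmorphXn /= !horner_algX !horner_algC !mulr_algl.
by rewrite !(scalarZ tau); case: c; rewrite // same_moments.
Qed.

Lemma sorted_rcons2 (T : Type) (e : rel T) (w : seq T) p r :
  sorted e (rcons (rcons w p) r) = sorted e (rcons w p) && e p r.
Proof. by case: w => [|a w] /=; rewrite ?andbT // !rcons_path last_rcons. Qed.

(** T_k is a sum of centred alternating words, and x_c T_k = Q_(k+1)(not c) + sum of kap_i T_(k-i),
    with the same sum for both c. Adding the two relations gives the recurrence of the sum, with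
    cumulants 2 kap (additivity under freeness); subtracting them leaves Q_(k+1)(false) -
    Q_(k+1)(true), of trace zero. *)
Lemma free_sum_appell : exists (K : nat -> R[i]) (T : nat -> A),
  [/\ appell_centered tau (x true + x false) K T,
      forall k, tau ((x true - x false) * T k) = 0 &
      forall k, tau ((x true - x false) * (x true - x false) * T k) = K k.+1].
Proof.
pose l p := tau (horner_alg (x true) p).
have lin : scalar l.
  move=> a p q; rewrite /l -mul_polyC rmorphD rmorphM /= horner_algC mulr_algl.
  by rewrite linearD /= (scalarZ tau).
have l1 : l 1 = 1 by rewrite /l rmorph1 tau1.
have [q [q0 [qS lq]]] := appell_poly_exists lin l1.
pose kap i := l ('X * q i).
have kap0 : kap 0%N = 0 by rewrite /kap q0 mulr1 /l horner_algX mean0.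
pose xq c j := horner_alg (x c) (q j).
have xq0 c : xq c 0%N = 1 by rewrite /xq q0 rmorph1.
have xqS c j : x c * xq c j = xq c j.+1 + \sum_(i < j.+1) kap i *: xq c (j - i)%N.
  have := congr1 (horner_alg (x c)) (qS j).
  rewrite rmorphM /= horner_algX rmorphD rmorph_sum /= => ->; congr (_ + _).
  by apply: eq_bigr => i _; rewrite -mul_polyC rmorphM /= horner_algC mulr_algl.
have xq1 c : xq c 1%N = x c.
  by have := xqS c 0%N; rewrite xq0 mulr1 big_ord1 kap0 scale0r addr0.
have txq c j : tau (xq c j) = (j == 0%N)%:R by rewrite -lq; apply: same_poly_moments.
(* [Q k c] is the sum of the centred alternating products
   [q j1 (x c1) * q j2 (x c2) * ...] with [j1 + j2 + ... = k], [ji >= 1] and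
   [c1 <> c]. *)
have [Q hQ] := @strong_recursion (bool -> A) (fun=> 0) (fun k Q c =>
    (k == 0%N)%:R + \sum_(j < k) xq (~~ c) j.+1 * Q (k - j.+1)%N (~~ c)) ltac:(
  move=> n u v uv; apply/funext => c; congr (_ + _); apply: eq_bigr => j _;
  by rewrite uv //; have := ltn_ord j; lia).
have Q0 c : Q 0%N c = 1 by rewrite hQ big_ord0 addr0.
have QS c k : Q k.+1 c = \sum_(j < k.+1) xq (~~ c) j.+1 * Q (k - j)%N (~~ c).
  by rewrite hQ add0r.
(* The words in [Q k c] begin with the index other than [c], so they may follow a word ending in
   [c]. The induction moves the first letter of [Q] to the end of [w], until freeness applies. *)
have tw k : forall (w : seq (bool * {poly R[i]})) p,
    sorted (fun p q => p.1 != q.1) (rcons w p) ->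
    (forall r, r \in rcons w p -> tau (horner_alg (x r.1) r.2) = 0) ->
    tau ((\prod_(r <- rcons w p) horner_alg (x r.1) r.2) * Q k p.1) = 0.
  elim/ltn_ind: k => -[|k] IH w p sw cw.
    by rewrite Q0 mulr1 free_x // -size_eq0 size_rcons.
  rewrite QS mulr_sumr linear_sum big1 // => j _ /=; rewrite mulrA.
  have := IH (k - j)%N _ (rcons w p) (~~ p.1, q j.+1).
  rewrite big_rcons /=; apply.
  - by rewrite ltnS leq_subr.
  - by rewrite sorted_rcons2 sw /=; case: (p.1).
  - move=> r; rewrite mem_rcons inE => /predU1P[->|/cw //] /=.
    exact: txq.
have txQ c j k : tau (xq c j * Q k c) = ((j == 0%N) && (k == 0%N))%:R.
  case: j => [|j].
    rewrite xq0 mul1r; case: k => [|k]; first by rewrite Q0 tau1.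
    rewrite QS linear_sum big1 // => j _ /=.
    have := tw (k - j)%N [::] (~~ c, q j.+1); rewrite big_seq1 /=; apply=> //.
    by move=> r; rewrite inE => /eqP -> /=; exact: txq.
  have := tw k [::] (c, q j.+1); rewrite big_seq1 /=; apply=> //.
  by move=> r; rewrite inE => /eqP -> /=; exact: txq.
have tQ c k : tau (Q k c) = (k == 0%N)%:R.
  by have := txQ c 0%N k; rewrite xq0 mul1r.
(* Nonempty words are separated by their first index; the empty word lies in both families, hence
   the correction at k = 0. *)
pose T k := Q k true + Q k false - (k == 0%N)%:R.
have TE c k : T k = \sum_(j < k.+1) xq c j * Q (k - j)%N c.
  rewrite big_ord_recl xq0 mul1r subn0 /T.
  have -> : \sum_(j < k) xq c (lift ord0 j) * Q (k - lift ord0 j)%N c =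
     Q k (~~ c) - (k == 0%N)%:R.
    case: k => [|k]; first by rewrite big_ord0 Q0 subrr.
    by rewrite QS negbK subr0; apply: eq_bigr => j _; rewrite lift0 subSS.
  by case: c; rewrite addrA // [Q k true + _]addrC.
have xT c k : x c * T k = Q k.+1 (~~ c) + \sum_(i < k.+1) kap i *: T (k - i)%N.
  rewrite (TE c) mulr_sumr QS negbK.
  have -> : \sum_(i < k.+1) kap i *: T (k - i)%N =
    \sum_(i < k.+1) \sum_(l < (k - i).+1) kap i *: (xq c l * Q (k - i - l)%N c).
    by apply: eq_bigr => i _; rewrite (TE c) scaler_sumr.
  rewrite -(triangular_sum (fun i l m => kap i *: (xq c l * Q m c))) -big_split.
  apply: eq_bigr => j _ /=; rewrite mulrA xqS mulrDl mulr_suml; congr (_ + _).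
  by apply: eq_bigr => i _; rewrite scalerAl.
have DT k : (x true - x false) * T k = Q k.+1 false - Q k.+1 true.
  by rewrite mulrBl !xT opprD addrACA subrr addr0.
(* Only the one-letter word q_(k+1)(x_c) contributes to this trace. *)
have txx c k : tau (x c * Q k.+1 (~~ c)) = kap k.+1.
  rewrite QS negbK mulr_sumr linear_sum /=.
  have -> : \sum_(j < k.+1) tau (x c * (xq c j.+1 * Q (k - j)%N c)) =
    \sum_(j < k.+1) (j == k :> nat)%:R * kap k.+1.
    apply: eq_bigr => j _; rewrite mulrA xqS mulrDl linearD /= txQ add0r.
    rewrite mulr_suml linear_sum /= big_ord_recr /= subnn big1 ?add0r => [|i _].
      rewrite -scalerAl (scalarZ tau) txQ /= subn_eq0 mulrC.
      have -> : (k <= j)%N = (j == k :> nat) by rewrite eqn_leq (leq_ord j).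
      by case: eqP => [->|] //; rewrite !mul0r.
    by rewrite -scalerAl (scalarZ tau) txQ subn_eq0 leqNgt ltn_ord mulr0.
  by rewrite big_ord_recr /= eqxx mul1r big1 ?add0r // => i _; rewrite ltn_eqF ?mul0r.
exists (fun i => 2 * kap i), T; split.
- split=> [|k]; first split=> [|k].
  + by rewrite /T !Q0 addrK.
  + rewrite mulrDl !xT /= addrACA /T [Q k.+1 false + _]addrC subr0; congr (_ + _).
    rewrite -big_split; apply: eq_bigr => i _ /=.
    by rewrite -scalerDl -[2]/(1 + 1) mulrDl mul1r.
  + rewrite /T linearB linearD /= !tQ -mulr_natl mulr1.
    by case: (k == 0%N); rewrite ?tau1 ?linear0 ?addrK ?subr0 ?addr0.
- by move=> k; rewrite DT linearB /= !tQ subrr.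
- move=> k; rewrite -mulrA DT mulrBr !mulrBl !linearB /= !(txx true) !(txx false).
  have h c : tau (x c * Q k.+1 c) = 0 by rewrite -{1}(xq1 c) txQ.
  by rewrite !h subr0 oppr0 sub0r opprK -[2]/(1 + 1) mulrDl mul1r.
Qed.

End FreeSum.

(** * The recursion for the free cumulants *)

Section MeixnerCoefficients.
Variables (F : comNzRingType) (eta sigma : F).

(* [mcoef k n] is the coefficient of [z^k] in the [n]th power of the power
   series [rho] such that [rho = z (1 + eta rho + sigma rho^2)]. *)
Fixpoint mcoef (k n : nat) : F :=
  if k is k'.+1 then
    if n is n'.+1 then mcoef k' n' + eta * mcoef k' n + sigma * mcoef k' n.+1 else 0
  else (n == 0%N)%:R.

Lemma mcoef0n n : mcoef 0 n = (n == 0%N)%:R. Proof. by []. Qed.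

Lemma mcoefk0 k : mcoef k 0 = (k == 0%N)%:R. Proof. by case: k. Qed.

Lemma mcoefSS k n : mcoef k.+1 n.+1 =
  mcoef k n + eta * mcoef k n.+1 + sigma * mcoef k n.+2.
Proof. by []. Qed.

(** Coefficients of rho rho^n = rho^(n+1). *)
Lemma mcoef_mul k n : \sum_(i < k.+1) mcoef i 1 * mcoef (k - i) n = mcoef k n.+1.
Proof.
elim: k n => [|k IH] n; first by rewrite big_ord1 /= mul0r.
rewrite big_ord_recr /= subnn mcoef0n.
case: n => [|n].
  rewrite mulr1 big1 ?add0r // => i _.
  by rewrite mcoefk0 subn_eq0 leqNgt ltn_ord mulr0.
rewrite mulr0 addr0 -!IH !mulr_sumr -!big_split /=.
apply: eq_bigr => i _; rewrite subSn; last by rewrite -ltnS.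
by rewrite mcoefSS; ring.
Qed.

Lemma mcoef_unique (rho : nat -> F) : rho 0%N = 0 ->
  (forall k, rho k.+1 = (k == 0%N)%:R + eta * rho k +
     sigma * \sum_(i < k.+1) rho i * rho (k - i)%N) ->
  forall k, rho k = mcoef k 1.
Proof.
move=> r0 rS; elim/ltn_ind => -[|k] IH; first by rewrite r0.
rewrite rS mcoefSS mcoefk0 IH // -(mcoef_mul k 1); congr (_ + _ * _).
apply: eq_bigr => i _; rewrite !IH // ?ltnS ?leq_subr //; exact: ltn_ord.
Qed.

End MeixnerCoefficients.

Lemma mcoef_real (R : realType) (eta sigma : R) k n :
  mcoef eta%:C sigma%:C k n = (mcoef eta sigma k n)%:C.
Proof.
elim: k n => [|k IH] [|n] //=.
by rewrite !IH !rmorphD !rmorphM.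
Qed.

Section RegressionCumulants.
Variables (R : realType) (A : algType R[i]) (tau : {scalar A}).

(** The functional a -> tau (D^2 a) - 4 tau (V a) vanishes on the powers of S, hence on the Appell
    polynomials, where it becomes a quadratic recursion for K. *)
Lemma regression_cumulants (S D V : A) (K : nat -> R[i]) (T : nat -> A)
    (eta sigma c u : R) : 0 < u -> appell_centered tau S K T ->
  tau S = 0 -> tau (S ^+ 2) = u%:C ->
  (forall k, tau (D * D * T k) = K k.+1) ->
  (forall n, tau (D * D * S ^+ n) = 4 * tau (V * S ^+ n)) ->
  V = c%:C *: (1 + (eta / u)%:C *: S + (sigma / u ^+ 2)%:C *: S ^+ 2) ->
  forall k, K k = (u * mcoef eta sigma k 1)%:C.
Proof.
move=> u0 hT tS tSS hD hV VE.
have [[T0 TS] tT] := hT.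
have un : u%:C != 0 :> R[i] by rewrite eq_complex /= negb_and gt_eqF.
have K0 : K 0%N = 0 by rewrite -(appell_tau_mul hT) T0 mulr1.
have K1 : K 1%N = u%:C.
  by have := appell_tau_mul2 hT 0; rewrite big_ord1 K0 mul0r addr0 T0 mulr1 -expr2 tSS.
have rec k : K k.+1 = 4 * c%:C * ((k == 0%N)%:R + (eta / u)%:C * K k +
    (sigma / u ^+ 2)%:C * (K k.+1 + \sum_(i < k.+1) K i * K (k - i)%N)).
  pose f (a : A) : R[i] := tau (D * D * a) - 4 * tau (V * a).
  have flin : scalar f.
    move=> z a b; rewrite /f !mulrDr -!scalerAr !linearD /= !(scalarZ tau).
    by ring.
  pose f' : {scalar A} := HB.pack f (GRing.isLinear.Build _ _ _ _ f flin).
  have /(_ k) : forall k, f' (T k) = 0.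
    apply: (powers_eq0_appell hT.1) => n; rewrite /f' /= /f hV subrr //.
  have tV : tau (V * T k) = c%:C * ((k == 0%N)%:R + (eta / u)%:C * K k +
      (sigma / u ^+ 2)%:C * (K k.+1 + \sum_(i < k.+1) K i * K (k - i)%N)).
    rewrite VE -scalerAl (scalarZ tau) !mulrDl mul1r -!scalerAl [S ^+ 2]expr2 -mulrA.
    by rewrite !linearD /= !(scalarZ tau) tT (appell_tau_mul hT) (appell_tau_mul2 hT).
  by rewrite /f' /= /f hD tV mulrA => /eqP; rewrite subr_eq0 => /eqP.
(* The case k = 0 reads u = 4 c (1 + sigma / u). It eliminates the unknown constant and shows that 4
   c is nonzero, so 4 c can be cancelled below. *)
have := rec 0%N; rewrite eqxx big_ord1 K0 mulr0 mul0r !addr0 K1 => rec0.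
set g := 4 * c%:C in rec rec0.
have rhoE : forall k, K k / u%:C = mcoef eta%:C sigma%:C k 1.
  apply: mcoef_unique => [|k]; first by rewrite K0 mul0r.
  have -> : \sum_(i < k.+1) K i / u%:C * (K (k - i)%N / u%:C) =
     (\sum_(i < k.+1) K i * K (k - i)%N) / u%:C ^+ 2.
    by rewrite mulr_suml; apply: eq_bigr => i _; field.
  have := rec k.
  rewrite !rmorphM !fmorphV !rmorphXn /= in rec0 *.
  set s := \sum_(i < k.+1) _; set d := (k == 0%N)%:R.
  set U := u%:C in un rec0 *; set x := K k; set y := K k.+1.
  set et := eta%:C; set sg := sigma%:C in rec0 *.
  move=> reck.
  have gn : g != 0 by apply: contra_neq un => g0; rewrite rec0 g0 mul0r.
  have e1 : g * (U + sg) = U ^+ 2.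
    transitivity (U * (g * (1 + sg / U ^+ 2 * U))); last by rewrite -rec0 expr2.
    by field; exact: un.
  have e2 : g * y * U = g * (U ^+ 2 * d + et * U * x + sg * s).
    have -> : g * y * U = (g * (U + sg)) * y - g * sg * y by ring.
    rewrite e1 {1}reck; field; exact: un.
  have e3 : y * U = U ^+ 2 * d + et * U * x + sg * s.
    by apply: (mulfI gn); rewrite -e2; ring.
  apply: (mulfI un); apply: (mulfI un).
  rewrite [LHS](_ : _ = y * U); last by field; exact: un.
  rewrite e3; field; exact: un.
move=> k; rewrite rmorphM /= -mcoef_real -rhoE.
by rewrite mulrC divfK.
Qed.

End RegressionCumulants.

(** * The moment-cumulant formula *)

Section NoncrossingStacks.
Local Open Scope nat_scope.
Variable n : nat.
Implicit Types (P : {set {set 'I_n}}) (O U B : {set 'I_n}) (r : nat).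

(** Initial segments of [O]: a block closed at a point below [O] must take the nearest open points,
    since otherwise it would cover one that stays open. *)
Definition lower U O : bool :=
  (U \subset O) && [forall u in U, forall o in O :\: U, u < o].

Lemma lowerP U O : reflect (U \subset O /\ forall u o, u \in U -> o \in O -> o \notin U -> u < o)
  (lower U O).
Proof.
apply: (iffP andP) => -[sUO h]; split=> //.
  move=> u o uU oO oU; move/forall_inP: h => /(_ u uU) /forall_inP /(_ o); apply.
  by rewrite inE oU.
apply/forall_inP => u uU; apply/forall_inP => o; rewrite inE => /andP[oU oO].
exact: h.
Qed.

(** [O] has exactly one initial segment of each size; the induction removes the largest point of
    [O]. *)
Lemma lower_sum (V : nmodType) (f : nat -> V) O :
  (\sum_(j < #|O|.+1) f j = \sum_(U : {set 'I_n} | lower U O) f #|U|)%R.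
Proof.
move: {2}#|O| (erefl #|O|) => k; elim: k O => [|k IH] O Ok.
  have O0 : O = finset.set0 by apply/eqP; rewrite -cards_eq0 Ok.
  rewrite Ok big_ord1 (big_pred1 finset.set0) ?cards0 // => U.
  rewrite O0; apply/lowerP/eqP => [[]|->]; first by rewrite finset.subset0 => /eqP.
  by split; [exact: finset.sub0set|move=> u o; rewrite inE].
have [m0 m0O] : exists m, m \in O by apply/card_gt0P; rewrite Ok.
have [m mO mmax] := @arg_maxnP _ m0 (mem O) (fun i : 'I_n => i : nat) m0O.
have {}mO : m \in O by [].
have {}mmax (j : 'I_n) : j \in O -> j <= m by move=> /mmax.
have Om : #|O :\ m| = k by have := cardsD1 m O; rewrite mO Ok => -[].
rewrite Ok big_ord_recr /= (bigD1 O) /=; last first.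
  by apply/lowerP; split=> // u o _ -> .
rewrite addrC Ok; congr (_ + _)%R.
rewrite -Om (IH _ Om); apply: eq_bigl => U; apply/lowerP/andP.
  move=> [/fintype.subsetP sU h]; split.
    apply/lowerP; split=> [|u o uU oO oU].
      by apply/fintype.subsetP => u /sU; rewrite !inE => /andP[].
    have [om|om] := eqVneq o m; last by apply: h => //; rewrite !inE om.
    rewrite om; have := sU _ uU; rewrite !inE => /andP[um uO].
    by rewrite ltn_neqAle um; apply: mmax.
  apply/eqP => UO; have := sU m; rewrite UO mO !inE eqxx.
  by move=> /(_ isT).
move=> [/lowerP[/fintype.subsetP sU h] UO].
have mU : m \notin U.
  apply/negP => mU; case/negP: UO; apply/eqP/finset.setP => x; apply/idP/idP => [/sU //|xO].
  apply/contraT => xU; have := h m x mU xO xU; have := mmax x xO.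
  by rewrite /= => ? ?; lia.
split=> [|u o uU]; last by rewrite !inE => /andP[_ oO]; apply: h.
apply/fintype.subsetP => u uU; rewrite !inE sU // andbT.
by apply: contraNneq mU => <-.
Qed.

(* [P] is a noncrossing partition of the points [>= r] outside [O], and no block
   of [P] covers a point of [O]: the points of [O] are still to be joined to
   points [< r]. *)
Record stack_conf r P O : Prop := {
  conf_neq0 : forall B, B \in P -> B != finset.set0;
  conf_cover : forall i : 'I_n, r <= i -> i \notin O -> exists2 B, B \in P & i \in B;
  conf_range : forall B (i : 'I_n), B \in P -> i \in B -> r <= i /\ i \notin O;
  conf_disj : forall B1 B2 i, B1 \in P -> B2 \in P -> i \in B1 -> i \in B2 -> B1 = B2;
  conf_open : forall o : 'I_n, o \in O -> r <= o;
  conf_nc : forall B1 B2 (i j k l : 'I_n), B1 \in P -> B2 \in P -> B1 != B2 ->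
    i \in B1 -> k \in B1 -> j \in B2 -> l \in B2 -> i < j -> j < k -> k < l -> False;
  conf_nocover : forall B (o i k : 'I_n), B \in P -> o \in O -> i \in B -> k \in B ->
    i < o -> o < k -> False }.

Lemma noncrossingP P : reflect (forall B1 B2 (i j k l : 'I_n), B1 \in P -> B2 \in P ->
    B1 != B2 -> i \in B1 -> k \in B1 -> j \in B2 -> l \in B2 ->
    i < j -> j < k -> k < l -> False) (noncrossing P).
Proof.
apply: (iffP forall_inP) => h.
  move=> B1 B2 i j k l P1 P2 B12 iB kB jB lB ij jk kl.
  move/forall_inP: (h B1 P1) => /(_ B2 P2); rewrite B12 /= => /negP; apply.
  apply/existsP; exists i; rewrite iB; apply/existsP; exists j; rewrite jB.
  apply/existsP; exists k; rewrite kB; apply/existsP; exists l; rewrite lB.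
  by rewrite ij jk kl.
move=> B1 P1; apply/forall_inP => B2 P2; apply/implyP => B12; apply/negP.
move=> /existsP[i /andP[iB /existsP[j /andP[jB /existsP[k /andP[kB /existsP[l]]]]]]].
move=> /andP[lB /and3P[ij jk kl]].
exact: (h B1 B2 i j k l).
Qed.

Lemma conf0P P : `[< stack_conf 0 P finset.set0 >] =
  finset.partition P (finset.setTfor 'I_n) && noncrossing P.
Proof.
apply/asboolP/andP => [[h1 h2 h3 h4 h5 h6 h7]|[/and3P[/eqP cP /finset.trivIsetP tP P0] /noncrossingP nc]].
  split; last exact/noncrossingP.
  apply/and3P; split.
  - apply/eqP/finset.setP => i; rewrite inE; apply/finset.bigcupP.
    by have [//||B BP iB] := h2 i; [rewrite inE|exists B].
  - apply/finset.trivIsetP => B1 B2 B1P B2P B12; rewrite -finset.setI_eq0.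
    apply/eqP/finset.setP => i; rewrite !inE; apply/negP => /andP[i1 i2].
    by case/eqP: B12; exact: (h4 _ _ i).
  - by apply/negP => /h1; rewrite eqxx.
split=> //.
- by move=> B BP; apply: contraNneq P0 => <-.
- move=> i _ _; have : i \in finset.cover P by rewrite cP inE.
  by move=> /finset.bigcupP[B BP iB]; exists B.
- by move=> B i _ _; rewrite inE.
- move=> B1 B2 i B1P B2P i1 i2; apply/eqP/contraT => B12.
  have := tP _ _ B1P B2P B12; rewrite -finset.setI_eq0 => /eqP/finset.setP/(_ i).
  by rewrite !inE i1 i2.
- by move=> B o i k _; rewrite inE.
Qed.

Lemma confnP P O : stack_conf n P O <-> P = finset.set0 /\ O = finset.set0.
Proof.
split=> [c|[-> ->]].
  split; apply/finset.setP => x; rewrite [RHS]inE; apply/negP => hx.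
    have := conf_neq0 c hx => /finset.set0Pn[i ix].
    by have [h _] := conf_range c hx ix; have := ltn_ord i; lia.
  by have h := conf_open c hx; have := ltn_ord x; lia.
split=> //.
- by move=> B; rewrite inE.
- by move=> i ni; have := ltn_ord i; lia.
- by move=> B i; rewrite inE.
- by move=> B1 B2 i; rewrite inE.
- by move=> o; rewrite inE.
- by move=> B1 B2 i j k l; rewrite inE.
- by move=> B o i k; rewrite inE.
Qed.

Section Step.
Variable r : 'I_n.

(** First alternative for the point [r]: it stays open, to be joined to a smaller point. *)
Lemma conf_push P O : r \notin O ->
  (stack_conf r P (r |: O) <-> stack_conf r.+1 P O).
Proof.
move=> rO; split=> [[h1 h2 h3 h4 h5 h6 h7]|[h1 h2 h3 h4 h5 h6 h7]].
  split=> //.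
  - move=> i ri iO; apply: h2; first by lia.
    by rewrite !inE negb_or iO andbT; apply/eqP => ir; move: ri; rewrite ir ltnn.
  - move=> B i BP iB; have [ri] := h3 B i BP iB; rewrite !inE negb_or => /andP[ir ->].
    by split=> //; rewrite ltn_neqAle ri andbT eq_sym.
  - move=> o oO; rewrite ltn_neqAle h5 ?inE ?oO ?orbT // andbT.
    by apply: contraNneq rO => ro; rewrite (_ : r = o) //; apply: val_inj.
  - by move=> B o i k BP oO; apply: (h7 B) => //; rewrite !inE oO orbT.
split=> //.
- move=> i ri; rewrite !inE negb_or => /andP[ir iO]; apply: h2 => //.
  by rewrite ltn_neqAle ri andbT eq_sym.
- move=> B i BP iB; have [ri iO] := h3 B i BP iB; split; first exact: ltnW.
  by rewrite !inE negb_or iO andbT; apply/eqP => ir; move: ri; rewrite ir ltnn.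
- by move=> o; rewrite !inE => /orP[/eqP -> //|/h5/ltnW].
- move=> B o i k BP; rewrite !inE => /orP[/eqP ->|oO iB kB]; last exact: (h7 B).
  by move=> iB _; have [] := h3 B i BP iB; lia.
Qed.

(** Second alternative: [r] is the smallest point of its block, whose other points are the lowest
    open ones. *)
Lemma conf_close P O U : stack_conf r.+1 P O -> lower U O ->
  [/\ stack_conf r ((r |: U) |: P) (O :\: U), r \notin O :\: U, r \notin U,
      r |: U \notin P & U \subset O].
Proof.
move=> [h1 h2 h3 h4 h5 h6 h7] /lowerP[sUO low]; have /fintype.subsetP sU := sUO.
have rO : r \notin O by apply/negP => /h5; rewrite ltnn.
have rU : r \notin U by apply: contra rO => /sU.
have rP B : B \in P -> r \notin B.
  by move=> BP; apply/negP => /(h3 _ _ BP)[]; rewrite ltnn.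
have in0 (i : 'I_n) : i \in r |: U -> i = r \/ (i \in U /\ r < i).
  by rewrite !inE => /orP[/eqP ->|iU]; [left|right; split=> //; apply/h5/sU].
have disj B i : B \in P -> i \in B -> i \in r |: U -> False.
  move=> BP iB /in0[ir|[iU _]]; first by have := rP _ BP; rewrite -ir iB.
  by have [_] := h3 _ _ BP iB; rewrite sU.
split=> //; last first.
- by apply/negP => /rP; rewrite !inE eqxx.
- by rewrite !inE rU.
split.
- move=> B; rewrite !inE => /orP[/eqP ->|/h1 //].
  by apply/finset.set0Pn; exists r; rewrite !inE eqxx.
- move=> i ri; rewrite !inE negb_and negbK => hi.
  have [ir|ir] := eqVneq i r; first by exists (r |: U); rewrite !inE ?eqxx // ir eqxx.
  have [iU|iU] := boolP (i \in U); first by exists (r |: U); rewrite !inE ?eqxx // iU orbT.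
  have [||B BP iB] := h2 i; last by exists B; rewrite // !inE BP orbT.
    by rewrite ltn_neqAle ri andbT eq_sym.
  by move: hi; rewrite (negbTE iU).
- move=> B i; rewrite !inE => /orP[/eqP -> /in0[->|[iU ri]]|BP iB].
  + by rewrite leqnn (negbTE rO) andbF.
  + by rewrite iU ltnW.
  + by have [ri iO] := h3 _ _ BP iB; rewrite ltnW // (negbTE iO) andbF.
- move=> B1 B2 i; rewrite !inE => /orP[/eqP ->|B1P] /orP[/eqP ->|B2P] // i1 i2.
  + by case: (disj _ _ B2P i2 i1).
  + by case: (disj _ _ B1P i1 i2).
  + exact: (h4 _ _ i).
- by move=> o; rewrite !inE => /andP[_ /h5/ltnW].
- move=> B1 B2 i j k l; rewrite !inE.
  move=> /orP[/eqP ->|B1P] /orP[/eqP ->|B2P]; rewrite ?eqxx // => B12 iB kB jB lB ij jk kl.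
  + case/in0: kB => [kr|[kU rk]]; last exact: (h7 B2 k j l B2P (sU _ kU)).
    by have [rj _] := h3 _ _ B2P jB; have := ltn_trans rj jk; rewrite kr ltnn.
  + case/in0: jB => [jr|[jU rj]]; last exact: (h7 B1 j i k B1P (sU _ jU)).
    by have [ri _] := h3 _ _ B1P iB; have := ltn_trans ri ij; rewrite jr ltnn.
  + exact: (h6 B1 B2 i j k l).
- move=> B o i k; rewrite !inE => /orP[/eqP ->|BP] /andP[oU oO].
  + move=> _ /in0[->|[kU _]] _ ok; first by have := h5 o oO; lia.
    by have := low k o kU oO oU; lia.
  + exact: (h7 B).
Qed.

(** Inverse of [conf_close]: removing the block of [r] reopens its other points. *)
Lemma conf_unclose P O : stack_conf r P O -> r \notin O ->
  let B0 := finset.pblock P r in let U := B0 :\ r in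
  [/\ stack_conf r.+1 (P :\ B0) (O :|: U), lower U (O :|: U),
      (r |: U) |: (P :\ B0) = P & (O :|: U) :\: U = O].
Proof.
move=> [h1 h2 h3 h4 h5 h6 h7] rO B0 U.
have rc : r \in finset.cover P.
  by have [//|//|B BP rB] := h2 r; apply/finset.bigcupP; exists B.
have B0P : B0 \in P by apply: finset.pblock_mem.
have rB0 : r \in B0 by rewrite finset.mem_pblock.
have inU i : i \in U -> [/\ i \in B0, i != r, r < i & i \notin O].
  rewrite !inE => /andP[ir iB]; have [ri iO] := h3 _ _ B0P iB.
  by split=> //; rewrite ltn_neqAle ri andbT eq_sym.
have rUB : r |: U = B0 by rewrite finset.setD1K.
split.
- split.
  + by move=> B; rewrite !inE => /andP[_ /h1].
  + move=> i ri; rewrite !inE !negb_or negb_and negbK => /andP[iO hi].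
    have ir : i != r by apply/eqP => ir; move: ri; rewrite ir ltnn.
    have [||B BP iB] := h2 i => //; first exact: ltnW.
    exists B => //; rewrite !inE BP andbT; apply/eqP => BB.
    by move: hi; rewrite (negbTE ir) /= -BB iB.
  + move=> B i; rewrite !inE => /andP[BB BP] iB; have [ri iO] := h3 _ _ BP iB.
    have iB0 : i \notin B0.
      by apply/negP => i0; case/eqP: BB; exact: (h4 _ _ i).
    rewrite (negbTE iO) (negbTE iB0) andbF; split=> //.
    rewrite ltn_neqAle ri andbT; apply: contraNneq iB0 => ir.
    by rewrite (_ : i = r) //; apply: val_inj.
  + move=> B1 B2 i; rewrite !inE => /andP[_ B1P] /andP[_ B2P]; exact: h4.
  + move=> o; rewrite inE => /orP[oO|/inU[]//].
    rewrite ltn_neqAle h5 // andbT; apply: contraNneq rO => ro.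
    by rewrite (_ : r = o) //; apply: val_inj.
  + move=> B1 B2 i j k l; rewrite !inE => /andP[_ B1P] /andP[_ B2P]; exact: h6.
  + move=> B o i k; rewrite 2!inE => /andP[BB BP]; rewrite inE => /orP[oO|oU] iB kB.
      exact: (h7 B).
    move=> io ok; have [oB0 _ ro _] := inU _ oU.
    have ri : r < i.
      have [ri _] := h3 _ _ BP iB; rewrite ltn_neqAle ri andbT.
      apply: contraNneq BB => rri; apply/eqP/(h4 _ _ r) => //.
      by rewrite (_ : r = i) //; apply: val_inj.
    by apply: (h6 B0 B r i o k) => //; rewrite eq_sym.
- apply/lowerP; split; first exact: finset.subsetUr.
  move=> u o uU; rewrite finset.in_setU => /orP[oO|->//] oU.
  have [uB0 _ ru uO] := inU _ uU.
  rewrite ltnNge; apply/negP => ou.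
  have ro : r < o.
    rewrite ltn_neqAle h5 // andbT; apply: contraNneq rO => ro.
    by rewrite (_ : r = o) //; apply: val_inj.
  apply: (h7 B0 o r u) => //; rewrite ltn_neqAle ou andbT.
  by apply: contraNneq uO => ou'; rewrite (_ : u = o) //; apply: val_inj.
- by rewrite rUB finset.setD1K.
- apply/finset.setP => i; rewrite finset.in_setD finset.in_setU.
  have [iU|iU] := boolP (i \in U); last by rewrite orbF.
  by have [_ _ _ /negbTE ->] := inU _ iU.
Qed.

End Step.
End NoncrossingStacks.

Section MomentCumulant.
Variables (R : realType) (A : algType R[i]) (tau : {scalar A}).
Variables (S : A) (K : nat -> R[i]) (T : nat -> A).
Hypothesis hT : appell_centered tau S K T.

Section Size.
Variable n : nat.

Local Notation conf r x := `[< stack_conf r x.1 x.2 >].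

Definition stack_weight (P : {set {set 'I_n}}) : R[i] := \prod_(B in P) K #|B|.-1.

(** The expansion of S^(n-r) over the points >= r: closed blocks contribute cumulants, and k open
    points contribute T_k. *)
Definition stack_sum r : A :=
  \sum_(x : {set {set 'I_n}} * {set 'I_n} | conf r x) stack_weight x.1 *: T #|x.2|.

Lemma stack_sum_top : stack_sum n = 1.
Proof.
rewrite /stack_sum (big_pred1 (finset.set0, finset.set0)) => [|[P O]].
  by rewrite /stack_weight big_set0 scale1r cards0 hT.1.1.
by apply/asboolP/eqP => /= [/confnP[-> ->] //|[-> ->]]; apply/confnP.
Qed.

Lemma conf_pblock r P (O : {set 'I_n}) (B : {set 'I_n}) i : stack_conf r P O -> B \in P -> i \in B ->
  finset.pblock P i = B.
Proof.
move=> c BP iB.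
have ic : i \in finset.cover P by apply/finset.bigcupP; exists B.
apply: (conf_disj c (i := i)) => //; first exact: finset.pblock_mem.
by rewrite finset.mem_pblock.
Qed.

(** In S T_k = T_(k+1) + sum of K_i T_(k-i), the first term leaves [r] open, and the term of index i
    closes [r] with the i lowest open points, a block of size i + 1. *)
Lemma stack_sum_step (r : 'I_n) : S * stack_sum r.+1 = stack_sum r.
Proof.
rewrite [RHS](bigID (fun x : {set {set 'I_n}} * {set 'I_n} => r \in x.2)) /=.
rewrite /stack_sum mulr_sumr.
have -> : \sum_(x : {set {set 'I_n}} * {set 'I_n} | conf r.+1 x) S * (stack_weight x.1 *: T #|x.2|) =
  \sum_(x : {set {set 'I_n}} * {set 'I_n} | conf r.+1 x) stack_weight x.1 *: T #|x.2|.+1 +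
  \sum_(x : {set {set 'I_n}} * {set 'I_n} | conf r.+1 x)
    \sum_(U : {set 'I_n} | lower U x.2) (stack_weight x.1 * K #|U|) *: T (#|x.2| - #|U|)%N.
  rewrite -big_split; apply: eq_bigr => -[P O] _ /=.
  rewrite -scalerAr hT.1.2 scalerDr; congr (_ + _).
  rewrite (lower_sum (fun i => K i *: T (#|O| - i)%N)) scaler_sumr.
  by apply: eq_bigr => U _; rewrite scalerA.
congr (_ + _).
  rewrite [RHS](reindex_onto (fun x => (x.1, r |: x.2)) (fun x => (x.1, x.2 :\ r))) /=; last first.
    by move=> [P O] /= /andP[_ rO]; rewrite finset.setD1K.
  symmetry; apply: eq_big => [[P O]|[P O]] /=.
    apply/idP/idP => [/andP[/andP[/asboolP c _] /eqP[e]]|/asboolP c].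
      apply/asboolP/conf_push => //.
      by rewrite -e !inE eqxx.
    have rO : r \notin O by apply/negP => /(conf_open c); rewrite ltnn.
    rewrite finset.setU1K // eqxx !inE eqxx !andbT.
    by apply/asboolP/conf_push.
  move=> /andP[_ /eqP[e]]; rewrite cardsU1 -{1}e.
  by rewrite !inE eqxx.
rewrite pair_big_dep /=.
pose h (y : ({set {set 'I_n}} * {set 'I_n}) * {set 'I_n}) :=
  ((r |: y.2) |: y.1.1, y.1.2 :\: y.2).
pose h' (x : {set {set 'I_n}} * {set 'I_n}) :=
  ((x.1 :\ finset.pblock x.1 r, x.2 :|: (finset.pblock x.1 r :\ r)), finset.pblock x.1 r :\ r).
rewrite [RHS](reindex_onto h h') /=; last first.
  move=> [P O] /= /andP[/asboolP c rO].
  by have [_ _ e1 e2] := conf_unclose c rO; rewrite /h /h' /= e1 e2.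
have hh' y : stack_conf r.+1 y.1.1 y.1.2 -> lower y.2 y.1.2 -> h' (h y) = y.
  move: y => [[P O] U] /= c low.
  have [c' rO rU BP sUO] := conf_close c low.
  rewrite /h' /h /= (conf_pblock c' (B := r |: U)) ?inE ?eqxx //.
  rewrite !finset.setU1K //; congr ((_, _), _).
  apply/finset.setP => i; rewrite !inE.
  by case: (boolP (i \in U)) => [/(fintype.subsetP sUO) ->|]; rewrite ?orbT ?orbF.
have hclose y : stack_conf r (h y).1 (h y).2 -> r \notin (h y).2 -> h' (h y) = y ->
    stack_conf r.+1 y.1.1 y.1.2 /\ lower y.2 y.1.2.
  move=> c rO e.
  suff : stack_conf r.+1 (h' (h y)).1.1 (h' (h y)).1.2 /\
    lower (h' (h y)).2 (h' (h y)).1.2 by rewrite e.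
  by have [] := conf_unclose c rO.
symmetry; apply: eq_big => [y|y] /=.
  apply/idP/idP => [/andP[/andP[/asboolP c rO] /eqP e]|/andP[/asboolP c low]].
    by have [c' ->] := hclose y c rO e; rewrite andbT; apply/asboolP.
  have [c' rO _ _ _] := conf_close c low.
  by rewrite rO hh' // eqxx !andbT; apply/asboolP.
move=> /andP[/andP[/asboolP c rO] /eqP e].
have [c' low] := hclose y c rO e; have [_ _ rU BP sUO] := conf_close c' low.
rewrite /stack_weight big_setU1 //= cardsU1 rU /= cardsDS //.
by rewrite [X in X *: _]mulrC.
Qed.

Lemma stack_sumE r : (r <= n)%N -> stack_sum (n - r) = S ^+ r.
Proof.
elim: r => [|r IH] rn; first by rewrite subn0 stack_sum_top.
have nr : (n - r.+1 < n)%N by lia.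
rewrite exprS -IH ?(ltnW rn) //.
by rewrite -(stack_sum_step (Ordinal nr)) /= -subSn // subSS.
Qed.

(** The trace kills T_k for k > 0, so only the configurations without open points remain. The
    predecessor appears because K_i has order i + 1. *)
Lemma appell_moment : tau (S ^+ n) =
  \sum_(P : {set {set 'I_n}} | finset.partition P (finset.setTfor 'I_n) && noncrossing P)
    \prod_(B in P) K #|B|.-1.
Proof.
rewrite -stack_sumE // subnn /stack_sum linear_sum /=.
rewrite (bigID (fun x : {set {set 'I_n}} * {set 'I_n} => x.2 == finset.set0)) /=.
rewrite [X in _ + X]big1 ?addr0 => [|[P O] /= /andP[_ O0]]; last first.
  by rewrite (scalarZ tau) hT.2 cards_eq0 (negbTE O0) mulr0.
rewrite (reindex_onto (fun P : {set {set 'I_n}} => (P, finset.set0 : {set 'I_n})) fst) /=; last first.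
  by move=> [P O] /= /andP[_ /eqP ->].
apply: eq_big => [P|P _]; first by rewrite !eqxx !andbT conf0P.
by rewrite (scalarZ tau) cards0 hT.1.1 -hT.1.1 hT.2 mulr1.
Qed.

End Size.

Lemma appell_free_cumulants : free_cumulants tau S (fun k => K k.-1).
Proof. exact: appell_moment. Qed.

End MomentCumulant.

(** * The R-transform *)

Lemma horner_continuous (K : numFieldType) (p : {poly K}) :
  continuous (horner p : K^o -> K^o).
Proof.
elim/poly_ind: p => [|p c IH] x.
  have -> : (horner (0 : {poly K}) : K^o -> K^o) = cst 0 by apply/funext => y; rewrite horner0.
  exact: cst_continuous.
have -> : (horner (p * 'X + c%:P) : K^o -> K^o) = (horner p \* id) \+ cst c.
  by apply/funext => y; rewrite hornerMXaddC.
by apply: continuousD; [apply: continuousM; [exact: IH|exact: cvg_id] | exact: cst_continuous].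
Qed.

Section ComplexSquareRoot.
Variable R : realType.
Implicit Types z f w : R[i].

Lemma normCE z : `|z| = (complex.Re `|z|)%:C.
Proof. exact: le0_complexP. Qed.

Lemma norm_Re_ge z : (complex.Re z)%:C <= `|z|.
Proof.
apply: le_trans (normc_ge_Re z); rewrite lecR; exact: ler_norm.
Qed.

Lemma Re_sqr z : complex.Re (z ^+ 2) = complex.Re z ^+ 2 - complex.Im z ^+ 2.
Proof. by case: z => x y; rewrite expr2 /= !expr2. Qed.

Lemma Im_sqr z : complex.Im (z ^+ 2) = 2 * complex.Re z * complex.Im z.
Proof. by case: z => x y; rewrite expr2 /=; ring. Qed.

Lemma sqrt_Re_gt0_exists f : 0 < complex.Re f \/ complex.Im f <> 0 ->
  exists2 w, w ^+ 2 = f & 0 < complex.Re w.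
Proof.
move=> hf; pose s := sqrtc f; have ss : s ^+ 2 = f by exact: sqr_sqrtc.
have sn : complex.Re s != 0.
  apply/eqP => s0; case: hf.
    by rewrite -ss Re_sqr s0 expr0n /= sub0r oppr_gt0 ltNge sqr_ge0.
  by rewrite -ss Im_sqr s0 mulr0 mul0r.
case: (ltrgt0P (complex.Re s)) => h.
- by exists s.
- by exists (- s); rewrite ?sqrrN // ReN oppr_gt0.
- by rewrite h eqxx in sn.
Qed.

(** From |w z - w y| |w z + w y| = |f z - f y|, where the second factor is at least Re (w z). *)
Lemma sqrt_continuous (D : set R[i]^o) (f w : R[i]^o -> R[i]^o) :
  continuous f -> (forall z, D z -> w z ^+ 2 = f z) ->
  (forall z, D z -> 0 < complex.Re (w z)) -> {within D, continuous w}.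
Proof.
move=> cf hw pw; apply/subspace_continuousP => z Dz.
apply/cvgrPdist_lt => _ /gt0_complexP[e e0 ->].
have h0 : 0 < (e * complex.Re (w z))%:C :> R[i] by rewrite ltcR mulr_gt0 ?pw.
have /cvgrPdist_lt /(_ _ h0) := cf z.
rewrite near_withinE; apply: filterS => y hy Dy.
have : `|w z - w y| * `|w z + w y| < (e * complex.Re (w z))%:C.
  by rewrite -normrM -subr_sqr !hw.
have : (complex.Re (w z))%:C <= `|w z + w y|.
  apply: le_trans (norm_Re_ge _); rewrite lecR ReD lerDl ltW // pw //.
rewrite [`|w z - w y|]normCE [`|w z + w y|]normCE -rmorphM !ltcR lecR.
set p := complex.Re `|w z - w y|; set q := complex.Re `|w z + w y|.
have p0 : 0 <= p by rewrite -ler0c -normCE.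
have := pw z Dz; set s := complex.Re (w z) => s0 sq pq.
rewrite ltNge; apply/negP => ep.
have : e * s <= p * q by apply: ler_pM => //; apply: ltW.
by rewrite leNgt pq.
Qed.

End ComplexSquareRoot.

Lemma quadratic_root (F : fieldType) (a b z w : F) :
  w ^+ 2 = (1 - a * z) ^+ 2 - 4 * z ^+ 2 * b -> 1 - a * z + w != 0 ->
  let r := 2 * z / (1 - a * z + w) in r = z * (1 + a * r + b * r ^+ 2).
Proof.
move=> w2 dn r; rewrite /r; set d := 1 - a * z + w in dn *.
have dE : 4 * z ^+ 2 * b = 2 * d * (1 - a * z) - d ^+ 2.
  have -> : 4 * z ^+ 2 * b = (1 - a * z) ^+ 2 - w ^+ 2 by rewrite w2; ring.
  by rewrite /d; ring.
have -> : z * (1 + a * (2 * z / d) + b * (2 * z / d) ^+ 2) =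
    z * (d ^+ 2 + 2 * a * z * d + 4 * z ^+ 2 * b) / d ^+ 2 by field.
by rewrite dE; field.
Qed.

Section MeixnerSeries.
Variables (R : realType) (eta sigma : R).

(** [B] bounds 1 + eta rho + sigma rho^2 for |rho| <= 1. As e B = 1/16, eta z and sigma z are so
    small for |z| < e that the discriminant has positive real part. *)
Let B : R := 1 + `|eta| + `|sigma|.
Let e : R := (16 * B)^-1.

(** The partial sums and the powers of rho obey the same recursion, so each step multiplies the
    error by at most |z| B. All exponents n are treated together because the recursion for n
    involves n + 1. *)
Lemma meixner_partial_sum (z rho : R[i]) : `|rho| <= 1 ->
  rho = z * (1 + eta%:C * rho + sigma%:C * rho ^+ 2) ->
  forall N n, `|\sum_(k < N) (mcoef eta sigma k n)%:C * z ^+ k - rho ^+ n| <=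
    (`|z| * B%:C) ^+ N.
Proof.
move=> r1 rE; elim=> [|N IH] n.
  by rewrite big_ord0 sub0r normrN normrX expr0 exprn_ile1.
case: n => [|n].
  rewrite big_ord_recl mcoef0n big1 => [|i _]; last by rewrite mcoefk0 /= mul0r.
  rewrite /= expr0 mulr1 addr0 subrr normr0 exprn_ge0 // mulr_ge0 //.
  by rewrite ler0c /B !addr_ge0.
rewrite big_ord_recl mcoef0n /= mul0r add0r.
have -> : \sum_(i < N) (mcoef eta sigma (bump 0 i) n.+1)%:C * z ^+ bump 0 i - rho ^+ n.+1 =
  z * ((\sum_(i < N) (mcoef eta sigma i n)%:C * z ^+ i - rho ^+ n) +
   eta%:C * (\sum_(i < N) (mcoef eta sigma i n.+1)%:C * z ^+ i - rho ^+ n.+1) +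
   sigma%:C * (\sum_(i < N) (mcoef eta sigma i n.+2)%:C * z ^+ i - rho ^+ n.+2)).
  have rS : rho ^+ n.+1 = z * (rho ^+ n + eta%:C * rho ^+ n.+1 + sigma%:C * rho ^+ n.+2).
    by rewrite {1}exprS {1}rE !exprS; ring.
  rewrite [in LHS]rS.
  have -> : \sum_(i < N) (mcoef eta sigma (bump 0 i) n.+1)%:C * z ^+ bump 0 i =
    z * (\sum_(i < N) (mcoef eta sigma i n)%:C * z ^+ i +
      eta%:C * \sum_(i < N) (mcoef eta sigma i n.+1)%:C * z ^+ i +
      sigma%:C * \sum_(i < N) (mcoef eta sigma i n.+2)%:C * z ^+ i).
    rewrite !mulr_sumr -!big_split /= mulr_sumr; apply: eq_bigr => i _.
    by rewrite /bump /= add0n add1n !rmorphD !rmorphM exprS; ring.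
  by ring.
rewrite normrM [leRHS]exprS -mulrA ler_wpM2l //.
have nC (c : R) : `|c%:C| = `|c|%:C :> R[i] by rewrite normc_def /= expr0n /= addr0 sqrtr_sqr.
have BE : B%:C = 1 + `|eta|%:C + `|sigma|%:C :> R[i] by rewrite /B !rmorphD.
move: (IH n) (IH n.+1) (IH n.+2).
move: (_ - rho ^+ n) (_ - rho ^+ n.+1) (_ - rho ^+ n.+2) (_ ^+ N) => x0 x1 x2 y h0 h1 h2.
apply: le_trans (ler_normD _ _) _; apply: le_trans (lerD (ler_normD _ _) (lexx _)) _.
rewrite BE !normrM !nC !mulrDl mul1r.
by apply: lerD; [apply: lerD|] => //; apply: ler_wpM2l; rewrite ?ler0c.
Qed.

Definition discriminant (z : R[i]) : R[i] :=
  (1 - eta%:C * z) ^+ 2 - 4 * z ^+ 2 * sigma%:C.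

Lemma discriminant_continuous : continuous (discriminant : R[i]^o -> R[i]^o).
Proof.
pose p : {poly R[i]} := (1 - eta%:C%:P * 'X) ^+ 2 - (4 * sigma%:C)%:P * ('X * 'X).
have pE (z : R[i]) : p.[z] = discriminant z.
  by rewrite /p /discriminant expr2 !(hornerD, hornerN, hornerM, hornerC, hornerX); ring.
have -> : (discriminant : R[i]^o -> R[i]^o) = horner p by apply/funext => z.
exact: (@horner_continuous R[i]).
Qed.

Lemma meixner_series : exists (e : R) (w : R[i]^o -> R[i]^o),
  let D := [set z : R[i]^o | `|z| < e%:C] in
  [/\ 0 < e, sqrt_branch D discriminant w, w 0 = 1 &
     forall z, D z -> (fun N => \sum_(k < N) (mcoef eta sigma k 1)%:C * z ^+ k : R[i]^o) @ \oo -->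
       2 * z / (1 - eta%:C * z + w z)].
Proof.
have B1 : 1 <= B by rewrite /B -addrA lerDl addr_ge0.
have e0 : 0 < e by rewrite invr_gt0 mulr_gt0 //; lra.
have eB : e * B = 16^-1 by rewrite /e invfM mulfVK // gt_eqF //; lra.
pose D := [set z : R[i]^o | `|z| < e%:C].
have small z : D z -> exists x y, [/\ z = x +i* y, `|x| < e & `|y| < e].
  case: z => x y hz; exists x, y; split=> //.
    by rewrite -ltcR; apply: le_lt_trans hz; exact: (normc_ge_Re (x +i* y)).
  rewrite -ltcR; apply: le_lt_trans hz.
  by rewrite normc_def lecR /= -sqrtr_sqr ler_wsqrtr // lerDr sqr_ge0.
have e16 : e <= 16^-1 by rewrite -eB ler_peMr // ltW.
have etaB : `|eta| <= B by rewrite /B addrAC lerDr addr_ge0.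
have sigB : `|sigma| <= B by rewrite /B lerDr addr_ge0.
have bnd c x : `|c| <= B -> `|x| < e -> `|c * x| <= 16^-1.
  by move=> cB xe; rewrite normrM -eB mulrC; apply: ler_pM => //; exact: ltW.
have Rf z : D z -> 0 < complex.Re (discriminant z) /\ 15 / 16 <= complex.Re (1 - eta%:C * z).
  move=> /small [x [y [-> xe ye]]].
  have := bnd eta x etaB xe; have := bnd eta y etaB ye.
  have := bnd sigma x sigB xe; have := bnd sigma y sigB ye.
  move: (le_trans (ltW xe) e16) (le_trans (ltW ye) e16).
  rewrite /discriminant !ler_norml => /andP[x1 x2] /andP[y1 y2].
  move=> /andP[sy1 sy2] /andP[sx1 sx2] /andP[ey1 ey2] /andP[ex1 ex2].
  have -> : complex.Re ((1 - eta%:C * (x +i* y)) ^+ 2 - 4 * (x +i* y) ^+ 2 * sigma%:C) =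
    (1 - eta * x) ^+ 2 - (eta * y) ^+ 2 - 4 * ((sigma * x) * x - (sigma * y) * y).
    rewrite -[4]/(4%:R) -(rmorph_nat (real_complex R)) !expr2 /=; ring.
  have -> : complex.Re (1 - eta%:C * (x +i* y)) = 1 - eta * x by rewrite /=; ring.
  move: (eta * x) (eta * y) (sigma * x) (sigma * y) ex1 ex2 ey1 ey2 sx1 sx2 sy1 sy2.
  move=> p q s t *; split; last lra.
  have : q ^+ 2 <= 1 / 256 by nra.
  have : s * x <= 1 / 256 by nra.
  have : - (t * y) <= 1 / 256 by nra.
  have : (1 - p) ^+ 2 >= 225 / 256 by nra.
  by lra.
have hex (z : R[i]^o) : exists w : R[i]^o, D z -> w ^+ 2 = discriminant z /\ 0 < complex.Re w.
  case: (pselect (D z)) => [Dz|nD]; last by exists 0.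
  have [w w2 w0] := sqrt_Re_gt0_exists (or_introl (Rf z Dz).1).
  by exists w.
have [w hw] := choice hex.
have cd := discriminant_continuous.
exists e, w; split; first exact: e0.
- split; last by move=> z /hw[].
  by apply: (sqrt_continuous cd) => z /hw[].
(* The value is a square root of 1, and the positive real part excludes - 1. *)
- have D0 : D 0 by rewrite /D /= normr0 ltcR.
  have [] := hw 0 D0; rewrite /discriminant mulr0 subr0 expr1n expr0n /= mulr0 mul0r subr0.
  move=> /eqP; rewrite -subr_eq0 subr_sqr_1 mulf_eq0 => /orP[|/eqP h].
    by rewrite subr_eq0 => /eqP.
  have : complex.Re (w 0 + 1) = 0 by rewrite h.
  by rewrite ReD /= => {}h w0; exfalso; move: h w0; lra.
move=> z Dz; have [w2 w0] := hw z Dz; have [_ R1] := Rf z Dz.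
set d := 1 - eta%:C * z + w z; set rho := 2 * z / d.
have Rd : 15 / 16 <= complex.Re d by rewrite /d ReD; lra.
have dn : d != 0.
  by apply/eqP => d0; move: Rd; rewrite d0 /=; lra.
have rE : rho = z * (1 + eta%:C * rho + sigma%:C * rho ^+ 2).
  exact: (@quadratic_root _ eta%:C sigma%:C z (w z) w2 dn).
have r1 : `|rho| <= 1.
  rewrite /rho normrM normfV ler_pdivrMr ?normr_gt0 // mul1r.
  apply: le_trans (norm_Re_ge d); apply: (@le_trans _ _ (2 * e%:C)).
    by rewrite normrM (ger0_norm (ler0n _ 2)) ler_wpM2l // ltW.
  by rewrite -(rmorph_nat (real_complex R)) -rmorphM lecR /=; lra.
apply/cvgrPdist_lt => _ /gt0_complexP[eps eps0 ->].
have zB : `|z| * B%:C = (complex.Re `|z| * B)%:C by rewrite {1}normCE -rmorphM.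
have q0 : 0 <= complex.Re `|z| by rewrite -ler0c -normCE.
have q1 : `|complex.Re `|z| * B| < 1.
  rewrite ger0_norm ?mulr_ge0 //; last lra.
  have : complex.Re `|z| < e by rewrite -ltcR -normCE.
  move=> h; apply: (@lt_trans _ _ (e * B)); first by rewrite ltr_pM2r //; lra.
  by rewrite eB invf_lt1 // ltr1n.
have /cvgrPdist_lt /(_ _ eps0) := cvg_expr q1.
apply: filterS => N; rewrite sub0r normrN => hN.
rewrite distrC; apply: le_lt_trans (meixner_partial_sum r1 rE N 1) _.
rewrite zB -rmorphXn ltcR; apply: le_lt_trans hN; exact: ler_norm.
Qed.

End MeixnerSeries.

(** * Free Meixner laws *)

Lemma integrable_ext (R : realType) (mu : probability R R) (f g : R -> \bar R) :
  f =1 g -> mu.-integrable setT f -> mu.-integrable setT g.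
Proof. by move=> /funext ->. Qed.

Section PolynomialMoments.
Variables (R : realType) (A : algType R[i]) (tau : {scalar A}).

Definition real_horner_alg (X : A) (p : {poly R}) : A :=
  horner_alg X (map_poly (real_complex R) p).

Lemma real_horner_algD X p q :
  real_horner_alg X (p + q) = real_horner_alg X p + real_horner_alg X q.
Proof. by rewrite /real_horner_alg !rmorphD. Qed.

Lemma real_horner_algM X p q :
  real_horner_alg X (p * q) = real_horner_alg X p * real_horner_alg X q.
Proof. by rewrite /real_horner_alg !rmorphM. Qed.

Lemma real_horner_algZ X c p : real_horner_alg X (c *: p) = c%:C *: real_horner_alg X p.
Proof.
by rewrite /real_horner_alg map_polyZ -mul_polyC rmorphM /= horner_algC mulr_algl.
Qed.

Lemma real_horner_algX X : real_horner_alg X 'X = X.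
Proof. by rewrite /real_horner_alg map_polyX horner_algX. Qed.

Lemma real_horner_algXn X n : real_horner_alg X 'X^n = X ^+ n.
Proof. by rewrite /real_horner_alg map_polyXn rmorphXn /= horner_algX. Qed.

Lemma law_horner X mu : has_law tau X mu -> forall p : {poly R},
  mu.-integrable setT (fun x => p.[x]%:E) /\
  tau (real_horner_alg X p) = (\int[mu]_x p.[x])%:C.
Proof.
move=> hX p.
pose Q (p : {poly R}) := mu.-integrable setT (fun x => p.[x]%:E) /\
  tau (real_horner_alg X p) = (\int[mu]_x p.[x])%:C.
have QZ c q : Q q -> Q (c *: q).
  move=> [iq tq]; split.
    apply: (integrable_ext _ (integrableZl measurableT c iq)) => x.
    by rewrite /= hornerZ EFinM.
  rewrite real_horner_algZ (scalarZ tau) tq -rmorphM /= -RintegralZl //.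
  by congr (_ %:C); apply: eq_Rintegral => x _; rewrite hornerZ.
have QD q r : Q q -> Q r -> Q (q + r).
  move=> [iq tq] [ir tr]; split.
    apply: (integrable_ext _ (integrableD measurableT iq ir)) => x.
    by rewrite /= hornerD EFinD.
  rewrite real_horner_algD linearD /= tq tr -rmorphD /= -RintegralD //.
  by congr (_ %:C); apply: eq_Rintegral => x _; rewrite hornerD.
have QX n : Q 'X^n.
  have [iX tX] := hX n; split.
    by apply: (integrable_ext _ iX) => x; rewrite hornerXn.
  rewrite real_horner_algXn tX; congr (_ %:C).
  by apply: eq_Rintegral => x _; rewrite hornerXn.
rewrite -/(Q p) -(coefK p) poly_def; apply: big_ind => //.
- by rewrite -(scale0r ('X^0 : {poly R})); apply: QZ.
- by move=> i _; apply: QZ.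
Qed.

Lemma has_law_scale X mu (c : R) : has_law tau X mu ->
  exists nu : probability R R, has_law tau (c%:C *: X) nu /\
    forall B : set R, measurable B -> nu B = mu ((fun x => c * x) @^-1` B).
Proof.
move=> hX.
have mf : measurable_fun setT (fun x : R => c * x) by apply: mulrl_measurable.
pose f : {mfun R >-> R} := HB.pack (fun x : R => c * x) (isMeasurableFun.Build _ _ _ _ _ mf).
have iXn n : mu.-integrable setT ((fun y => (y ^+ n)%:E) \o f).
  apply: (integrable_ext _ (integrableZl measurableT (c ^+ n) (hX n).1)) => x.
  by rewrite /= exprMn EFinM.
have mXn n : measurable_fun setT (fun y : R => (y ^+ n)%:E).
  by apply/measurable_EFinP; exact: exprn_measurable.
exists (distribution mu f); split=> // n; split.
  by apply: integrable_pushforward => //; exact: iXn.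
rewrite exprZn (scalarZ tau) (hX n).2 -rmorphXn -rmorphM /=; congr (_ %:C).
rewrite /Rintegral integral_distribution // -(RintegralZl _ measurableT (hX n).1).
by congr fine; apply: eq_integral => x _; rewrite /= exprMn.
Qed.

End PolynomialMoments.

Section MeixnerPolynomials.
Variables (R : realType) (a b : R).

(** Jacobi parameters of the free Meixner law: mean 0 and variance 1 fix the first ones, after which
    they are constant. The weight 0 at index 0 removes the term that would carry the index - 1. *)
Definition jacobi_shift n : R := if n is 0%N then 0 else a.

Definition jacobi_weight n : R := if n is m.+1 then (if m is 0%N then 1 else 1 + b) else 0.

Fixpoint meixner_poly n : {poly R} :=
  if n is m.+1 then ('X - (jacobi_shift m)%:P) * meixner_poly m -
    (if m is l.+1 then jacobi_weight m *: meixner_poly l else 0)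
  else 1.

Lemma mulX_meixner_poly n : 'X * meixner_poly n =
  meixner_poly n.+1 + jacobi_shift n *: meixner_poly n +
    jacobi_weight n *: meixner_poly n.-1.
Proof.
by case: n => [|n]; rewrite /= -?mul_polyC ?scale0r; ring.
Qed.

#[local] Arguments meixner_poly : simpl never.

Lemma meixner_poly1 : meixner_poly 1 = 'X.
Proof. by rewrite /meixner_poly /= subr0 mulr1 subr0. Qed.

Definition meixner_norm n : R := \prod_(i < n) jacobi_weight i.+1.

Lemma meixner_normS n : meixner_norm n.+1 = meixner_norm n * jacobi_weight n.+1.
Proof. by rewrite /meixner_norm big_ord_recr. Qed.

(** Multiplication by X is symmetric under (p, q) -> L (p q), so the recurrence can be moved from
    one factor to the other; it reaches two indices back, hence the paired induction. *)
Lemma meixner_poly_orthogonal (L : {scalar {poly R}}) :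
  (forall n, L (meixner_poly n) = (n == 0%N)%:R) ->
  forall m n, L (meixner_poly n * meixner_poly m) = (n == m)%:R * meixner_norm m.
Proof.
move=> L0 m.
have LZ c p : L (c *: p) = c * L p by rewrite linearZ.
suff [] : (forall n, L (meixner_poly n * meixner_poly m) = (n == m)%:R * meixner_norm m) /\
  (forall n, L (meixner_poly n * meixner_poly m.+1) = (n == m.+1)%:R * meixner_norm m.+1) by [].
have step m' : (forall n, L (meixner_poly n * meixner_poly m') = (n == m')%:R * meixner_norm m') ->
  forall n, L (meixner_poly n * meixner_poly m'.+1) =
    (n.+1 == m')%:R * meixner_norm m' +
    (jacobi_shift n - jacobi_shift m') * ((n == m')%:R * meixner_norm m') +
    jacobi_weight n * ((n.-1 == m')%:R * meixner_norm m') -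
    jacobi_weight m' * L (meixner_poly n * meixner_poly m'.-1).
  move=> IH n.
  have -> : meixner_poly n * meixner_poly m'.+1 = ('X * meixner_poly n) * meixner_poly m' -
      jacobi_shift m' *: (meixner_poly n * meixner_poly m') -
      jacobi_weight m' *: (meixner_poly n * meixner_poly m'.-1).
    have -> : meixner_poly m'.+1 = 'X * meixner_poly m' - jacobi_shift m' *: meixner_poly m' -
      jacobi_weight m' *: meixner_poly m'.-1 by rewrite mulX_meixner_poly -!mul_polyC; ring.
    by rewrite -!mul_polyC; ring.
  have -> : 'X * meixner_poly n * meixner_poly m' = meixner_poly n.+1 * meixner_poly m' +
      jacobi_shift n *: (meixner_poly n * meixner_poly m') +
      jacobi_weight n *: (meixner_poly n.-1 * meixner_poly m').
    by rewrite mulX_meixner_poly -!mul_polyC; ring.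
  rewrite !(linearB, linearD) !LZ !IH.
  by ring.
elim: m => [|m [IH1 IH2]].
  have h n : L (meixner_poly n * meixner_poly 0) = (n == 0%N)%:R * meixner_norm 0.
    by rewrite mulr1 L0 /meixner_norm big_ord0 mulr1.
  split=> // n; rewrite step // meixner_normS /meixner_norm big_ord0 /=.
  by case: n => [|[|n]] /=; ring.
split=> // n; rewrite step // IH1 !meixner_normS /=.
case: n => [|n] /=; first by ring.
rewrite !eqSS.
have e1 : (m.+1 == m) = false by rewrite gtn_eqF.
have e2 : (m == m.+1) = false by rewrite ltn_eqF.
have e3 : (m.+2 == m) = false by rewrite gtn_eqF // ltnW.
have [->|nm] := eqVneq n m; first by rewrite e1 e2 /=; ring.
have [->|nm'] := eqVneq n m.+1; first by rewrite e3 /=; ring.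
have [mE|nm''] := eqVneq n.+1 m; last by rewrite /=; ring.
by rewrite -mE /=; ring.
Qed.

Section Appell.
Variables (A : algType R[i]) (tau : {scalar A}) (X : A) (T : nat -> A).
Hypothesis hT : appell_centered tau X (fun k => (mcoef a b k 1)%:C) T.

(** X acts on T_k by the Appell recurrence, whose cumulant sum [mcoef_mul] folds into the
    coefficient of rho^(n+1). The equation of rho then cancels the shift and the lower term of the
    recurrence of P_n, leaving the weight 1 + b. *)
Lemma tau_meixner_appell n k :
  tau (real_horner_alg X (meixner_poly n) * T k) = (meixner_norm n * mcoef a b k n)%:C.
Proof.
have [[T0 TS] tT] := hT.
pose f n k := tau (real_horner_alg X (meixner_poly n) * T k).
suff [] : (forall k, f n k = (meixner_norm n * mcoef a b k n)%:C) /\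
  (forall k, f n.+1 k = (meixner_norm n.+1 * mcoef a b k n.+1)%:C) by move=> h _; exact: h.
have step m : (forall k, f m k = (meixner_norm m * mcoef a b k m)%:C) -> forall k, f m.+1 k =
   (meixner_norm m * (mcoef a b k.+1 m + mcoef a b k m.+1) -
     jacobi_shift m * (meixner_norm m * mcoef a b k m))%:C -
    (jacobi_weight m)%:C * f m.-1 k.
  move=> IH {}k.
  have -> : f m.+1 k = tau (real_horner_alg X (meixner_poly m * 'X) * T k) -
     (jacobi_shift m)%:C * f m k - (jacobi_weight m)%:C * f m.-1 k.
    rewrite [meixner_poly m * 'X]mulrC mulX_meixner_poly real_horner_algD.
    rewrite [real_horner_alg X (meixner_poly m.+1 + _)]real_horner_algD !real_horner_algZ.
    rewrite !mulrDl -!scalerAl !linearD /= !(scalarZ tau) /f.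
    by rewrite addrAC addrK addrK.
  congr (_ - _); rewrite real_horner_algM real_horner_algX -mulrA TS mulrDr linearD /=.
  rewrite -/(f m k.+1) mulr_sumr linear_sum /=.
  have -> : \sum_(i < k.+1) tau (real_horner_alg X (meixner_poly m) * ((mcoef a b i 1)%:C *: T (k - i)%N)) =
    (meixner_norm m * mcoef a b k m.+1)%:C.
    rewrite -(mcoef_mul a b k m) mulr_sumr rmorph_sum; apply: eq_bigr => i _ /=.
    rewrite -scalerAr (scalarZ tau) -/(f m (k - i)%N) IH -rmorphM /=; congr (_%:C).
    by ring.
  rewrite !IH !rmorphB !rmorphM !rmorphD /=; ring.
elim: n {k} => [|n [IH1 IH2]].
  have h k : f 0%N k = (meixner_norm 0 * mcoef a b k 0)%:C.
    rewrite /f /meixner_norm big_ord0 mul1r mcoefk0 /real_horner_alg !rmorph1 mul1r tT.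
    by rewrite rmorph_nat.
  split=> // k; rewrite step //; rewrite meixner_normS /meixner_norm big_ord0 /=.
  by rewrite !mul0r !mul1r add0r !subr0.
split=> // k; rewrite step // IH1 !meixner_normS -rmorphM -rmorphB /=; congr (_%:C).
by case: n {IH1 IH2} => [|n] /=; ring.
Qed.

Lemma tau_meixner_poly n : tau (real_horner_alg X (meixner_poly n)) = (n == 0%N)%:R.
Proof.
have := tau_meixner_appell n 0; rewrite hT.1.1 mulr1 => ->; rewrite mcoef0n.
by case: n => [|n]; rewrite ?mulr0 // /meixner_norm big_ord0 mulr1.
Qed.

End Appell.
End MeixnerPolynomials.

(** * Cauchy transforms weighted by polynomials *)

Section PolynomialCauchyTransform.
Variables (R : realType) (nu : probability R R).
Hypothesis nu_poly : forall p : {poly R}, nu.-integrable setT (fun x => p.[x]%:E).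

Definition poly_mean (p : {poly R}) : R := \int[nu]_x p.[x].

Lemma poly_mean_linear : scalar poly_mean.
Proof.
move=> c p q; rewrite /poly_mean -(RintegralZl _ measurableT (nu_poly p)) -RintegralD //.
- by apply: eq_Rintegral => x _; rewrite hornerD hornerZ.
- by apply: (integrable_ext _ (nu_poly (c *: p))) => x; rewrite hornerZ.
- exact: nu_poly.
Qed.

Definition poly_mean_scalar : {scalar {poly R}} :=
  HB.pack poly_mean (GRing.isLinear.Build _ _ _ _ poly_mean poly_mean_linear).

Lemma poly_meanD p q : poly_mean (p + q) = poly_mean p + poly_mean q.
Proof. exact: (linearD poly_mean_scalar). Qed.

Lemma poly_meanZ c p : poly_mean (c *: p) = c * poly_mean p.
Proof. exact: (scalarZ poly_mean_scalar). Qed.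

Lemma poly_mean1 : poly_mean 1 = 1.
Proof.
rewrite /poly_mean; under eq_Rintegral do rewrite hornerC.
by rewrite Rintegral_cst // mul1r -[RHS]/(fine 1%E) -(probability_setT nu).
Qed.

Section BoundedWeight.
Variables (h : R -> R) (M : R).
Hypothesis mh : measurable_fun setT h.
Hypothesis hM : forall y, `|h y| <= M.

Lemma weighted_poly_integrable (p : {poly R}) :
  nu.-integrable setT (fun y => (p.[y] * h y)%:E).
Proof.
have bh : [bounded h x | x in setT].
  exists M; split; first exact: num_real.
  by move=> m Mm x _; apply: le_trans (hM x) (ltW Mm).
apply: (integrable_ext _ (integrableMl measurableT (nu_poly p) mh bh)) => y.
by rewrite /= EFinM.
Qed.

Definition weighted_mean (p : {poly R}) : R := \int[nu]_y (p.[y] * h y).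

Lemma weighted_mean_linear : scalar weighted_mean.
Proof.
move=> c p q; rewrite /weighted_mean -(RintegralZl _ measurableT (weighted_poly_integrable p)) -RintegralD //.
- by apply: eq_Rintegral => x _; rewrite hornerD hornerZ mulrDl mulrA.
- by apply: (integrable_ext _ (weighted_poly_integrable (c *: p))) => x; rewrite hornerZ -mulrA.
- exact: weighted_poly_integrable.
Qed.

(** Pointwise |p h| <= M |p| <= (M / 2) (s + p^2 / s). The free scale [s] lets this replace the
    Cauchy-Schwarz inequality. *)
Lemma weighted_mean_le (p : {poly R}) (s : R) : 0 < s ->
  `|weighted_mean p| <= M / 2 * (s + poly_mean (p * p) / s).
Proof.
move=> s0; have M0 : 0 <= M by apply: le_trans (hM 0).
pose q : {poly R} := (M / 2 / s) *: (p * p) + (M / 2 * s) *: 1.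
have -> : M / 2 * (s + poly_mean (p * p) / s) = poly_mean q.
  by rewrite /q poly_meanD !poly_meanZ poly_mean1; field; rewrite gt_eqF.
apply: le_trans (le_normr_Rintegral measurableT (weighted_poly_integrable p)) _.
apply: le_Rintegral => //.
  have := integrable_norm (weighted_poly_integrable p).
  by apply: integrable_ext => y.
  exact: nu_poly.
move=> y _; rewrite /q alg_polyC hornerD hornerZ hornerM hornerC normrM.
apply: (@le_trans _ _ (`|p.[y]| * M)); first by apply: ler_wpM2l.
have h2 : 0 <= M / 2 / s * (`|p.[y]| - s) ^+ 2 by rewrite mulr_ge0 ?sqr_ge0 // !divr_ge0 // ltW.
rewrite -subr_ge0; apply: le_trans h2 _; rewrite le_eqVlt; apply/orP; left; apply/eqP.
rewrite -[p.[y] * p.[y]]expr2 -(real_normK (num_real p.[y])).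
by field; rewrite gt_eqF.
Qed.

End BoundedWeight.

Section Kernel.
Variable z : R[i].
Hypothesis z0 : 0 < complex.Im z.

Let k (y : R) : R[i] := (z - y%:C)^-1.
Let x0 := complex.Re z.
Let y0 := complex.Im z.

Lemma cauchy_kernelE y : k y = ((x0 - y) / ((x0 - y) ^+ 2 + y0 ^+ 2)) +i*
  (- y0 / ((x0 - y) ^+ 2 + y0 ^+ 2)).
Proof.
rewrite /k /x0 /y0; case: z => u v; rewrite -[LHS]/(invc ((u +i* v) - y%:C)) /=.
by rewrite subr0 mulNr.
Qed.

Let d (y : R) := (x0 - y) ^+ 2 + y0 ^+ 2.

Let d_gt0 y : 0 < d y.
Proof. by rewrite /d ltr_wpDl ?sqr_ge0 // exprn_gt0. Qed.

Let d_inv_measurable : measurable_fun setT (fun y => (d y)^-1).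
Proof.
apply: continuous_measurable_fun => y; apply: cvgV; first by rewrite gt_eqF.
have -> : d = horner ((x0%:P - 'X) ^+ 2 + (y0 ^+ 2)%:P).
  by apply/funext => t; rewrite /d !hornerE.
exact: continuous_horner.
Qed.

Lemma Re_cauchy_kernel_measurable : measurable_fun setT (fun y => complex.Re (k y)).
Proof.
have -> : (fun y => complex.Re (k y)) = (horner (x0%:P - 'X)) \* (fun y => (d y)^-1).
  by apply/funext => y; rewrite cauchy_kernelE /= !hornerE.
by apply: measurable_funM; [exact: measurable_poly | exact: d_inv_measurable].
Qed.

Lemma Im_cauchy_kernel_measurable : measurable_fun setT (fun y => complex.Im (k y)).
Proof.
have -> : (fun y => complex.Im (k y)) = (horner (- y0)%:P) \* (fun y => (d y)^-1).
  by apply/funext => y; rewrite cauchy_kernelE /= !hornerE.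
by apply: measurable_funM; [exact: measurable_poly | exact: d_inv_measurable].
Qed.

Lemma Re_cauchy_kernel_le y : `|complex.Re (k y)| <= y0^-1.
Proof.
rewrite cauchy_kernelE /= normrM normfV (gtr0_norm (d_gt0 y)).
rewrite ler_pdivrMr // mulrC ler_pdivlMr // /d -(real_normK (num_real (x0 - y))).
have := sqr_ge0 (`|x0 - y| - y0); have := sqr_ge0 (`|x0 - y|); have := sqr_ge0 y0.
by rewrite sqrrB -/y0; lra.
Qed.

Lemma Im_cauchy_kernel_le y : `|complex.Im (k y)| <= y0^-1.
Proof.
rewrite cauchy_kernelE /= normrM normfV (gtr0_norm (d_gt0 y)) normrN (gtr0_norm z0).
rewrite ler_pdivrMr // mulrC ler_pdivlMr // /d -expr2 -/y0.
by rewrite lerDr sqr_ge0.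
Qed.

Definition poly_cauchy (p : {poly R}) : R[i] :=
  weighted_mean (fun y => complex.Re (k y)) p +i* weighted_mean (fun y => complex.Im (k y)) p.

Let LRe := weighted_mean_linear Re_cauchy_kernel_measurable Re_cauchy_kernel_le.
Let LIm := weighted_mean_linear Im_cauchy_kernel_measurable Im_cauchy_kernel_le.

Lemma poly_cauchy_linear (c : R) p q :
  poly_cauchy (c *: p + q) = c%:C * poly_cauchy p + poly_cauchy q.
Proof. by rewrite /poly_cauchy LRe LIm /=; congr (_ +i* _) => /=; rewrite !mul0r ?subr0 ?addr0. Qed.

Lemma poly_cauchy1 : poly_cauchy 1 = cauchy_stieltjes nu z.
Proof.
rewrite /poly_cauchy /cauchy_stieltjes /weighted_mean; congr (_ +i* _);
  by apply: eq_Rintegral => y _; rewrite hornerC mul1r.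
Qed.

(** Integrates p against y / (z - y) = z / (z - y) - 1, in real and imaginary parts. *)
Lemma poly_cauchy_mulX p : poly_cauchy ('X * p) = z * poly_cauchy p - (poly_mean p)%:C.
Proof.
have iRe q := weighted_poly_integrable Re_cauchy_kernel_measurable Re_cauchy_kernel_le q.
have iIm q := weighted_poly_integrable Im_cauchy_kernel_measurable Im_cauchy_kernel_le q.
have dn y : d y != 0 by rewrite gt_eqF.
have hRe : weighted_mean (fun y => complex.Re (k y)) ((-1) *: ('X * p) + (x0 *: p + 0)) =
    weighted_mean (fun y => complex.Im (k y)) (y0 *: p + 0) + poly_mean p.
  rewrite !addr0 /weighted_mean /poly_mean -RintegralD //.
  - apply: eq_Rintegral => y _; rewrite !cauchy_kernelE /=.
    rewrite hornerD !hornerZ hornerM hornerX; field; exact: dn.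
  - exact: (iIm (y0 *: p)).
  - exact: nu_poly.
have hIm : weighted_mean (fun y => complex.Im (k y)) ((-1) *: ('X * p) + (x0 *: p + 0)) =
    weighted_mean (fun y => complex.Re (k y)) ((- y0) *: p + 0).
  rewrite !addr0; apply: eq_Rintegral => y _; rewrite !cauchy_kernelE /=.
  rewrite hornerD !hornerZ hornerM hornerX; field; exact: dn.
move: hRe hIm; rewrite !LRe !LIm /=.
have -> : weighted_mean (fun y => complex.Re (k y)) 0 = 0.
  by have := LRe (-1) 0 0; rewrite scaler0 addr0 => ->; rewrite mulN1r addNr.
have -> : weighted_mean (fun y => complex.Im (k y)) 0 = 0.
  by have := LIm (-1) 0 0; rewrite scaler0 addr0 => ->; rewrite mulN1r addNr.
have zE : z = x0 +i* y0 by rewrite /x0 /y0; case: z.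
rewrite /poly_cauchy [in z * _]zE; move: (poly_mean p) (weighted_mean _ p) (weighted_mean _ p).
move: (weighted_mean _ ('X * p)) (weighted_mean _ ('X * p)) => A B m P Q h1 h2.
by congr (_ +i* _); rewrite /=; lra.
Qed.

End Kernel.
End PolynomialCauchyTransform.

(** * The square root on the upper half-plane *)

Section UpperHalfPlane.
Variable R : realType.
Implicit Types z w : R[i].

Lemma normC_le_sqr z w : complex.Re z ^+ 2 + complex.Im z ^+ 2 <= complex.Re w ^+ 2 + complex.Im w ^+ 2 ->
  `|z| <= `|w|.
Proof. by move=> h; rewrite !normc_def lecR ler_wsqrtr. Qed.

Lemma normC_lt_sqr z w : complex.Re z ^+ 2 + complex.Im z ^+ 2 < complex.Re w ^+ 2 + complex.Im w ^+ 2 ->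
  `|z| < `|w|.
Proof.
move=> h; rewrite !normc_def ltcR ltr_sqrt //.
by apply: le_lt_trans h; rewrite addr_ge0 ?sqr_ge0.
Qed.

Lemma normC_le_ReIm z : `|z| <= (`|complex.Re z| + `|complex.Im z|)%:C.
Proof.
rewrite normc_def lecR -(ger0_norm (addr_ge0 (normr_ge0 (complex.Re z)) (normr_ge0 (complex.Im z)))).
rewrite -sqrtr_sqr ler_wsqrtr // sqrrD !real_normK ?num_real //.
by rewrite -addrA [X in _ <= _ + X]addrC addrA lerDl mulrn_wge0 // mulr_ge0.
Qed.

(** A real constant does not change the imaginary part of the square, so Re w Im w = Re z Im z with
    both imaginary parts positive. *)
Lemma upper_sqrt_Re z w (c : R) : 0 < complex.Im z -> 0 < complex.Im w ->
  w ^+ 2 = z ^+ 2 - c%:C -> 0 <= complex.Re z * complex.Re w.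
Proof.
case: z w => x y [p q] /= y0 q0 /(congr1 (@complex.Im R)).
rewrite !expr2 /= => e.
have h : p * q = x * y by lra.
rewrite -(pmulr_lge0 (x * p) (mulr_gt0 y0 q0)).
have -> : x * p * (y * q) = (x * y) ^+ 2 by rewrite expr2 -{2}h; ring.
exact: sqr_ge0.
Qed.

(** Re z Re w + Im z Im w > 0; this tells the two characteristic roots apart by modulus. *)
Lemma upper_sqrt_norm_lt z w (c : R) : 0 < complex.Im z -> 0 < complex.Im w ->
  w ^+ 2 = z ^+ 2 - c%:C -> `|z - w| < `|z + w|.
Proof.
move=> z0 w0 h; apply: normC_lt_sqr; have := upper_sqrt_Re z0 w0 h.
have := mulr_gt0 z0 w0; case: z w {z0 w0 h} => x y [p q] /= h1 h2.
by rewrite !expr2; nra.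
Qed.

Lemma upper_sqrt_norm_le z w (c : R) : 0 < complex.Im z -> 0 < complex.Im w ->
  w ^+ 2 = z ^+ 2 - c%:C -> `|z| <= `|z + w|.
Proof.
move=> z0 w0 h; apply: normC_le_sqr; have := upper_sqrt_Re z0 w0 h.
have := mulr_gt0 z0 w0; case: z w {z0 w0 h} => x y [p q] /= h1 h2.
by rewrite !expr2; nra.
Qed.

(** With u = z - a one has |w - u| |w + u| = c and |w + u| >= |u| >= 1, so |w - z| <= c + |a|; the
    bound on |z| ensures |u| >= 1 and makes the quotient smaller than e. *)
Lemma upper_sqrt_asymptotic (a c e : R) z w : 0 <= c -> 0 < e ->
  0 < complex.Im z -> 0 < complex.Im w -> w ^+ 2 = (z - a%:C) ^+ 2 - c%:C ->
  (1 + `|a| + (c + `|a|) / e)%:C < `|z| -> `|w / z - 1| < e%:C.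
Proof.
move=> c0 e0 z0 w0 w2 zM; pose u := z - a%:C.
have u0 : 0 < complex.Im u by rewrite /u; move: z0; case: (z) => x y /= y0; rewrite subr0.
have nC (r : R) : `|r%:C| = `|r|%:C :> R[i] by rewrite normc_def /= expr0n /= addr0 sqrtr_sqr.
have hy := upper_sqrt_norm_le u0 w0 w2.
have hxy : `|w - u| * `|u + w| = c%:C.
  have -> : c%:C = `|- c%:C| by rewrite normrN nC ger0_norm.
  rewrite -normrM; congr `|_|.
  have -> : (w - u) * (u + w) = w ^+ 2 - u ^+ 2 by ring.
  by rewrite w2 addrAC subrr add0r.
have hz : `|z| <= `|u| + `|a|%:C by rewrite -nC -{1}(subrK a%:C z) ler_normD.
have hwz : `|w - z| <= `|w - u| + `|a|%:C.
  have -> : w - z = (w - u) - a%:C by rewrite /u opprB addrA addrAC addrK.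
  by rewrite -nC; exact: ler_normB.
have zn : z != 0 by apply: contraTneq z0 => ->; rewrite /= ltxx.
have -> : w / z - 1 = (w - z) / z by rewrite mulrBl divff.
rewrite normrM normfV ltr_pdivrMr ?normr_gt0 //.
have := normr_ge0 (w - u); move: hy hxy hz hwz zM.
rewrite [`|w - u|]normCE [`|u + w|]normCE [`|z|]normCE [`|w - z|]normCE [`|u|]normCE.
move: (complex.Re `|w - u|) (complex.Re `|u + w|) (complex.Re `|u|) => x y t.
move: (complex.Re `|z|) (complex.Re `|w - z|) => n v.
rewrite -!rmorphM -!rmorphD !lecR !ltcR => ty /(congr1 (@complex.Re R)) /= xy nt vx nM x0.
have ce : 0 <= (c + `|a|) / e by rewrite divr_ge0 ?addr_ge0 // ltW.
have y1 : 1 <= y by lra.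
have xc : x <= c by rewrite -xy ler_peMr.
apply: (@le_lt_trans _ _ (c + `|a|)); first by lra.
by rewrite mulrC -ltr_pdivrMr //; have := normr_ge0 a; lra.
Qed.

(** The root is i times the root of c - (z - a)^2 with positive real part; for c >= 0 this function
    avoids the closed negative axis on the upper half-plane. *)
Lemma upper_sqrt_exists (a c : R) : 0 <= c -> exists w : R[i]^o -> R[i]^o,
  sqrt_branch (@upper_half_plane R) (fun z => (z - a%:C) ^+ 2 - c%:C) w /\
  forall z, upper_half_plane z -> 0 < complex.Im (w z).
Proof.
move=> c0; pose f (z : R[i]) : R[i] := c%:C - (z - a%:C) ^+ 2.
have hf z : upper_half_plane z -> 0 < complex.Re (f z) \/ complex.Im (f z) <> 0.
  case: z => x y; rewrite /upper_half_plane /= => y0.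
  have [->|xa] := eqVneq x a; [left|right].
    by rewrite subrr mul0r subr0 sub0r opprK ltr_wpDl // mulr_gt0.
  have -> : 0 - ((x - a) * (y - 0) + (y - 0) * (x - a)) = - (2 * (x - a) * y) by ring.
  by apply/eqP; rewrite oppr_eq0 !mulf_neq0 ?subr_eq0 // gt_eqF.
have hex (z : R[i]^o) : exists w : R[i]^o, upper_half_plane z -> w ^+ 2 = f z /\ 0 < complex.Re w.
  case: (pselect (upper_half_plane z)) => [Dz|nD]; last by exists 0.
  have [w w2 w0] := sqrt_Re_gt0_exists (hf z Dz).
  by exists w.
have [v hv] := choice hex.
have cf : continuous (f : R[i]^o -> R[i]^o).
  pose p : {poly R[i]} := c%:C%:P - ('X - a%:C%:P) ^+ 2.
  have -> : (f : R[i]^o -> R[i]^o) = horner p.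
    by apply/funext => z; rewrite /p expr2 !(hornerD, hornerN, hornerM, hornerC, hornerX) -expr2.
  exact: (@horner_continuous R[i]).
have cv : {within (@upper_half_plane R), continuous v}.
  by apply: (sqrt_continuous cf) => z /hv[].
exists (fun z => 'i%C * v z); split; [split|].
- move=> z; apply: cvgM; [exact: cvg_cst | exact: cv].
- move=> z /hv[v2 _]; rewrite exprMn; have -> : 'i%C ^+ 2 = -1 :> R[i] by exact: sqr_i.
  by rewrite mulN1r v2 opprB.
- by move=> z /hv[_]; case: (v z) => x y /=; rewrite mul0r mul1r add0r.
Qed.

Lemma geometric_le_eq0 (x C q : R) : 0 <= x -> 0 <= q < 1 ->
  (forall n, x <= C * q ^+ n) -> x = 0.
Proof.
rewrite le_eqVlt => /predU1P[->|x0] // /andP[q0 q1] h.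
have C0 : 0 < C by apply: lt_le_trans x0 _; have := h 0%N; rewrite expr0 mulr1.
have q1' : `|q| < 1 by rewrite ger0_norm.
have /cvgrPdist_lt /(_ _ (divr_gt0 x0 C0)) [N _ hN] := cvg_expr q1'.
have := hN N (leqnn N); rewrite sub0r normrN ger0_norm ?exprn_ge0 //.
by rewrite ltr_pdivlMr // mulrC ltNge h.
Qed.

End UpperHalfPlane.

(** Put l = (z - a + w) / 2 and l' = (z - a - w) / 2. The second hypothesis reads G (z l - 1) = l,
    and (z l - 1)(z l' - 1) = b z^2 + a z + 1, so multiplying by z l' - 1 gives the quotient. *)
Lemma quadratic_resolvent (F : numFieldType) (a b z w G : F) :
  w ^+ 2 = (z - a) ^+ 2 - 4 * (1 + b) ->
  (z - a + w) / 2 * (z * G - 1) = G -> b * z ^+ 2 + a * z + 1 != 0 ->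
  G = ((1 + 2 * b) * z + a - w) / (2 * (b * z ^+ 2 + a * z + 1)).
Proof.
move=> w2 key d0; set d := b * z ^+ 2 + a * z + 1 in d0 *.
pose lp := (z - a + w) / 2; pose lm := (z - a - w) / 2.
have prod : lp * lm = 1 + b.
  have -> : lp * lm = ((z - a) ^+ 2 - w ^+ 2) / 4 by rewrite /lp /lm; field.
  by rewrite w2; field.
have sum : lp + lm = z - a by rewrite /lp /lm; field.
have dE : d = (z * lp - 1) * (z * lm - 1).
  have -> : (z * lp - 1) * (z * lm - 1) = lp * lm * z ^+ 2 - z * (lp + lm) + 1 by ring.
  by rewrite prod sum /d; ring.
have {}key : G * (z * lp - 1) = lp.
  by rewrite -[RHS]addr0 -(subrr G) -{2}key -/lp; ring.
have h : G * (2 * d) = (1 + 2 * b) * z + a - w.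
  have -> : G * (2 * d) = 2 * (G * (z * lp - 1)) * (z * lm - 1) by rewrite dE; ring.
  rewrite key.
  have -> : 2 * lp * (z * lm - 1) = 2 * z * (lp * lm) - 2 * lp by ring.
  by rewrite prod /lp; field.
by rewrite -h mulfK // mulf_neq0 // pnatr_eq0.
Qed.

Section FreeMeixnerLaw.
Variables (R : realType) (A : algType R[i]) (tau : {scalar A}) (a b : R) (X : A).
Variables (nu : probability R R) (T : nat -> A).
Hypothesis hX : has_law tau X nu.
Hypothesis hT : appell_centered tau X (fun k => (mcoef a b k 1)%:C) T.

Let nu_poly p := (law_horner hX p).1.
Local Notation P := (meixner_poly a b).

Lemma poly_mean_meixner n : poly_mean nu (P n) = (n == 0%N)%:R.
Proof.
have := (law_horner hX (P n)).2; rewrite (tau_meixner_poly hT) => /(congr1 (@complex.Re R)) h.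
by apply: etrans (esym h) _; case: (n == 0%N).
Qed.

Lemma poly_mean_meixner_mul n m :
  poly_mean nu (P n * P m) = (n == m)%:R * meixner_norm b m.
Proof.
apply: (meixner_poly_orthogonal (L := poly_mean_scalar nu_poly)) => k.
exact: poly_mean_meixner.
Qed.

Lemma meixner_weight_ge0 : 0 <= 1 + b.
Proof.
have : 0 <= poly_mean nu (P 2 * P 2).
  by apply: Rintegral_ge0 => x _; rewrite hornerM -expr2 sqr_ge0.
by rewrite poly_mean_meixner_mul eqxx /meixner_norm !big_ord_recr big_ord0 /= !mul1r.
Qed.

Lemma meixner_norm_le (q : R) n : 0 <= q -> 1 + b <= q ^+ 2 -> meixner_norm b n.+1 <= q ^+ (2 * n).
Proof.
move=> q0 bq; elim: n => [|n IH]; first by rewrite /meixner_norm big_ord_recr big_ord0 /= mulr1 muln0 expr0.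
rewrite meixner_normS mulnS exprD mulrC; apply: ler_pM => //; first exact: meixner_weight_ge0.
by rewrite /meixner_norm prodr_ge0 // => i _; case: (val i) => [|k] //=; exact: meixner_weight_ge0.
Qed.

Section Transform.
Variables (z w : R[i]).
Hypothesis z0 : 0 < complex.Im z.
Hypothesis w0 : 0 < complex.Im w.
Hypothesis wE : w ^+ 2 = (z - a%:C) ^+ 2 - (4 * (1 + b))%:C.

Let r n := poly_cauchy nu z (P n).

Lemma meixner_cauchy_rec n : r n.+2 =
  (z - a%:C) * r n.+1 - (jacobi_weight b n.+1)%:C * r n.
Proof.
have := poly_cauchy_mulX nu_poly z0 (P n.+1).
rewrite mulX_meixner_poly poly_mean_meixner subr0 -addrA addrC.
rewrite -addrA (poly_cauchy_linear nu_poly z0 _ (P n.+1)).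
rewrite (poly_cauchy_linear nu_poly z0 _ (P n)) -/(r _) -/(r _) -/(r _) /= => h.
by rewrite mulrBl -h; ring.
Qed.

(** The scale in [weighted_mean_le] is q^n, which balances its two terms because the squared norm of
    P_(n+1) is at most q^(2n). *)
Lemma meixner_cauchy_le (q : R) n : 0 < q -> 1 + b <= q ^+ 2 ->
  `|r n.+1| <= ((complex.Im z)^-1 * (1 + 1) * q ^+ n)%:C.
Proof.
move=> q0 bq; apply: le_trans (normC_le_ReIm _) _; rewrite lecR.
have qn : 0 < q ^+ n by rewrite exprn_gt0.
have h : poly_mean nu (P n.+1 * P n.+1) / q ^+ n <= q ^+ n.
  rewrite poly_mean_meixner_mul eqxx mul1r ler_pdivrMr // -exprD addnn -mul2n.
  by apply: meixner_norm_le => //; exact: ltW.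
have M0 : 0 <= (complex.Im z)^-1 / 2 by rewrite divr_ge0 // invr_ge0 ltW.
have hRe := weighted_mean_le nu_poly (Re_cauchy_kernel_measurable z0) (Re_cauchy_kernel_le z0) (P n.+1) qn.
have hIm := weighted_mean_le nu_poly (Im_cauchy_kernel_measurable z0) (Im_cauchy_kernel_le z0) (P n.+1) qn.
have := ler_wpM2l M0 (lerD (lexx (q ^+ n)) h).
move: hRe hIm; rewrite /r /poly_cauchy /=; set s := _ / 2 * (_ + _); lra.
Qed.

Lemma meixner_cauchy_stieltjes : b%:C * z ^+ 2 + a%:C * z + 1 != 0 ->
  cauchy_stieltjes nu z = ((1 + 2 * b)%:C * z + a%:C - w) / (2 * (b%:C * z ^+ 2 + a%:C * z + 1)).
Proof.
pose zeta := z - a%:C; have wE' : w ^+ 2 = zeta ^+ 2 - (4 * (1 + b))%:C by exact: wE.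
have zeta0 : 0 < complex.Im zeta by rewrite /zeta; case: (z) z0 => u v /= v0; rewrite subr0.
pose lp := (zeta + w) / 2; pose lm := (zeta - w) / 2.
have lplm : lp * lm = (1 + b)%:C.
  have -> : lp * lm = (zeta ^+ 2 - w ^+ 2) / 4 by rewrite /lp /lm; field.
  by rewrite wE' opprB addrC subrK rmorphM /= mulrC; field.
have lpDlm : lp + lm = zeta by rewrite /lp /lm; field.
have lt_lm_lp : `|lm| < `|lp|.
  by rewrite /lp /lm !normrM ltr_pM2r ?normr_gt0 // (upper_sqrt_norm_lt zeta0 w0 wE').
pose l := complex.Re `|lp|.
have lE : `|lp| = l%:C by exact: normCE.
have l0 : 0 < l by rewrite -ltcR -lE; exact: le_lt_trans (normr_ge0 lm) lt_lm_lp.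
have bl : 1 + b < l ^+ 2.
  have : `|lp * lm| < `|lp| * `|lp| by rewrite normrM ltr_pM2l // lE ltcR.
  rewrite lplm lE -rmorphM /= => h; rewrite -ltcR expr2; apply: le_lt_trans h.
  by rewrite real_ler_norm // complex_real.
(* A rate strictly below |lp| whose square exceeds 1 + b; the midpoint keeps it positive even when b
   = - 1. *)
pose q := Num.sqrt ((1 + b + l ^+ 2) / 2).
have h1 : 1 + b < (1 + b + l ^+ 2) / 2 < l ^+ 2 by apply/andP; split; lra.
have [h2 h3] := andP h1.
have m0 : 0 < (1 + b + l ^+ 2) / 2 by apply: le_lt_trans h2; exact: meixner_weight_ge0.
have q0 : 0 < q by rewrite sqrtr_gt0.
have q2 : q ^+ 2 = (1 + b + l ^+ 2) / 2 by rewrite sqr_sqrtr // ltW.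
have ql : q < l by rewrite -(ltr_pXn2r (n := 2)) ?nnegrE ?ltW // q2.
have bq : 1 + b <= q ^+ 2 by rewrite q2 ltW.
(* This combination removes the component along [lm] and is geometric of ratio [lp]. The indices are
   shifted because the weights equal 1 + b only from the second one on. *)
pose e n := r n.+2 - lm * r n.+1.
have eS n : e n.+1 = lp * e n.
  rewrite /e meixner_cauchy_rec /= -lplm -/zeta -lpDlm; ring.
have eE n : e n = lp ^+ n * e 0%N.
  by elim: n => [|n IH]; rewrite ?mul1r // eS IH exprS mulrA.
pose m := complex.Re `|lm|; have mE : `|lm| = m%:C by exact: normCE.
have m_ge0 : 0 <= m by rewrite -ler0c -mE.
have ele n : `|e n| <= ((complex.Im z)^-1 * (1 + 1) * (q + m) * q ^+ n)%:C.
  apply: le_trans (ler_normB _ _) _; rewrite normrM mE.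
  apply: le_trans (lerD (meixner_cauchy_le n.+1 q0 bq) (ler_wpM2l _ (meixner_cauchy_le n q0 bq))) _.
    by rewrite ler0c.
  by rewrite -rmorphM -rmorphD lecR exprS /=; lra.
(* [r] solves a recurrence with characteristic roots [lp] and [lm], and its
   growth rate [q < `|lp|] excludes the root [lp]. *)
have e0 : e 0%N = 0.
  apply/normr0_eq0; rewrite normCE; congr (_%:C).
  apply: (@geometric_le_eq0 _ _ ((complex.Im z)^-1 * (1 + 1) * (q + m)) (q / l)).
  - by rewrite -ler0c -normCE.
  - by rewrite divr_ge0 ?ltW //= ltr_pdivrMr // mul1r.
  move=> n; have := ele n; rewrite eE normrM normrX lE normCE -rmorphXn -rmorphM lecR /=.
  by rewrite expr_div_n mulrA ler_pdivlMr ?exprn_gt0 // mulrC.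
move=> d0; set G := cauchy_stieltjes nu z.
have r0 : r 0 = G by rewrite /r (poly_cauchy1 nu z).
have r1 : r 1 = z * G - 1.
  have := poly_cauchy_mulX nu_poly z0 1; rewrite mulr1 poly_cauchy1 poly_mean1.
  by rewrite /r meixner_poly1.
(* The first weight is 1, so r_2 = lm r_1 becomes lp r_1 = r_0. *)
have key : lp * (z * G - 1) = G.
  move: e0; rewrite /e meixner_cauchy_rec /= r1 r0 -/zeta -lpDlm mul1r => h.
  by apply/eqP; rewrite -subr_eq0 -h; apply/eqP; ring.
have -> : (1 + 2 * b)%:C = 1 + 2 * b%:C by rewrite rmorphD rmorphM rmorph1 rmorph_nat.
apply: quadratic_resolvent d0 => //.
have -> : 4 * (1 + b%:C) = (4 * (1 + b))%:C :> R[i] by rewrite rmorphM rmorph_nat rmorphD rmorph1.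
exact: wE.
Qed.

End Transform.

Lemma free_meixner_law : free_meixner a b nu.
Proof.
have b1 := meixner_weight_ge0; split; first by lra.
have [|w [wb w0]] := @upper_sqrt_exists R a (4 * (1 + b)); first by rewrite mulr_ge0.
exists w; split=> //; last first.
  by move=> z z0; apply: meixner_cauchy_stieltjes => //; [exact: w0|exact: wb.2].
move=> e e0; exists (1 + `|a| + (4 * (1 + b) + `|a|) / e) => z z0 zM.
by apply: (upper_sqrt_asymptotic _ e0 z0 (w0 z z0) (wb.2 z z0) zM); rewrite mulr_ge0.
Qed.

End FreeMeixnerLaw.

(** * Free Levy processes *)

Section Scaling.

(** The series with parameters c eta and c^2 sigma is rho(c z) / c. *)
Lemma mcoef_scale (F : comNzRingType) (eta sigma c : F) k n :
  mcoef (c * eta) (c ^+ 2 * sigma) k n * c ^+ n = c ^+ k * mcoef eta sigma k n.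
Proof.
elim: k n => [|k IH] [|n] /=; rewrite ?mulr0 ?mul0r ?mul1r ?mulr1 ?expr0 //.
have -> : c ^+ k.+1 * (mcoef eta sigma k n + eta * mcoef eta sigma k n.+1 + sigma * mcoef eta sigma k n.+2) =
  c * (c ^+ k * mcoef eta sigma k n) + c * eta * (c ^+ k * mcoef eta sigma k n.+1) +
  c * sigma * (c ^+ k * mcoef eta sigma k n.+2) by rewrite exprS; ring.
by rewrite -!IH !exprS; ring.
Qed.

Lemma appell_centered_scale (C : fieldType) (A : algType C) (tau : {scalar A})
    (S : A) (K : nat -> C) (T : nat -> A) (c : C) : appell_centered tau S K T ->
  appell_centered tau (c *: S) (fun k => c ^+ k.+1 * K k) (fun k => c ^+ k *: T k).
Proof.
move=> [[T0 TS] tT]; split; [split=> [|k]|move=> k].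
- by rewrite T0 scale1r.
- rewrite -scalerAl -scalerAr TS scalerA -exprS scalerDr scaler_sumr; congr (_ + _).
  apply: eq_bigr => i _; rewrite !scalerA; congr (_ *: _).
  by rewrite mulrAC -exprD addSn subnKC // -ltnS.
- by rewrite (scalarZ tau) tT; case: k => [|k]; rewrite ?expr0 ?mulr1 ?mulr0.
Qed.

Lemma free_family_inj (R : realType) (A : algType R[i]) (tau : {scalar A})
    (I J : eqType) (f : I -> J) (x : J -> A) :
  injective f -> free_family tau x -> free_family tau (x \o f).
Proof.
move=> fI hx w wn sw cw; pose g (p : I * {poly R[i]}) := (f p.1, p.2).
have := hx (map g w); rewrite big_map /=; apply.
- by rewrite -size_eq0 size_map size_eq0.
- rewrite sorted_map; apply: sub_sorted sw => p q /=.
  by rewrite /relpre /= (inj_eq fI).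
- by move=> _ /mapP[p pw ->]; exact: cw.
Qed.

Lemma same_law_moments (R : realType) (A : algType R[i]) (tau : {scalar A}) (X Y : A) :
  same_law tau X Y -> forall n, tau (X ^+ n) = tau (Y ^+ n).
Proof. by move=> [mu hX hY] n; rewrite (hX n).2 (hY n).2. Qed.

End Scaling.

Section FreeLevyRegression.
Variables (R : realType) (H : completeNormedModType R[i]) (ip : {dot H for Num.conj}).
Variables (A : algType R[i]) (star : A -> A) (rep : A -> H -> H).
Variables (tau : {scalar A}) (X : R -> A) (eta sigma : R) (C : R -> R -> R).
Hypothesis hip : hilbert_product ip.
Hypothesis vn : von_neumann_algebra star rep ip.
Hypothesis nf : normal_faithful_tracial_state star tau.
Hypothesis levy : free_levy_process star tau X.
Hypothesis mean0 : forall t : R, 0 <= t -> tau (X t) = 0.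
Hypothesis var : forall t : R, 0 <= t -> tau (X t ^+ 2) = t%:C.
Hypothesis regression : forall t u : R, 0 <= t -> t < u ->
  cond_variance star rep tau (X t) (X u)
    ((C t u)%:C *: (1 + (eta / u)%:C *: X u + (sigma / u ^+ 2)%:C *: X u ^+ 2)).

Lemma levy_appell t : 0 <= t -> exists T,
  appell_centered tau (X t) (fun k => (t * mcoef eta sigma k 1)%:C) T.
Proof.
rewrite le_eqVlt => /predU1P[<-|t0].
  (* The case t = 0: faithfulness of the trace makes the square vanish, so the powers of X 0 are
     Appell polynomials with all cumulants zero. *)
  have X2 : X 0 ^+ 2 = 0.
    apply: (tau_faithful nf); last by rewrite var.
    by exists (X 0); rewrite (levy_self_adjoint levy (lexx 0)) expr2.
  exists (fun k => X 0 ^+ k); split; [split=> [|k]|].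
  - by rewrite expr0.
  - by rewrite big1 ?addr0 ?exprS // => i _; rewrite mul0r scale0r.
  - case=> [|[|k]]; first by rewrite expr0 (tau_one nf).
      by rewrite expr1 mean0.
    by rewrite !exprS mulrA -expr2 X2 mul0r linear0.
pose h := t / 2; have h0 : 0 < h by rewrite divr_gt0.
have ht : h < t by rewrite /h; lra.
have htE : t - h = h by rewrite /h; lra.
pose x (c : bool) := if c then X h else X t - X h.
have free_x : free_family tau x.
  pose times (i : nat) := if i is 0%N then h else t.
  have := levy_free levy (k := 2) (t := times) (ltW h0).
  have hs i : (i.+1 < 2)%N -> times i < times i.+1 by case: i.
  pose f (c : bool) : 'I_2 := if c then ord0 else ord_max.
  have fI : injective f by case=> [] [].
  move=> /(_ hs) /(free_family_inj fI).
  have -> : (fun i : 'I_2 => increment X times i) \o f = x by apply/funext; case.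
  by [].
have mom n : tau (x true ^+ n) = tau (x false ^+ n).
  have := same_law_moments (levy_stationary levy (ltW h0) ht) n.
  by rewrite htE.
have [K [T [hT DT DDT]]] := free_sum_appell (tau_one nf) free_x mom (mean0 (ltW h0)).
have sumE : x true + x false = X t by rewrite /= addrC subrK.
have difE : x true - x false = X h + X h - X t by rewrite /= opprB addrA.
rewrite sumE in hT; rewrite difE in DT DDT.
exists T.
have DS n : tau ((X h + X h - X t) * X t ^+ n) = 0.
  pose f (a : A) : R[i] := tau ((X h + X h - X t) * a).
  have flin : scalar f.
    by move=> z a b; rewrite /f mulrDr -scalerAr linearD /= (scalarZ tau).
  pose f' : {scalar A} := HB.pack f (GRing.isLinear.Build _ _ _ _ f flin).
  exact: (appell_eq0_powers (f := f') hT.1 DT).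
have sa u : 0 <= u -> self_adjoint star (X u) by exact: (levy_self_adjoint levy).
have DDS := cond_variance_moments hip vn nf (sa t (ltW t0)) (sa h (ltW h0)) DS (regression (ltW h0) ht).
have KE := regression_cumulants t0 hT (mean0 (ltW t0)) (var (ltW t0)) DDT DDS erefl.
have -> : (fun k => (t * mcoef eta sigma k 1)%:C) = K by apply/funext => k; rewrite KE.
exact: hT.
Qed.

Lemma levy_R_transform t : 0 <= t -> exists (e : R) (w : R[i]^o -> R[i]^o),
  let D := [set z : R[i]^o | `|z| < e%:C] in
  [/\ 0 < e, sqrt_branch D (discriminant eta sigma) w, w 0 = 1 &
    R_transform_eq tau (X t) D (fun z => 2 * z * t%:C / (1 - eta%:C * z + w z))].
Proof.
move=> t0; have [T hT] := levy_appell t0.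
have [e [w [e0 wb w0 ser]]] := meixner_series eta sigma.
exists e, w; split; [exact: e0|exact: wb|exact: w0|].
exists (fun k => (t * mcoef eta sigma k.-1 1)%:C).
  exact: (appell_free_cumulants hT).
move=> z Dz.
have -> : series (fun k => (t * mcoef eta sigma k.+1.-1 1)%:C * z ^+ k : R[i]^o) =
    (fun N => t%:C * (\sum_(k < N) (mcoef eta sigma k 1)%:C * z ^+ k : R[i]^o)).
  apply/funext => N; rewrite /series /= big_mkord mulr_sumr; apply: eq_bigr => k _.
  by rewrite rmorphM mulrA.
have -> : 2 * z * t%:C / (1 - eta%:C * z + w z) = t%:C * (2 * z / (1 - eta%:C * z + w z)).
  by rewrite [RHS]mulrA [t%:C * _]mulrC.
by apply: cvgMl_tmp; exact: ser.
Qed.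

Lemma levy_free_meixner s t : 0 < s -> 0 < t ->
  exists2 mu : probability R R, has_law tau (X (s + t) - X s) mu &
    free_meixner_type (eta / Num.sqrt t) (sigma / t) mu.
Proof.
move=> s0 t0.
have st : s < s + t by rewrite ltrDl.
have [mu hmu] := levy_stationary levy (ltW s0) st.
rewrite [s + t]addrC addrK => hX; exists mu => //.
  by rewrite [t + s]addrC.
have [T hT] := levy_appell (ltW t0).
have r0 : 0 < Num.sqrt t by rewrite sqrtr_gt0.
pose c := (Num.sqrt t)^-1.
have c2 : c ^+ 2 = t^-1 by rewrite exprVn sqr_sqrtr // ltW.
have [nu [hnu nuE]] := has_law_scale c hX.
exists nu.
  apply: (free_meixner_law hnu (T := fun k => c%:C ^+ k *: T k)).
  have := appell_centered_scale c%:C hT.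
  have -> : (fun k => c%:C ^+ k.+1 * (t * mcoef eta sigma k 1)%:C) =
      (fun k => (mcoef (eta / Num.sqrt t) (sigma / t) k 1)%:C); last by [].
  apply/funext => k; rewrite -rmorphXn -rmorphM /=; congr (_%:C).
  have -> : eta / Num.sqrt t = c * eta by rewrite mulrC.
  have -> : sigma / t = c ^+ 2 * sigma by rewrite c2 mulrC.
  have -> : c ^+ k.+1 * (t * mcoef eta sigma k 1) = c * t * (c ^+ k * mcoef eta sigma k 1).
    by rewrite exprS; ring.
  rewrite -mcoef_scale expr1.
  have -> : c * t * (mcoef (c * eta) (c ^+ 2 * sigma) k 1 * c) =
    c ^+ 2 * t * mcoef (c * eta) (c ^+ 2 * sigma) k 1 by ring.
  by rewrite c2 mulVf ?mul1r // gt_eqF.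
exists (Num.sqrt t), 0; split; first by rewrite gt_eqF.
move=> B mB; rewrite /pushforward nuE.
  congr (mu _); apply/seteqP; split=> y /=;
    by rewrite addr0 mulVKf ?gt_eqF.
have -> : (fun x : R => Num.sqrt t * x + 0) = horner (Num.sqrt t *: 'X).
  by apply/funext => y; rewrite hornerZ hornerX addr0.
rewrite -[X in measurable X]setTI; exact: measurable_poly.
Qed.

Lemma levy_sigma_ge0 : 0 <= sigma.
Proof.
rewrite leNgt; apply/negP => sn.
(* At this time sigma / t = - 2, which is below the bound - 1 for a free Meixner law. *)
have t0 : 0 < - sigma / 2 by rewrite divr_gt0 // oppr_gt0.
have [mu _ [nu [b1 _] _]] := levy_free_meixner ltr01 t0.
move: b1; have -> : sigma / (- sigma / 2) = - 2 by field; rewrite lt_eqF.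
by lra.
Qed.

End FreeLevyRegression.

Theorem proposition3p4 (R : realType)
    (H : completeNormedModType R[i]) (ip : {dot H for Num.conj})
    (A : algType R[i]) (star : A -> A) (rep : A -> H -> H)
    (tau : {scalar A}) (X : R -> A) (eta sigma : R) (C : R -> R -> R) :
  hilbert_product ip ->
  von_neumann_algebra star rep ip ->
  normal_faithful_tracial_state star tau ->
  free_levy_process star tau X ->
  (forall t : R, 0 <= t -> tau (X t) = 0) ->
  (forall t : R, 0 <= t -> tau (X t ^+ 2) = t%:C) ->
  (forall t u : R, 0 <= t -> t < u ->
     cond_variance star rep tau (X t) (X u)
       ((C t u)%:C *: (1 + (eta / u)%:C *: X u
                         + (sigma / u ^+ 2)%:C *: X u ^+ 2))) ->
  (forall s t : R, 0 < s -> 0 < t ->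
     0 <= sigma / t /\
     exists2 mu : probability R R, has_law tau (X (s + t) - X s) mu &
       free_meixner_type (eta / Num.sqrt t) (sigma / t) mu) /\
  (forall t : R, 0 <= t ->
     exists (e : R) (w : R[i]^o -> R[i]^o), let D := [set z | `|z| < e%:C] in
     [/\ 0 < e,
         sqrt_branch D
           (fun z => (1 - eta%:C * z) ^+ 2 - 4 * z ^+ 2 * sigma%:C) w,
         w 0 = 1
       & R_transform_eq tau (X t) D
           (fun z => 2 * z * t%:C / (1 - eta%:C * z + w z))]).
Proof.
move=> hip vn nf levy mean0 var regression; split.
  move=> s t s0 t0; split.
    by rewrite divr_ge0 ?(levy_sigma_ge0 hip vn nf levy mean0 var regression) // ltW.
  exact: (levy_free_meixner hip vn nf levy mean0 var regression).
by move=> t; exact: (levy_R_transform hip vn nf levy mean0 var regression).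
Qed.
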